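(* Let $\phi\in(0,\pi/2)$ and let $n=2k+1$ be odd, with $k\ge 1$ an integer. A function $g\in C^\infty(\mathbb{R}^{2k}\times\mathbb{R})$ is in the range of $\mathcal{C}_\phi$ on $C_0^\infty(\mathbb{R}^{2k}\times\mathbb{R})$ (i.e. $g=\mathcal{C}_\phi[f]$ for some $f\in C_0^\infty(\mathbb{R}^{2k}\times\mathbb{R})$) if and only if the following conditions are satisfied: (i) $\square_\phi^{2k}\mathcal{C}_\phi^{1}[g](\boldsymbol{x},t)$ has compact support. (ii) $\int_{-\infty}^{\infty}\square_\phi^{2k}\mathcal{C}_\phi^{1}[g](\boldsymbol{x},t)\,dt=0$ for every $\boldsymbol{x}\in\mathbb{R}^{2k}$. (iii) $\operatorname{supp} g\subseteq H_{t_0}$ for some $t_0\in\mathbb{R}$.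
   Context: Points of $\mathbb{R}^n=\mathbb{R}^{n-1}\times\mathbb{R}$ are written $(\boldsymbol{x},t)$. $C_0^\infty$ denotes smooth functions with compact support. For $t_0\in\mathbb{R}$, $H_{t_0}=\{(\boldsymbol{x},t): t\le t_0\}$. The modified d'Alembertian is $\square_\phi=\frac{\partial^2}{\partial t^2}-(\tan^2\phi)\,\Delta_{\boldsymbol{x}}$, where $\Delta_{\boldsymbol{x}}$ is the Laplacian in $\boldsymbol{x}\in\mathbb{R}^{n-1}$. The restricted conical Radon transform $\mathcal{C}_\phi$ (half-opening angle $\phi$, axis direction $\boldsymbol{e}_n=(\boldsymbol{0},1)$) is convolution with $D_\phi(\boldsymbol{x},t)=\delta(-t-|(\cot\phi)\boldsymbol{x}|)$, $\delta$ the Dirac delta, that is $$\mathcal{C}_\phi[f](\boldsymbol{x},t)=\int_{\mathbb{R}^{n-1}} f(\boldsymbol{x}+\boldsymbol{u},\,t+(\cot\phi)|\boldsymbol{u}|)\,d\boldsymbol{u}.$$ Up to a positive constant factor depending only on $\phi$ this is the integral of $f$ with respect to surface measure over the cone with vertex $(\boldsymbol{x},t)$, axis direction $\boldsymbol{e}_n$ and half-opening angle $\phi$. The weighted transform $\mathcal{C}^1_\phi$ is convolution with $D^1_\phi(\boldsymbol{x},t)=|((\cot\phi)\boldsymbol{x},t)|^{-1}\delta(-t-|(\cot\phi)\boldsymbol{x}|)$, that is $$\mathcal{C}^1_\phi[f](\boldsymbol{x},t)=\int_{\mathbb{R}^{n-1}} \frac{f(\boldsymbol{x}+\boldsymbol{u},\,t+(\cot\phi)|\boldsymbol{u}|)}{\sqrt2\,(\cot\phi)|\boldsymbol{u}|}\,d\boldsymbol{u}.$$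 It is well defined on smooth functions supported in some $H_{t_0}$, because the integrand then has bounded support in $\boldsymbol{u}$; conditions (i) and (ii) are understood for $g$ satisfying (iii). *)

(* Defs.v *)
From HB Require Import structures.
From mathcomp Require Import all_boot all_order all_algebra.
From mathcomp Require Import all_classical all_reals all_analysis.

Set Implicit Arguments.
Unset Strict Implicit.
Unset Printing Implicit Defensive.

Import Order.TTheory GRing.Theory Num.Theory.
Import numFieldNormedType.Exports.

Local Open Scope classical_set_scope.
Local Open Scope ring_scope.

(* The library equips tuples, but not row vectors, with a measurable structure:
   Lebesgue measure on [R^n] is built on [n.-tuple R], and integrands on
   ['rV[R]_n] are precomposed with [row_of_tuple]. *)

Section cons_measure.
Context {R : realType} {n : nat}.
Variable mu : {sigma_finite_measure set (n.-tuple (measurableTypeR R)) -> \bar R}.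

Let T := measurableTypeR R.

Definition tuple_cons (p : T * n.-tuple T) : n.+1.-tuple T :=
  [tuple of p.1 :: p.2].

Lemma measurable_tuple_cons : measurable_fun [set: T * n.-tuple T] tuple_cons.
Proof. exact: measurable_cons. Qed.

Definition cons_measure : set (n.+1.-tuple T) -> \bar R :=
  pushforward (@lebesgue_measure R \x mu)%E tuple_cons.

Let cons_measure0 : cons_measure set0 = 0%E.
Proof. by rewrite /cons_measure /pushforward preimage_set0 measure0. Qed.

Let cons_measure_ge0 A : (0 <= cons_measure A)%E.
Proof. by rewrite /cons_measure /pushforward; exact: measure_ge0. Qed.

Let cons_measure_sigma_additive : semi_sigma_additive cons_measure.
Proof.
move=> F mF tF mUF; rewrite /cons_measure /pushforward preimage_bigcup.
have mp A : measurable A -> measurable (tuple_cons @^-1` A).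
  by move=> mA; rewrite -[X in measurable X]setTI; exact: measurable_tuple_cons.
apply: measure_semi_sigma_additive.
- by move=> k; exact: mp.
- apply/trivIsetP => /= i j _ _ ij; rewrite -preimage_setI.
  by move/trivIsetP : tF => /(_ _ _ _ _ ij) ->//; rewrite preimage_set0.
- by rewrite -preimage_bigcup; exact: mp.
Qed.

HB.instance Definition _ := isMeasure.Build _ _ _ cons_measure
  cons_measure0 cons_measure_ge0 cons_measure_sigma_additive.

Let cons_measure_sigma_finite : sigma_finite setT cons_measure.
Proof.
have /sigma_finiteP[F [TF ndF Foo]] := sigma_finiteT (@lebesgue_measure R).
have /sigma_finiteP[G [TG ndG Goo]] := sigma_finiteT mu.
pose h (x : n.+1.-tuple T) : T * n.-tuple T := (thead x, [tuple of behead x]).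
have Kh : cancel tuple_cons h.
  by case=> a b; congr pair; apply: val_inj.
have mh : measurable_fun setT h.
  apply: measurable_fun_pair; first exact: measurable_tnth.
  exact: measurable_behead.
exists (fun k => h @^-1` (F k `*` G k)).
  rewrite -preimage_bigcup -[LHS](preimage_setT h); congr (h @^-1` _).
  rewrite -setXTT TF TG predeqE => -[x y]; split.
    move=> [/= [i _ Fix] [j _ Gjy]]; exists (maxn i j) => //; split.
    - by move: x Fix; exact/subsetPset/ndF/leq_maxl.
    - by move: y Gjy; exact/subsetPset/ndG/leq_maxr.
  by move=> [i _ []/= ? ?]; split; exists i.
move=> k; have [mF Fo] := Foo k; have [mG Go] := Goo k; split.
  by rewrite -[X in measurable X]setTI; apply: mh => //; exact: measurableX.
rewrite /cons_measure /pushforward -comp_preimage.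
rewrite (_ : h \o tuple_cons = id); last by apply/funext => x; exact: Kh.
by rewrite preimage_id product_measure1E// lte_mul_pinfty// ge0_fin_numE.
Qed.

HB.instance Definition _ := Measure_isSigmaFinite.Build _ _ _ cons_measure
  cons_measure_sigma_finite.

End cons_measure.

Fixpoint lebesgue_tuple {R : realType} (n : nat) :
    {sigma_finite_measure set (n.-tuple (measurableTypeR R)) -> \bar R} :=
  match n with
  | 0 => dirac [tuple]
  | m.+1 => cons_measure (lebesgue_tuple m)
  end.

Definition row_of_tuple {R : realType} {n : nat}
    (u : n.-tuple (measurableTypeR R)) : 'rV[R]_n := \row_i tnth u i.

(* Euclidean norm; the library norm on ['rV[R]_n] is the sup norm. *)
Definition enorm {R : realType} {n : nat} (x : 'rV[R]_n) : R :=
  Num.sqrt (\sum_i x 0 i ^+ 2).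

(* [Ck j f] : [f] has continuous iterated directional derivatives of all
   orders up to [j] *)
Fixpoint Ck {R : realType} {V : normedModType R} (j : nat) (f : V -> R) : Prop :=
  match j with
  | 0 => continuous f
  | i.+1 => continuous f /\
      forall v, (forall x, derivable f x v) /\ Ck i (fun x => 'D_v f x)
  end.

Definition smooth {R : realType} {V : normedModType R} (f : V -> R) : Prop :=
  forall j, Ck j f.

Definition supp {R : realType} {V : normedModType R} (f : V -> R) : set V :=
  closure [set x | f x != 0].

Definition compactly_supported {R : realType} {V : normedModType R}
  (f : V -> R) : Prop := compact (supp f).

Definition halfspace {R : realType} {m : nat} (t0 : R) : set ('rV[R]_m * R) :=
  [set p | p.2 <= t0].

Section conical.
Context {R : realType}.
Variable phi : R.

Definition cot : R := (tan phi)^-1.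

Definition dt {m} (f : 'rV[R]_m * R -> R) : 'rV[R]_m * R -> R :=
  fun p => 'D_(0, 1) f p.

Definition dx {m} (i : 'I_m) (f : 'rV[R]_m * R -> R) : 'rV[R]_m * R -> R :=
  fun p => 'D_(delta_mx 0 i, 0) f p.

Definition box {m} (f : 'rV[R]_m * R -> R) : 'rV[R]_m * R -> R :=
  fun p => dt (dt f) p - tan phi ^+ 2 * \sum_(i < m) dx i (dx i f) p.

(* Convolution with [delta (- t - |cot x|)], after the substitution [u := - v]. *)
Definition conical {m} (f : 'rV[R]_m * R -> R) : 'rV[R]_m * R -> R :=
  fun p => \int[lebesgue_tuple m]_u
    (let v := row_of_tuple u in f (p.1 + v, p.2 + cot * enorm v)).

(* On the cone [-t = cot * |x|] the weight [1 / |(cot x, t)|] is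
   [1 / (sqrt 2 * cot * |x|)].  At [v = 0], a null set for [m > 0], the
   quotient is [0]. *)
Definition conical1 {m} (f : 'rV[R]_m * R -> R) : 'rV[R]_m * R -> R :=
  fun p => \int[lebesgue_tuple m]_u
    (let v := row_of_tuple u in
     f (p.1 + v, p.2 + cot * enorm v) / (Num.sqrt 2 * cot * enorm v)).

End conical.

(* Main.v *)
(* Write C for the conical transform, N for its variant with weight 1/|u| and
   [] for the modified d'Alembertian, m = n - 1, a = cot phi, b = tan^2 phi.
   Integrating by parts along coordinate directions on the cone gives
     C (x_i []u) - x_i C []u = (m + 1) b C d_i u,
     (m - 1) N d_t u = - a C []u.
   As []^(m+1) x_i = x_i []^(m+1) - 2 (m + 1) b d_i []^m, the first identity
   makes C C []^(m+1) commute with multiplication by each x_i.  By Hadamard's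
   lemma and translation invariance this operator is then determined by its
   values on functions of t alone.  There it is (C d_t^m)^2 d_t^2, and C d_t^m
   commutes with multiplication by t, so it is a nonzero scalar.  Hence
   C C []^(m+1) = K d_t^2, and the second identity turns this into
   []^m N C = K' d_t together with the injectivity of []^m N.  So g = C f
   exactly when []^m N g = K' d_t f, and such an f with compact support exists
   if and only if []^m N g has compact support and integral 0 along each
   vertical line. *)
Require Import Defs.
From HB Require Import structures.
From mathcomp Require Import all_boot all_order all_algebra.
From mathcomp Require Import all_classical all_reals all_analysis.
From mathcomp Require Import measurable_realfun ring lra.
Import Order.TTheory GRing.Theory Num.Theory.
Import numFieldNormedType.Exports.
Local Open Scope classical_set_scope.
Local Open Scope ring_scope.

(** * Directional derivatives and smooth functions *)

(** All identities are proved on smooth functions that vanish after some time ([past_smooth]). There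
    [d_t] is injective, so an equality that integration by parts yields only after applying [d_t]
    can be stripped of it. The obstacle is the vertex, where [1 / |u|] and [u_i / |u|] are singular.
    A line in direction [i] avoids the vertex as soon as some other coordinate [j] is nonzero, and
    the points with [u_j = 0] form a null set; so integration by parts is done line by line, for
    almost every line. Here [m >= 2] enters, as it does in the integrability of [1 / |u|]. The
    composition of the two cone transforms is never written as a kernel, and the scalar on functions
    of [t] is never computed. It exists because an operator commuting with multiplication by [t]
    sends a function vanishing at time 0 to one that vanishes there too. It is nonzero by strict
    positivity: [C (e^2) = 0] would force [e = 0] at the vertex. *)

Section directional.
Context {R : realType} {V : normedModType R}.
Implicit Types (f g : V -> R) (p v w : V).

Lemma is_derive_line f p v (s : R) : derivable f (p + s *: v) v ->
  is_derive s 1 (fun s => f (p + s *: v)) ('D_v f (p + s *: v)).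
Proof.
have E : (fun h : R => h^-1 *: (((fun s => f (p + s *: v)) \o shift s) (h *: 1)
      - f (p + s *: v))) =
    (fun h : R => h^-1 *: ((f \o shift (p + s *: v)) (h *: v) - f (p + s *: v))).
  apply/funext => h /=; congr (_ *: (f _ - _)).
  by rewrite [h *: 1]mulr1 scalerDl addrCA.
by move=> df; split; rewrite /derivable/derive E.
Qed.

Lemma MVT_line f p v (h : R) : (forall q, derivable f q v) ->
  exists2 c, `|c| <= `|h| & f (p + h *: v) - f p = h * 'D_v f (p + c *: v).
Proof.
move=> df.
have dl (s : R) : is_derive s 1 (fun s => f (p + s *: v)) ('D_v f (p + s *: v)).
  exact: is_derive_line.
have cl a b : {within `[a, b], continuous (fun s : R => f (p + s *: v))}.
  by apply: derivable_within_continuous => x _; exact: ex_derive.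
have [h0|h0] := leP 0 h.
  have [c /[!in_itv]/= /andP[c0 ch]] := @MVT_segment R (fun s => f (p + s *: v))
    (fun s => 'D_v f (p + s *: v)) 0 h h0 (fun x _ => dl x) (cl _ _).
  rewrite scale0r addr0 subr0 => ->; exists c; last by rewrite mulrC.
  by rewrite !ger0_norm.
have [c /[!in_itv]/= /andP[c0 ch]] := @MVT_segment R (fun s => f (p + s *: v))
  (fun s => 'D_v f (p + s *: v)) h 0 (ltW h0) (fun x _ => dl x) (cl _ _).
rewrite scale0r addr0 sub0r => E; exists c; last by rewrite -opprB E; lra.
by rewrite !ler0_norm ?lerN2// ltW.
Qed.

(** At a zero of [u] the difference quotient of the product is that of [u] times a value of [Phi],
    so continuity of [Phi] replaces its differentiability. *)
Lemma is_derive_mul0 (u Phi : R -> R) (s du : R) :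
  is_derive s 1 u du -> u s = 0 -> {for s, continuous Phi} ->
  is_derive s 1 (fun x => u x * Phi x) (du * Phi s).
Proof.
move=> dfu us cP.
have H : h^-1 *: (((fun x => u x * Phi x) \o shift s) (h *: 1) - u s * Phi s)
    @[h --> 0^'] --> du * Phi s.
  rewrite us mul0r.
  under eq_fun do rewrite /= subr0 scalerAl.
  apply: cvgM.
    have := @ex_derive _ _ _ _ _ _ _ dfu.
    rewrite /derivable us; under eq_fun do rewrite subr0.
    move=> c; have := @derive_val _ _ _ _ _ _ _ dfu; rewrite /derive us.
    under eq_fun do rewrite subr0.
    by move=> <-.
  have hs : (fun h : R => h *: (1 : R) + s) @ 0^' --> s.
    rewrite -[X in _ --> X]add0r -[X in _ --> X + _](scale0r (1 : R)).
    by apply: cvgD; [apply: cvgZr_tmp; exact: cvg_within|exact: cvg_cst].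
  exact: (cvg_comp _ _ hs cP).
by split; [apply/cvg_ex; eexists; exact: H|exact/cvg_lim].
Qed.

(** The mean value theorem writes the move along [v] as [a x - a s] times a value of ['D_v f] at a
    nearby point. This factor vanishes at [s], so [is_derive_mul0] needs only continuity of
    ['D_v f]; what remains moves along [w] alone. *)
Lemma is_derive_curve f p v w (a b : R -> R) (s da db : R) :
  (forall q, derivable f q v) -> (forall q, derivable f q w) ->
  continuous ('D_v f) ->
  is_derive s 1 a da -> is_derive s 1 b db ->
  is_derive s 1 (fun s => f (p + a s *: v + b s *: w))
    (da * 'D_v f (p + a s *: v + b s *: w)
     + db * 'D_w f (p + a s *: v + b s *: w)).
Proof.
move=> dv dw cv ha hb.
have cc x : exists c : R, `|c| <= `|a x - a s| /\
    f (p + a x *: v + b x *: w) =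
    f (p + a s *: v + b x *: w) + (a x - a s) * 'D_v f (p + a s *: v + b x *: w + c *: v).
  have [c c1 c2] := MVT_line f (p + a s *: v + b x *: w) v (a x - a s) dv.
  exists c; split => //; rewrite -c2 [RHS]addrC subrK; congr f.
  by rewrite [RHS]addrAC; congr (_ + _); rewrite -addrA -scalerDl [a s + _]addrC subrK.
have [c /all_and2[c1 c2]] := choice cc.
have -> : (fun s => f (p + a s *: v + b s *: w)) =
  (fun x => (f (p + a s *: v + b x *: w)) +
     (a x - a s) * 'D_v f (p + a s *: v + b x *: w + c x *: v)).
  by apply/funext => x; rewrite c2.
have cs0 : c s = 0.
  by have := c1 s; rewrite subrr normr0 normr_le0 => /eqP.
have ca : {for s, continuous a}.
  by apply: differentiable_continuous; apply/derivable1_diffP; exact: ex_derive.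
have cb : {for s, continuous b}.
  by apply: differentiable_continuous; apply/derivable1_diffP; exact: ex_derive.
rewrite [da * _ + _]addrC; apply: is_deriveD.
  have -> : db * 'D_w f (p + a s *: v + b s *: w) =
     ('D_w f (p + a s *: v + b s *: w)) * db by rewrite mulrC.
  apply: (@is_derive1_comp _ (fun x => f (p + a s *: v + x *: w)) b s).
  by have := is_derive_line f (p + a s *: v) w (b s) (dw _).
have -> : 'D_v f (p + a s *: v + b s *: w) =
   'D_v f (p + a s *: v + b s *: w + c s *: v) by rewrite cs0 scale0r addr0.
apply: (@is_derive_mul0 (fun x => a x - a s)
  (fun x => 'D_v f (p + a s *: v + b x *: w + c x *: v))); last 2 first.
- by rewrite subrr.
- apply: (@continuous_comp _ _ _ (fun x => p + a s *: v + b x *: w + c x *: v) ('D_v f)).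
  + apply: cvgD.
      by apply: cvgD; [exact: cvg_cst|apply: cvgZr_tmp; exact: cb].
    apply: cvgZr_tmp.
    rewrite /continuous_at cs0; apply/norm_cvg0P.
    apply: (@squeeze_cvgr _ _ _ _ (cst 0) (fun x => `|a x - a s|)).
    * by near=> x; rewrite /= normr_ge0 c1.
    * exact: cvg_cst.
    * by apply/norm_cvg0P; apply/subr_cvg0; exact: ca.
  + exact: cv.
- by rewrite -[da]subr0; exact: (is_deriveB ha (is_derive_cst (a s) s 1)).
Unshelve. all: end_near. Qed.

(** [Ck] provides directional derivatives without linearity in the direction. Additivity is the
    chain rule along the curve [p + s v + s w]. *)
Lemma derive_dirD f p v w :
  (forall q, derivable f q v) -> (forall q, derivable f q w) ->
  continuous ('D_v f) ->
  'D_(v + w) f p = 'D_v f p + 'D_w f p.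
Proof.
move=> dv dw cv.
have H := is_derive_curve f p v w id id 0 1 1 dv dw cv (is_derive_id _ _) (is_derive_id _ _).
have := @derive_val _ _ _ _ _ _ _ H.
rewrite !mul1r !scale0r !addr0 => <-.
rewrite /derive; apply: (congr1 (fun F : R -> R => lim (F @ 0^'))); apply/funext => h /=.
by rewrite [h *: 1]mulr1 !addr0 !scale0r !addr0 [h *: (v + w)]scalerDr (addrC _ p) addrA.
Qed.

Lemma derive_translate f p q v : derivable f (p + q) v ->
  is_derive p v (fun x => f (x + q)) ('D_v f (p + q)).
Proof.
have E : (fun h : R => h^-1 *: (((fun x => f (x + q)) \o shift p) (h *: v)
      - f (p + q))) =
    (fun h : R => h^-1 *: ((f \o shift (p + q)) (h *: v) - f (p + q))).
  by apply/funext => h /=; rewrite addrA.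
by move=> df; split; rewrite /derivable/derive E.
Qed.

Lemma second_difference f p v w (h : R) :
  (forall q, derivable f q v) -> (forall q, derivable ('D_v f) q w) ->
  exists c : R * R, [/\ `|c.1| <= `|h|, `|c.2| <= `|h| &
    f (p + h *: v + h *: w) - f (p + h *: v) - (f (p + h *: w) - f p) =
    h * (h * 'D_w ('D_v f) (p + c.1 *: v + c.2 *: w))].
Proof.
move=> dv dvw.
pose g x := f (x + h *: w) - f x.
have dg x : is_derive x v g ('D_v f (x + h *: w) - 'D_v f x).
  by apply: is_deriveB; [exact: derive_translate|exact: derivableP].
have [c c1 E] := MVT_line g p v h (fun q => @ex_derive _ _ _ _ _ _ _ (dg q)).
rewrite (@derive_val _ _ _ _ _ _ _ (dg _)) in E.
have [c' c'1 E'] := MVT_line ('D_v f) (p + c *: v) w h dvw.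
by exists (c, c'); split => //=; rewrite -E' -E.
Qed.

Lemma cvg_le_norm (c : R -> R) : (forall h, `|c h| <= `|h|) ->
  c h @[h --> 0^'] --> (0 : R).
Proof.
move=> ch; apply/norm_cvg0P.
apply: (@squeeze_cvgr _ _ _ _ (cst 0) (fun x : R => `|x|)).
- by near=> x; rewrite /= normr_ge0 ch.
- exact: cvg_cst.
- by apply/norm_cvg0P; exact: cvg_within.
Unshelve. all: end_near. Qed.

(** Schwarz's argument: the second difference over a parallelogram is symmetric in [v] and [w], and
    divided by [h^2] it tends to either mixed derivative, according to the order in which the mean
    value theorem is applied. *)
Lemma derive_commute f p v w :
  (forall q, derivable f q v) -> (forall q, derivable f q w) ->
  (forall q, derivable ('D_v f) q w) -> (forall q, derivable ('D_w f) q v) ->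
  continuous ('D_w ('D_v f)) -> continuous ('D_v ('D_w f)) ->
  'D_w ('D_v f) p = 'D_v ('D_w f) p.
Proof.
move=> dv dw dvw dwv cvw cwv.
have /choice[c cP] : forall h : R, _ := fun h => second_difference f p v w h dv dvw.
have /choice[d dP] : forall h : R, _ := fun h => second_difference f p w v h dw dwv.
have lim_small (F : V -> R) (a b : V) (e : R -> R * R) : {for p, continuous F} ->
    (forall h, `|(e h).1| <= `|h|) -> (forall h, `|(e h).2| <= `|h|) ->
    F (p + (e h).1 *: a + (e h).2 *: b) @[h --> 0^'] --> F p.
  move=> cF e1 e2.
  have H : (p + (e h).1 *: a + (e h).2 *: b) @[h --> 0^'] --> p.
    rewrite -[X in _ --> X]addr0 -[X in _ --> X + _]addr0.
    rewrite -[X in _ --> _ + X + _](scale0r a) -[X in _ --> _ + X](scale0r b).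
    apply: cvgD; last by apply: cvgZr_tmp; exact: cvg_le_norm.
    by apply: cvgD; [exact: cvg_cst|apply: cvgZr_tmp; exact: cvg_le_norm].
  exact: (cvg_comp _ _ H cF).
have L1 := lim_small _ v w c (cvw p) (fun h => let: And3 x _ _ := cP h in x)
  (fun h => let: And3 _ x _ := cP h in x).
have L2 := lim_small _ w v d (cwv p) (fun h => let: And3 x _ _ := dP h in x)
  (fun h => let: And3 _ x _ := dP h in x).
apply: (cvg_unique _ L1); first exact: norm_hausdorff.
apply: cvg_trans L2; apply: near_eq_cvg; near=> h.
have h0 : h != 0 by near: h; exact: nbhs_dnbhs_neq.
have [_ _ E1] := cP h; have [_ _ E2] := dP h.
apply/(mulfI h0)/(mulfI h0)/(etrans (esym E2))/(etrans _ E1); rewrite (addrAC p).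
have swap (x y z t : R) : x - y - (z - t) = x - z - (y - t) by ring.
exact: swap.
Unshelve. all: end_near. Qed.

End directional.

Section smooth_algebra.
Context {R : realType} {V : normedModType R}.
Implicit Types (f g : V -> R) (v : V).

Lemma CkS j f : Ck j.+1 f -> Ck j f.
Proof.
elim: j f => [|j IH] f [cf Df]; first exact: cf.
by split => // v; have [df /IH] := Df v.
Qed.

Lemma smooth_continuous f : smooth f -> continuous f.
Proof. by move=> /(_ 0%N). Qed.

Lemma smooth_derivable f v x : smooth f -> derivable f x v.
Proof. by move=> /(_ 1%N)[_ /(_ v)[]]. Qed.

Lemma smooth_derive f v : smooth f -> smooth ('D_v f).
Proof. by move=> sf j; have [_ /(_ v)[]] := sf j.+1. Qed.

(** Coinduction for classes stable under directional derivatives, such as the constants or the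
    translates of smooth functions. *)
Lemma smooth_coind (Q : (V -> R) -> Prop) :
  (forall f, Q f -> continuous f /\
    forall v, (forall x, derivable f x v) /\ Q ('D_v f)) ->
  forall f, Q f -> smooth f.
Proof.
move=> QP f Qf j; elim: j f Qf => [|j IH] f /QP[cf Df]; first exact: cf.
by split => // v; have [df /IH] := Df v.
Qed.

Lemma smooth_cst (c : R) : smooth (fun _ : V => c).
Proof.
apply: (smooth_coind (fun f => exists c : R, f = cst c)); last by exists c.
move=> _ [{}c ->]; split=> [x|v]; first exact: cvg_cst.
split; first by move=> x; exact: derivable_cst.
by exists 0; apply/funext => x; rewrite derive_cst.
Qed.

Lemma CkD j f g : Ck j f -> Ck j g -> Ck j (fun x => f x + g x).
Proof.
elim: j f g => [|j IH] f g.
  by move=> cf cg x; apply: cvgD; [exact: cf|exact: cg].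
move=> [cf Df] [cg Dg]; split=> [x|v].
  by apply: cvgD; [exact: cf|exact: cg].
have [df D1] := Df v; have [dg D2] := Dg v; split=> [x|].
  exact: (@derivableD _ _ _ f g).
have -> : 'D_v (fun x => f x + g x) = (fun x => 'D_v f x + 'D_v g x).
  by apply/funext => x; exact: (@deriveD _ _ _ f g).
exact: IH.
Qed.

Lemma CkM j f g : Ck j f -> Ck j g -> Ck j (fun x => f x * g x).
Proof.
elim: j f g => [|j IH] f g.
  by move=> cf cg x; apply: cvgM; [exact: cf|exact: cg].
move=> /[dup] /CkS kf [cf Df] /[dup] /CkS kg [cg Dg]; split=> [x|v].
  by apply: cvgM; [exact: cf|exact: cg].
have [df D1] := Df v; have [dg D2] := Dg v; split=> [x|].
  exact: (@derivableM _ _ f g).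
have -> : 'D_v (fun x => f x * g x) = (fun x => f x * 'D_v g x + g x * 'D_v f x).
  by apply/funext => x; exact: (@deriveM _ _ f g).
by apply: CkD; exact: IH.
Qed.

Lemma smoothD f g : smooth f -> smooth g -> smooth (fun x => f x + g x).
Proof. by move=> sf sg j; exact: CkD. Qed.

Lemma smoothM f g : smooth f -> smooth g -> smooth (fun x => f x * g x).
Proof. by move=> sf sg j; exact: CkM. Qed.

Lemma smooth_linear (l : V -> R) : continuous l ->
  (forall (h : R) v x, l (h *: v + x) = h * l v + l x) -> smooth l.
Proof.
move=> cl ll j; case: j => [|j]; first exact: cl.
have D v x : is_derive x v l (l v).
  have E : h^-1 *: ((l \o shift x) (h *: v) - l x) @[h --> 0^'] --> l v.
    apply: cvg_near_cst; near=> h; have h0 : h != 0.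
      by near: h; exact: nbhs_dnbhs_neq.
    by rewrite /= ll addrK scalerA mulVf// scale1r.
  by split; [apply/cvg_ex; eexists; exact: E|exact/cvg_lim].
split => // v; split=> [x|]; first exact: (@ex_derive _ _ _ _ _ _ _ (D v x)).
have -> : 'D_v l = fun=> l v.
  by apply/funext => x; exact: (@derive_val _ _ _ _ _ _ _ (D v x)).
exact: smooth_cst.
Unshelve. all: end_near. Qed.

End smooth_algebra.

(** * Measurability, compactness and sequential continuity on row vectors *)

Lemma measurable_fun_countable {R : realType} d (Y : measurableType d)
    (T : countType) (key : Y -> T) (F : T -> R) :
  (forall z, measurable (key @^-1` [set z])) -> measurable_fun setT (F \o key).
Proof.
move=> mk _ B mB; rewrite setTI.
have -> : (F \o key) @^-1` B = \bigcup_n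
    (if unpickle n is Some z then
       (if `[< B (F z) >] then key @^-1` [set z] else set0) else set0).
  apply/seteqP; split=> [y By|y [n _]].
    exists (pickle (key y)) => //; rewrite pickleK.
    by case: asboolP.
  by case: unpickle => // z; case: asboolP => // Bz /= kz; rewrite kz.
apply: bigcupT_measurable => n; case: unpickle => // z.
by case: asboolP.
Qed.

Lemma rV_norm_leP {R : realType} {m} (x : 'rV[R]_m) (e : R) : 0 <= e ->
  (`|x| <= e) <-> (forall i, `|x 0 i| <= e).
Proof.
move=> e0; rewrite -[`|x|]/(mx_norm x) mx_normrE.
split=> [/bigmax_leP[_ h] i|h]; first exact: (h (0, i)).
by apply/bigmax_leP; split=> // -[i j] _; rewrite ord1 /=; exact: h.
Qed.

Lemma cvg_rV {R : realType} {m} T (F : set_system T) (FF : Filter F)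
    (f : T -> 'rV[R]_m) (l : 'rV[R]_m) :
  (forall i, f x 0 i @[x --> F] --> l 0 i) -> f x @[x --> F] --> l.
Proof.
move=> fl; apply/cvgrPdist_le => e e0.
have : \forall x \near F, forall i : 'I_m, `|l 0 i - f x 0 i| <= e.
  by apply: filter_forall => i; have /cvgrPdist_le := fl i; apply.
apply: filterS => x h; apply/rV_norm_leP; first exact: ltW.
by move=> i; rewrite !mxE.
Qed.

Section measurable_continuous.
Context {R : realType} d (Y : measurableType d) (m : nat).

Let q (n : nat) (x : R) : R := (Num.floor (n.+1%:R * x))%:~R / n.+1%:R.

Let q_cvg x : q n x @[n --> \oo] --> x.
Proof.
apply/cvgrPdist_le => e e0; near=> n.
have n0 : (0 : R) < n.+1%:R by [].
have fl : (Num.floor (n.+1%:R * x))%:~R <= n.+1%:R * x by exact: floor_le.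
have fr : n.+1%:R * x < (Num.floor (n.+1%:R * x))%:~R + 1.
  by have := floorD1_gt (n.+1%:R * x); rewrite intrD.
have ne : n.+1%:R^-1 <= e.
  near: n; have := near_infty_natSinv_lt (PosNum e0).
  by apply: filterS => n /ltW.
apply: le_trans ne; rewrite /q.
have -> : x - (Num.floor (n.+1%:R * x))%:~R / n.+1%:R =
   (n.+1%:R * x - (Num.floor (n.+1%:R * x))%:~R) / n.+1%:R.
  by rewrite mulrBl mulrAC mulfV ?mul1r// gt_eqF.
rewrite normrM ger0_norm ?subr_ge0// ger0_norm ?invr_ge0 ?ler0n//.
by rewrite -[leRHS]mul1r ler_pM2r ?invr_gt0//; lra.
Unshelve. all: end_near. Qed.

(** The argument of [W] is rounded down to the grid of mesh [1 / n.+1]. Each rounded function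
    factors through a countable set of integer vectors with measurable fibres, and continuity of [W]
    gives pointwise convergence. *)
Lemma measurable_continuous_row (W : 'rV[R]_m * R -> R) (be : Y -> 'rV[R]_m)
    (ga : Y -> R) : continuous W ->
  (forall i, measurable_fun setT (fun y => be y 0 i)) ->
  measurable_fun setT ga -> measurable_fun setT (fun y => W (be y, ga y)).
Proof.
move=> cW mb mg.
pose key n y : {ffun 'I_m -> int} * int :=
  ([ffun i => Num.floor (n.+1%:R * be y 0 i)], Num.floor (n.+1%:R * ga y)).
pose Wn n (z : {ffun 'I_m -> int} * int) : R :=
  W (\row_i ((z.1 i)%:~R / n.+1%:R), z.2%:~R / n.+1%:R).
apply: (@measurable_fun_cvg _ _ _ _ (fun n => Wn n \o key n)).
  move=> n; apply: measurable_fun_countable => -[z1 z2].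
  have mf (h : Y -> R) (z : int) : measurable_fun setT h ->
      measurable [set y | Num.floor (n.+1%:R * h y) = z].
    move=> mh.
    have -> : [set y | Num.floor (n.+1%:R * h y) = z] =
       (fun y => n.+1%:R * h y) @^-1` `[z%:~R, (z + 1)%:~R[.
      apply/seteqP; split=> y /=; rewrite in_itv/=.
      - by move=> <-; exact: floor_itv.
      - exact: floor_def.
    rewrite -[X in measurable X]setTI; apply: measurable_funM => //.
  have -> : key n @^-1` [set (z1, z2)] =
     (\bigcap_(i in [set: 'I_m]) [set y | Num.floor (n.+1%:R * be y 0 i) = z1 i])
     `&` [set y | Num.floor (n.+1%:R * ga y) = z2].
    apply/seteqP; split=> y /=.
      by move=> [<- <-]; split => // i _ /=; rewrite ffunE.
    move=> [h1 h2]; congr pair => //; apply/ffunP => i.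
    by rewrite ffunE; exact: h1.
  apply: measurableI; last exact: mf.
  by apply: fin_bigcap_measurable => // i _; exact: mf.
move=> y _.
have H : (\row_i q n (be y 0 i), q n (ga y)) @[n --> \oo] --> (be y, ga y).
  have H1 : (\row_i q n (be y 0 i)) @[n --> \oo] --> be y.
    by apply: cvg_rV => i; under eq_fun do rewrite mxE; exact: q_cvg.
  exact: (cvg_pair H1 (q_cvg (ga y))).
have -> : (fun n => (Wn n \o key n) y) =
    W \o (fun n => (\row_i q n (be y 0 i), q n (ga y))).
  apply/funext => n /=; rewrite /Wn/=; congr (W (_, _)).
  by apply/rowP => i; rewrite !mxE ffunE.
exact: (cvg_comp _ _ H (cW _)).
Qed.

End measurable_continuous.

Lemma compact_norm_le {R : realType} {m} (B : R) :
  compact [set q : 'rV[R]_m * R | `|q| <= B].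
Proof.
have [B0|B0] := leP 0 B; last first.
  rewrite (_ : [set _ | _] = set0); first exact: compact0.
  apply/seteqP; split=> // q /= qB; have := le_lt_trans qB B0.
  by rewrite ltNge normr_ge0.
rewrite (_ : [set _ | _] = [set x : 'rV[R]_m | `|x| <= B] `*` [set t : R | `|t| <= B]).
  apply: compact_setX.
    have -> : [set x : 'rV[R]_m | `|x| <= B] =
        [set v : 'rV[R]_m | forall i, `[-B, B]%classic (v ord0 i)].
      apply/seteqP; split=> x /=.
        by move=> /(rV_norm_leP _ _ B0) h i; rewrite in_itv/= -ler_norml.
      move=> h; apply/(rV_norm_leP _ _ B0) => i.
      by have := h i; rewrite in_itv/= -ler_norml.
    by apply: (@rV_compact _ _ (fun=> `[-B, B]%classic)) => i; exact: segment_compact.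
  have -> : [set t : R | `|t| <= B] = `[-B, B]%classic.
    by apply/seteqP; split=> x /=; rewrite in_itv/= -ler_norml.
  exact: segment_compact.
by apply/seteqP; split=> q /=; rewrite prod_normE ge_max => /andP.
Qed.

Lemma continuous_bounded_ball {R : realType} {m} (f : 'rV[R]_m * R -> R) (B : R) :
  continuous f -> exists M, 0 <= M /\ forall q, `|q| <= B -> `|f q| <= M.
Proof.
move=> cf; have [B0|B0] := leP 0 B; last first.
  exists 0; split=> // q qB; have := le_lt_trans qB B0.
  by rewrite ltNge normr_ge0.
have cnf : {within [set q | `|q| <= B], continuous (fun q => `|f q|)}.
  apply: continuous_subspaceT => q.
  by apply: (continuous_comp (cf q)); exact: norm_continuous.
have K0 : [set q : 'rV[R]_m * R | `|q| <= B] !=set0 by exists 0; rewrite /= normr0.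
have [c _ cM] := compact_EVT_max K0 (compact_norm_le B) cnf.
by exists `|f c|; split => // q qB; apply: cM; rewrite inE.
Qed.

(** Dominated convergence speaks of sequences, so continuity of integrals in a parameter is reduced
    to them. A failure of continuity gives a bad point within [1 / n.+1] of [p] for each [n]. *)
Lemma cvg_at_seq {R : realType} {V : normedModType R} (f : V -> R) (p : V) :
  (forall u : nat -> V, u n @[n --> \oo] --> p -> f (u n) @[n --> \oo] --> f p) ->
  {for p, continuous f}.
Proof.
move=> pfl; apply: contrapT => fpl.
have [e He] : exists e : {posnum R}, forall d : {posnum R},
    exists x, `|p - x| < d%:num /\ `|f p - f x| >= e%:num.
  apply: contrapT; apply: contra_not fpl => /forallNP h.
  apply/cvgrPdist_lt => e e0; have /existsNP[d dP] := h (PosNum e0).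
  have /cvgrPdist_lt/(_ d%:num [gt0 of d%:num]) := @cvg_id _ (nbhs p).
  apply: filterS => t pt; rewrite ltNge; apply/negP => et; apply: dP.
  by exists t.
have [u uP] := choice (fun n : nat => He n.+1%:R^-1%:pos).
have up : u n @[n --> \oo] --> p.
  apply/cvgrPdist_lt => e' e'0; near=> n.
  apply: lt_trans (uP n).1 _.
  by near: n; exact: (near_infty_natSinv_lt (PosNum e'0)).
have /cvgrPdist_lt/(_ e%:num [gt0 of e%:num])[N _ /(_ N (leqnn N))] := pfl u up.
by rewrite ltNge (uP N).2.
Unshelve. all: end_near. Qed.

(* On functions supported in a half-space [t <= t0] all the integrals below run
   over bounded sets. *)
Definition past_smooth {R : realType} {m} (f : 'rV[R]_m * R -> R) :=
  smooth f /\ exists t0, forall p, t0 < p.2 -> f p = 0.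

Lemma derive_split {R : realType} {m} (f : 'rV[R]_m * R -> R) (xi : 'rV[R]_m) (tau a b : R) q : smooth f ->
  'D_(a *: xi, b * tau) f q = a * 'D_(xi, 0) f q + b * 'D_(0, tau) f q.
Proof.
move=> sf.
have H := is_derive_curve f q (xi, 0) (0, tau) (fun s => a * s) (fun s => b * s) 0 a b
  (fun q => smooth_derivable _ _ _ sf) (fun q => smooth_derivable _ _ _ sf)
  (smooth_continuous _ (smooth_derive _ _ sf)).
have dlin (c : R) : is_derive (0 : R) 1 (fun s : R => c * s) c.
  rewrite -[X in is_derive _ _ _ X]mulr1; exact: is_deriveZ.
have := @derive_val _ _ _ _ _ _ _ (H (dlin a) (dlin b)).
rewrite !mulr0 !scale0r !addr0 => <-.
rewrite /derive; apply: (congr1 (fun F : R -> R => lim (F @ 0^'))); apply/funext => h /=.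
rewrite [h *: 1]mulr1 !addr0 !mulr0 !scale0r !addr0; congr (_ *: (f _ - _)).
rewrite -[RHS]addrA [LHS]addrC; congr (_ + _); congr pair => /=.
  by rewrite scaler0 addr0 scalerA mulrC.
by rewrite /GRing.scale/=; ring.
Qed.

Lemma derive_zero_past {R : realType} {m} (f : 'rV[R]_m * R -> R) v : (exists t0, forall p, t0 < p.2 -> f p = 0) ->
  (exists t0, forall p, t0 < p.2 -> 'D_v f p = 0).
Proof.
move=> [t0 f0]; exists t0 => p pt.
have -> : 'D_v f p = 'D_v (cst 0) p.
  apply: near_eq_derive.
  have /(cvgr_gt p.2)/(_ t0 pt) : (snd : 'rV[R]_m * R -> R) @ nbhs p --> p.2 by exact: cvg_snd.
  by apply: filterS => q qt; exact: f0.
exact: derive_cst.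
Qed.

(** * Smoothness of weighted averages *)

Section averaging.
Context {R : realType} {m : nat} {d : measure_display} {Y : measurableType d}.
Variables (mu : {measure set Y -> \bar R}) (al al' ga : Y -> R)
  (be : Y -> 'rV[R]_m).
Hypotheses (mal : measurable_fun setT al) (mal' : measurable_fun setT al')
  (mga : measurable_fun setT ga)
  (mbe : forall i, measurable_fun setT (fun y => be y 0 i)).
Local Notation P := ('rV[R]_m * R)%type.
Implicit Types (f : P -> R) (w : Y -> R) (p v : P).

(* The cone transforms, the averages [f (s x, t)], [f (x, s t)] of Hadamard's
   lemma and integration in [t] are all of the form [avg]. *)
Definition aff y p : P := (al y *: p.1 + be y, al' y * p.2 + ga y).

Definition avg w f p : R := \int[mu]_y (w y * f (aff y p)).

(** The bound on [w] is asked only where the argument of [f] has time at most [t0], since [f]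
    vanishes later, and it is uniform for [p] near [p0]. The bounds on [al] and [al'] keep the class
    stable under the factors [al] and [al'] that differentiation brings out. *)
Definition admissible w := [/\ measurable_fun setT w,
  forall y, w y != 0 -> `|al y| <= 1 /\ `|al' y| <= 1 &
  forall p0 t0, exists g0 : Y -> R, exists B, [/\ mu.-integrable setT (EFin \o g0),
    forall y, 0 <= g0 y &
    \forall p \near p0, forall y, w y != 0 -> (aff y p).2 <= t0 ->
      `|w y| <= g0 y /\ `|aff y p| <= B]].

Lemma measurable_aff f p : continuous f -> measurable_fun setT (fun y => f (aff y p)).
Proof.
move=> cf; apply: measurable_continuous_row => //.
  move=> i; under eq_fun do rewrite !mxE.
  by apply: measurable_funD => //; exact: measurable_funM.
by apply: measurable_funD => //; exact: measurable_funM.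
Qed.

Lemma admissible_le w w' : admissible w -> measurable_fun setT w' ->
  (forall y, `|w' y| <= `|w y|) -> admissible w'.
Proof.
move=> [mw w1 wd] mw' ww'.
have w0 y : w' y != 0 -> w y != 0.
  apply: contra_neq => w0; apply/eqP; rewrite -normr_le0.
  by have := ww' y; rewrite w0 normr0.
split=> [//|y /w0/w1//|p0 t0].
have [g0 [B [ig g00 gB]]] := wd p0 t0.
exists g0, B; split => //; apply: filterS gB => p gB y /w0 wy pt.
by have [h1 h2] := gB y wy pt; split => //; exact: le_trans (ww' y) h1.
Qed.

Lemma admissible_al w : admissible w -> admissible (fun y => w y * al y).
Proof.
move=> /[dup] aw [mw w1 _]; apply: admissible_le aw _ _.
  exact: measurable_funM.
move=> y; have [->|wy] := eqVneq (w y) 0; first by rewrite mul0r normr0.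
by rewrite normrM ler_piMr//; exact: (w1 y wy).1.
Qed.

Lemma admissible_al' w : admissible w -> admissible (fun y => w y * al' y).
Proof.
move=> /[dup] aw [mw w1 _]; apply: admissible_le aw _ _.
  exact: measurable_funM.
move=> y; have [->|wy] := eqVneq (w y) 0; first by rewrite mul0r normr0.
by rewrite normrM ler_piMr//; exact: (w1 y wy).2.
Qed.

(** After time [t0] the integrand is zero; the other arguments stay in the ball of radius [B], where
    [f] is bounded by some [M]. Hence the dominating function [M * g0]. *)
Lemma avg_dominated w f p0 : admissible w -> continuous f ->
  (exists t0, forall p, t0 < p.2 -> f p = 0) ->
  exists G : Y -> R, [/\ mu.-integrable setT (EFin \o G), forall y, 0 <= G y &
    \forall p \near p0, forall y, `|w y * f (aff y p)| <= G y].
Proof.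
move=> [mw _ wd] cf [t0 f0].
have [g0 [B [ig g00 gB]]] := wd p0 t0.
have [M [M0 fM]] := continuous_bounded_ball f B cf.
exists (fun y => M * g0 y); split.
- have -> : EFin \o (fun y => M * g0 y) = (fun y => M%:E * (EFin \o g0) y)%E.
    by apply/funext => y /=; rewrite EFinM.
  exact: integrableZl.
- by move=> y; rewrite mulr_ge0.
- apply: filterS gB => p gB y.
  have [->|wy] := eqVneq (w y) 0; first by rewrite mul0r normr0 mulr_ge0.
  have [pt|pt] := leP (aff y p).2 t0; last first.
    by rewrite f0// mulr0 normr0 mulr_ge0.
  have [h1 h2] := gB y wy pt.
  by rewrite normrM mulrC ler_pM// fM.
Qed.

Lemma avg_integrable w f p : admissible w -> continuous f ->
  (exists t0, forall p, t0 < p.2 -> f p = 0) ->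
  mu.-integrable setT (EFin \o (fun y => w y * f (aff y p))).
Proof.
move=> aw cf f0; have [G [iG G0 fG]] := avg_dominated w f p aw cf f0.
apply: le_integrable iG => //.
  apply/measurable_EFinP; apply: measurable_funM; last exact: measurable_aff.
  by case: aw.
move=> y _ /=; rewrite lee_fin [leRHS]ger0_norm//.
exact: (nbhs_singleton fG).
Qed.

Lemma aff_continuous y : continuous (aff y).
Proof.
move=> p; apply: (@cvg_pair _ _ _ _ (nbhs _) (nbhs _)).
  by apply: cvgD; [apply: cvgZl_tmp; exact: cvg_fst|exact: cvg_cst].
by apply: cvgD; [apply: cvgM; [exact: cvg_cst|exact: cvg_snd]|exact: cvg_cst].
Qed.

Lemma avg_continuous w f : admissible w -> continuous f ->
  (exists t0, forall p, t0 < p.2 -> f p = 0) -> continuous (avg w f).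
Proof.
move=> aw cf f0 p; apply: cvg_at_seq => u up.
have [G [iG G0 fG]] := avg_dominated w f p aw cf f0.
have [N _ NG] : \forall n \near \oo, forall y, `|w y * f (aff y (u n))| <= G y.
  exact: up fG.
have ii p' := avg_integrable w f p' aw cf f0.
(* The domination holds only for [u n] close to [p], that is for [n >= N]. *)
rewrite -(cvg_shiftn N) /=.
have fn : (\int[mu]_y (w y * f (aff y p))%:E)%E \is a fin_num.
  by apply: integrable_fin_num => //; exact: ii.
apply: fine_cvg; rewrite fineK//.
apply: (@dominated_cvg _ _ _ mu setT measurableT
  (fun n y => (w y * f (aff y (u (n + N)%N)))%:E) _ (EFin \o G)) => //.
- by move=> n; apply: (measurable_int mu); exact: ii.
- move=> y _; apply: cvg_EFin; first exact: nearW.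
  apply: cvgM; first exact: cvg_cst.
  have cc : {for p, continuous (f \o aff y)}.
    by apply: continuous_comp; [exact: aff_continuous|exact: cf].
  apply: (cvg_comp (fun n => u (n + N)%N) (f \o aff y)) cc.
  by rewrite (cvg_shiftn N).
- by move=> n y _; rewrite /= lee_fin NG//= leq_addl.
Qed.

Lemma avg_is_derive w f p (xi : 'rV[R]_m) (tau : R) :
  admissible w -> past_smooth f ->
  is_derive p (xi, tau) (avg w f)
    (avg (fun y => w y * al y) ('D_(xi, 0) f) p +
     avg (fun y => w y * al' y) ('D_(0, tau) f) p).
Proof.
move=> aw [sf f0].
have s1 := smooth_derive _ (xi, 0) sf; have s2 := smooth_derive _ (0, tau) sf.
have z1 := derive_zero_past f (xi, 0) f0; have z2 := derive_zero_past f (0, tau) f0.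
have aw1 := admissible_al _ aw; have aw2 := admissible_al' _ aw.
have [G1 [iG1 G10 G1d]] := avg_dominated _ _ p aw1 (smooth_continuous _ s1) z1.
have [G2 [iG2 G20 G2d]] := avg_dominated _ _ p aw2 (smooth_continuous _ s2) z2.
pose F (h : R) y := w y * f (aff y (p + h *: (xi, tau))).
have affE y h : aff y (p + h *: (xi, tau)) =
    aff y p + h *: (al y *: xi, al' y * tau).
  rewrite /aff; congr pair => /=.
    by rewrite scalerDr addrAC !scalerA mulrC.
  by rewrite mulrDr addrAC; congr (_ + _ + _); rewrite /GRing.scale/=; lra.
have dF (h : R) y : is_derive h 1 (fun h : R => F h y)
    (w y * al y * 'D_(xi, 0) f (aff y (p + h *: (xi, tau))) +
     w y * al' y * 'D_(0, tau) f (aff y (p + h *: (xi, tau)))).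
  have -> : (fun h => F h y) = (fun h => w y * f (aff y p + h *: (al y *: xi, al' y * tau))).
    by apply/funext => h'; rewrite /F affE.
  rewrite -!mulrA -mulrDr affE -derive_split//.
  apply: is_deriveZ; apply: is_derive_line; exact: smooth_derivable.
have near_line (U : set P) : nbhs p U ->
    exists2 e : R, 0 < e & forall h, `]-e, e[%classic h -> U (p + h *: (xi, tau)).
  move=> Up.
  have cl : (fun h : R => p + h *: (xi, tau)) @ (0 : R) --> p.
    have {2}-> : p = p + (0 : R) *: (xi, tau) by rewrite scale0r addr0.
    by apply: cvgD; [exact: cvg_cst|apply: cvgZr_tmp; exact: cvg_id].
  have /nbhs_ballP[e /= e0 eU] := cl _ Up.
  exists e => // h; rewrite /= in_itv/= -ltr_norml => he; apply: eU.
  by rewrite /ball/= sub0r normrN.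
have [e1 e10 E1] := near_line _ G1d.
have [e2 e20 E2] := near_line _ G2d.
pose e := Num.min e1 e2.
have e0 : 0 < e by rewrite lt_min e10.
have I0 : `]-e, e[%classic (0 : R) by rewrite /= in_itv/= oppr_lt0 e0.
have iF x : `]-e, e[%classic x -> mu.-integrable setT (EFin \o F x).
  by move=> _; apply: avg_integrable => //; exact: smooth_continuous.
have dF1 x y : `]-e, e[%classic x -> setT y -> derivable (F ^~ y) x 1.
  by move=> _ _; exact: (@ex_derive _ _ _ _ _ _ _ (dF x y)).
have G0 y : 0 <= G1 y + G2 y by rewrite addr_ge0.
have iG : mu.-integrable setT (EFin \o (fun y => G1 y + G2 y)).
  have -> : EFin \o (fun y => G1 y + G2 y) = ((EFin \o G1) \+ (EFin \o G2))%E.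
    by apply/funext.
  exact: integrableD.
have FG x y : `]-e, e[%classic x -> setT y -> `|partial1of2 F x y| <= G1 y + G2 y.
  rewrite partial1of2E (@derive_val _ _ _ _ _ _ _ (dF x y)) /= in_itv/=.
  rewrite -ltr_norml lt_min => /andP[x1 x2] _.
  apply: le_trans (ler_normD _ _) _; apply: lerD.
    by apply: E1; rewrite /= in_itv/= -ltr_norml.
  by apply: E2; rewrite /= in_itv/= -ltr_norml.
have := @cvg_differentiation_under_integral _ _ _ mu F setT measurableT 0 (-e) e
  I0 iF dF1 _ G0 iG FG.
rewrite (_ : (\int[mu]_y partial1of2 F 0 y) =
  (avg (fun y => w y * al y) ('D_(xi, 0) f) p +
   avg (fun y => w y * al' y) ('D_(0, tau) f) p)); last first.
  rewrite /avg -RintegralD//; last 2 first.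
  - exact: (avg_integrable _ _ p aw1 (smooth_continuous _ s1) z1).
  - exact: (avg_integrable _ _ p aw2 (smooth_continuous _ s2) z2).
  apply: eq_Rintegral => y _.
  rewrite partial1of2E (@derive_val _ _ _ _ _ _ _ (dF 0 y)).
  by rewrite scale0r addr0.
set L := (X in _ --> X) => cL.
suff cL' : h^-1 *: ((avg w f \o shift p) (h *: (xi, tau)) - avg w f p) @[h --> 0^'] --> L.
  by split; [apply/cvg_ex; eexists; exact: cL'|exact/cvg_lim].
apply: cvg_trans cL; apply: near_eq_cvg; near=> h.
by rewrite /F /avg /= addr0 scale0r addr0 (addrC p).
Unshelve. all: end_near. Qed.

Lemma avg_zero_past w f : (forall p y, w y != 0 -> p.2 <= (aff y p).2) ->
  past_smooth f -> exists t0, forall p, t0 < p.2 -> avg w f p = 0.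
Proof.
move=> wp [sf [t0 f0]]; exists t0 => p pt.
rewrite /avg; under eq_Rintegral.
  move=> y _; rewrite (_ : _ * _ = 0); last first.
    have [->|wy] := eqVneq (w y) 0; first by rewrite mul0r.
    by rewrite f0 ?mulr0// (lt_le_trans pt)// wp.
  over.
by rewrite Rintegral_cst// mul0r.
Qed.

(** The induction runs over all [w] and [f] at once: a derivative of an average is a sum of two
    averages with new weights and differentiated integrands. *)
Lemma smooth_avg w f : admissible w -> past_smooth f -> smooth (avg w f).
Proof.
move=> aw pf j; elim: j w f aw pf => [|j IH] w f aw pf.
  by apply: avg_continuous => //; [exact: smooth_continuous pf.1|exact: pf.2].
split; first by apply: avg_continuous => //; [exact: smooth_continuous pf.1|exact: pf.2].
move=> [xi tau]; have D p := avg_is_derive w f p xi tau aw pf.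
split=> [p|]; first exact: (@ex_derive _ _ _ _ _ _ _ (D p)).
have -> : 'D_(xi, tau) (avg w f) = (fun p => avg (fun y => w y * al y) ('D_(xi, 0) f) p +
     avg (fun y => w y * al' y) ('D_(0, tau) f) p).
  by apply/funext => p; exact: (@derive_val _ _ _ _ _ _ _ (D p)).
apply: CkD; apply: IH.
- exact: admissible_al.
- by split; [exact: smooth_derive pf.1|exact: derive_zero_past pf.2].
- exact: admissible_al'.
- by split; [exact: smooth_derive pf.1|exact: derive_zero_past pf.2].
Qed.

End averaging.

(** * Lebesgue measure on tuples *)

Section lebesgue_tuple_fubini.
Context {R : realType}.
Local Notation T := (measurableTypeR R).
Local Open Scope ereal_scope.

Lemma tnth_tuple_cons0 n (x : T) (y : n.-tuple T) :
  tnth (tuple_cons (x, y)) ord0 = x.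
Proof. by []. Qed.

Lemma tnth_tuple_consS n (x : T) (y : n.-tuple T) (i : 'I_n) :
  tnth (tuple_cons (x, y)) (lift ord0 i) = tnth y i.
Proof. by rewrite !(tnth_nth x). Qed.

Lemma ge0_integral_tuple_cons n (G : n.+1.-tuple T -> \bar R) :
  measurable_fun setT G -> (forall y, 0 <= G y) ->
  \int[lebesgue_tuple n.+1]_y G y =
  \int[lebesgue_measure]_x \int[lebesgue_tuple n]_y G (tuple_cons (x, y)).
Proof.
move=> mG G0.
rewrite /= /cons_measure (ge0_integral_pushforward measurable_tuple_cons)//.
rewrite preimage_setT fubini_tonelli1//.
by apply: measurableT_comp => //; exact: measurable_tuple_cons.
by move=> x; exact: G0.
Qed.

Lemma integrable_tuple_cons n (G : n.+1.-tuple T -> \bar R) :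
  (lebesgue_tuple n.+1).-integrable setT G ->
  (@lebesgue_measure R \x lebesgue_tuple n).-integrable setT (G \o tuple_cons).
Proof.
move=> /integrableP[mG iG]; apply/integrableP; split.
  by apply: measurableT_comp => //; exact: measurable_tuple_cons.
move: iG; rewrite /= /cons_measure (ge0_integral_pushforward measurable_tuple_cons)//.
exact: measurableT_comp.
Qed.

Lemma integral_tuple_cons n (G : n.+1.-tuple T -> \bar R) :
  (lebesgue_tuple n.+1).-integrable setT G ->
  \int[lebesgue_tuple n.+1]_y G y =
  \int[@lebesgue_measure R \x lebesgue_tuple n]_z G (tuple_cons z).
Proof.
move=> iG; have [mG _] := integrableP _ _ _ iG.
rewrite /= /cons_measure (integral_pushforward measurable_tuple_cons)//.
by rewrite preimage_setT; exact: integrable_tuple_cons.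
Qed.

Lemma lebesgue_tuple_coord0 n (j : 'I_n) :
  lebesgue_tuple n [set y : n.-tuple T | tnth y j = 0%R] = 0.
Proof.
elim: n j => [[]//|n IH j].
rewrite /= /cons_measure /pushforward.
case: (unliftP ord0 j) => [j'|] ->.
  have -> : tuple_cons @^-1` [set y : n.+1.-tuple T | tnth y (lift ord0 j') = 0%R] =
      [set: T] `*` [set y : n.-tuple T | tnth y j' = 0%R].
    by apply/seteqP; split=> -[x y] /=; rewrite tnth_tuple_consS; [split|case].
  rewrite product_measure1E//; first by rewrite IH mule0.
  rewrite -[X in measurable X]setTI.
  exact: (measurable_tnth j' measurableT (measurable_set1 0%R)).
have -> : tuple_cons @^-1` [set y : n.+1.-tuple T | tnth y ord0 = 0%R] =
      [set 0%R : T] `*` [set: n.-tuple T].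
  by apply/seteqP; split=> -[x y] /=; rewrite tnth_tuple_cons0; [split|case].
by rewrite product_measure1E//= [X in X * _](_ : _ = 0) ?mul0e//; exact: lebesgue_measure_set1.
Qed.

Lemma integrable_tensor n (h : T -> R) : (forall x, (0 <= h x)%R) ->
  (@lebesgue_measure R).-integrable setT (EFin \o h) ->
  (lebesgue_tuple n).-integrable setT
    (fun y : n.-tuple T => (\prod_(i < n) h (tnth y i))%R%:E).
Proof.
move=> h0 ih; have mh : measurable_fun setT h.
  by apply/measurable_EFinP; exact: measurable_int ih.
have mp k : measurable_fun setT (fun y : k.-tuple T => (\prod_(i < k) h (tnth y i))%R).
  apply: measurable_prod => i _.
  exact: (measurableT_comp mh (measurable_tnth i)).
have p0 k (y : k.-tuple T) : (0 <= \prod_(i < k) h (tnth y i))%R by exact: prodr_ge0.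
elim: n => [|n IH]; apply/integrableP; (split; first by apply/measurable_EFinP; exact: mp).
  rewrite (eq_integral (cst 1)); last by move=> y _ /=; rewrite big_ord0 normr1.
  by rewrite integral_cst//= mul1e diracT ltry.
rewrite (eq_integral (fun y : n.+1.-tuple T => (\prod_(i < n.+1) h (tnth y i))%R%:E)); last first.
  by move=> y _; rewrite gee0_abs// lee_fin.
rewrite ge0_integral_tuple_cons; last 2 first.
- by apply/measurable_EFinP; exact: mp.
- by move=> y; rewrite lee_fin.
have -> : (fun x : T => \int[lebesgue_tuple n]_y (\prod_(i < n.+1) h (tnth (tuple_cons (x, y)) i))%R%:E)
    = (fun x => (h x)%:E * \int[lebesgue_tuple n]_y (\prod_(i < n) h (tnth y i))%R%:E).
  apply/funext => x; rewrite -ge0_integralZl//; last 3 first.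
  - by apply/measurable_EFinP; exact: mp.
  - by move=> y _; rewrite lee_fin.
  - by rewrite lee_fin.
  apply: eq_integral => y _; rewrite big_ord_recl EFinM; congr (_ * _%:E).
  by apply: eq_bigr => i _; rewrite tnth_tuple_consS.
have [_ fin] := integrableP _ _ _ IH.
rewrite ge0_integralZr//.
- apply: lte_mul_pinfty.
  + by apply: integral_ge0 => x _; rewrite lee_fin.
  + by apply: integrable_fin_num.
  + by move: fin; under eq_integral do rewrite gee0_abs ?lee_fin//.
- exact/measurable_EFinP.
- by move=> x _; rewrite lee_fin.
- by apply: integral_ge0 => y _; rewrite lee_fin.
Qed.

End lebesgue_tuple_fubini.

Section line_integrals.
Context {R : realType}.
Local Notation T := (measurableTypeR R).

Definition tuple_upd n (y : n.-tuple T) (i : 'I_n) (s : R) : n.-tuple T :=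
  [tuple if k == i then s else tnth y k | k < n].

Lemma tuple_upd_cons0 n (x s : R) (y : n.-tuple T) :
  tuple_upd n.+1 (tuple_cons (x, y)) ord0 s = tuple_cons (s, y).
Proof.
apply: eq_from_tnth => k; rewrite tnth_mktuple.
case: (unliftP ord0 k) => [k'|] ->; first by rewrite !tnth_tuple_consS.
by rewrite eqxx tnth_tuple_cons0.
Qed.

Lemma tuple_upd_consS n (x s : R) (y : n.-tuple T) (i : 'I_n) :
  tuple_upd n.+1 (tuple_cons (x, y)) (lift ord0 i) s =
  tuple_cons (x, tuple_upd n y i s).
Proof.
apply: eq_from_tnth => k; rewrite tnth_mktuple.
case: (unliftP ord0 k) => [k'|] ->.
  by rewrite !tnth_tuple_consS tnth_mktuple (inj_eq lift_inj).
by rewrite (negbTE (neq_lift _ _)) !tnth_tuple_cons0.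
Qed.

Local Open Scope ereal_scope.

(* [oj] is a coordinate, other than the [i]-th one, on whose zero set (a null
   set) the line integrals are not constrained. *)
Lemma integral_line0_opt n (i : 'I_n) (oj : option 'I_n) (G : n.-tuple T -> \bar R) :
  oj != Some i -> (lebesgue_tuple n).-integrable setT G ->
  (forall y, (if oj is Some j then tnth y j != 0%R else true) ->
    \int[lebesgue_measure]_s G (tuple_upd n y i s) = 0) ->
  \int[lebesgue_tuple n]_y G y = 0.
Proof.
elim: n i oj G => [[]//|n IH] i oj G ij iG G0.
have iGc := integrable_tuple_cons _ _ iG.
rewrite (integral_tuple_cons _ _ iG).
have cst0 d (X : measurableType d) (mu : {measure set X -> \bar R}) (F : X -> \bar R) :
    measurable_fun setT F -> {ae mu, forall x, F x = 0} -> \int[mu]_x F x = 0.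
  move=> mF F0; rewrite (ae_eq_integral (cst 0))//; first by rewrite integral0.
  by apply: filterS F0 => x F0 _.
case: (unliftP ord0 i) ij G0 => [i'|] -> ij G0.
(* Direction in the tail: with the first coordinate as outer variable, almost every slice is
   integrable and falls under the induction hypothesis. *)
- rewrite -(integral12_prod_meas1 iGc); apply: cst0.
    exact: (measurable_fubini_F iGc).
  have i1 := ae_integrable1 iGc.
  (* The marked coordinate of the slice. If it was the first coordinate, no mark is left, and the
     constraint becomes [x != 0] on the outer variable, true almost everywhere. *)
  pose oj' := if oj is Some j then unlift ord0 j else None.
  have ij' : oj' != Some i'.
    apply: contraNneq ij; rewrite /oj'; case: (oj) => // j.
    by case: unliftP => // j' -> [->].
  have H x : (lebesgue_tuple n).-integrable setT (fun y => G (tuple_cons (x, y))) ->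
      (oj = Some ord0 -> x != 0%R) -> \int[lebesgue_tuple n]_y G (tuple_cons (x, y)) = 0.
    move=> ix x0; apply: (IH i' oj') => // y yj.
    under eq_integral do rewrite -tuple_upd_consS.
    apply: G0; move: yj x0; rewrite /oj'; case: (oj) => // j.
    case: unliftP => [j' ->|-> _]; first by rewrite tnth_tuple_consS.
    by rewrite tnth_tuple_cons0; apply.
  have [oj0|oj0] := eqVneq oj (Some ord0); last first.
    by apply: filterS i1 => x ix; apply: H => // E; rewrite E eqxx in oj0.
  have n0 : {ae (@lebesgue_measure R), forall x : R, x != 0%R}.
    exists [set 0%R]; split => //; first exact: lebesgue_measure_set1.
    by move=> x /= /negP; rewrite negbK => /eqP.
  by apply: filterS2 i1 n0 => x ix x0; exact: H.
(* Direction along the first coordinate: the inner integral is itself the line integral. The value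
   [0] put in front of [y] below is arbitrary, as [tuple_upd] overwrites it. *)
- rewrite -(integral21_prod_meas1 iGc); apply: cst0.
    exact: (measurable_fubini_G iGc).
  case: oj ij G0 => [j|] ij G0; last first.
    apply: aeW => y; rewrite -(G0 (tuple_cons (0%R, y)) isT).
    by apply: eq_integral => s _; rewrite tuple_upd_cons0.
  case: (unliftP ord0 j) ij G0 => [j'|] -> // ij G0.
  exists [set y : n.-tuple T | tnth y j' = 0%R]; split.
  + rewrite -[X in measurable X]setTI.
    exact: (measurable_tnth j' measurableT (measurable_set1 0%R)).
  + exact: lebesgue_tuple_coord0.
  + move=> y /=; apply: contra_notP => /eqP yj.
    rewrite -(G0 (tuple_cons (0%R, y))); last by rewrite tnth_tuple_consS.
    by apply: eq_integral => s _; rewrite tuple_upd_cons0.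
Qed.

Lemma integral_line0 n (i j : 'I_n) (G : n.-tuple T -> R) :
  i != j -> (lebesgue_tuple n).-integrable setT (EFin \o G) ->
  (forall y, tnth y j != 0%R ->
    \int[lebesgue_measure]_s (G (tuple_upd n y i s))%:E = 0) ->
  (\int[lebesgue_tuple n]_y G y)%R = 0%R.
Proof.
move=> ij iG G0; rewrite /Rintegral.
by rewrite (integral_line0_opt n i (Some j) (EFin \o G))// eq_sym; apply: contraNneq ij => -[->].
Qed.

End line_integrals.

(** * Integrability of an inverse square root singularity *)

Section inverse_sqrt.
Context {R : realType}.
Local Notation mu := (@lebesgue_measure R).

(** An improper integral: on each interval the fundamental theorem gives [F (b n) - F (a n)], at
    most [2 * M], and monotone convergence passes to the union. *)
Lemma integral_bounded_primitive (k F : R -> R) (a b : nat -> R) (M : R) :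
  (forall n, a n < b n) -> (forall n, a n.+1 <= a n) -> (forall n, b n <= b n.+1) ->
  (forall n x, a n <= x <= b n ->
     [/\ 0 <= k x, {for x, continuous k}, is_derive x 1 F (k x) & `|F x| <= M]) ->
  (\int[mu]_(x in \bigcup_n [set` `[a n, b n]]) (k x)%:E <= (2 * M)%:E)%E.
Proof.
move=> ab an bn kP.
pose I n : set (measurableTypeR R) := [set` `[a n, b n]].
have nd : nondecreasing_seq I.
  apply/nondecreasing_seqP => n; apply/subsetPset => x; rewrite /I /= !in_itv/=.
  by move=> /andP[h1 h2]; rewrite (le_trans (an n))// (le_trans _ (bn n)).
have ck n : {within `[a n, b n], continuous k}.
  apply: continuous_in_subspaceT => x /[!inE]/=; rewrite in_itv/= => xab.
  by have [] := kP n x xab.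
have mk n : measurable_fun (I n) (fun x => (k x)%:E).
  apply/measurable_EFinP; apply: subspace_continuous_measurable_fun; [exact: measurable_itv|exact: ck].
have k0 n x : I n x -> (0 <= (k x)%:E)%E.
  by rewrite /I /= in_itv/= => xab; rewrite lee_fin; have [] := kP n x xab.
have mI n : measurable (I n) by exact: measurable_itv.
have := @ge0_nondecreasing_set_cvg_integral _ _ _ I (fun x => (k x)%:E) mu nd mI mk k0.
apply: cvge_le; apply: nearW => n /=.
rewrite (@continuous_FTC2 _ k F (a n) (b n))//.
- have [_ _ _ Fa] := kP n (a n) (ltac:(by rewrite lexx ltW)).
  have [_ _ _ Fb] := kP n (b n) (ltac:(by rewrite lexx ltW)).
  rewrite -EFinB lee_fin; move: Fa Fb; rewrite !ler_norml; lra.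
- have dF x : a n <= x <= b n -> derivable F x 1.
    by move=> xab; have [_ _ d _] := kP n x xab; exact: ex_derive.
  have cF x : a n <= x <= b n -> {for x, continuous F}.
    by move=> /dF d; apply: differentiable_continuous; apply/derivable1_diffP.
  split.
  + by move=> x; rewrite in_itv/= => /andP[x1 x2]; apply: dF; rewrite !ltW.
  + by apply: cvg_at_right_filter; apply: cF; rewrite lexx ltW.
  + by apply: cvg_at_left_filter; apply: cF; rewrite lexx ltW.
- move=> x; rewrite in_itv/= => /andP[x1 x2]; rewrite derive1E.
  by have [_ _ d _] := kP n x (ltac:(by rewrite !ltW)); exact: derive_val.
Qed.

Lemma measurable_inv_ge0 d (X : measurableType d) (f : X -> R) :
  (forall x, 0 <= f x) -> measurable_fun setT f -> measurable_fun setT (fun x => (f x)^-1).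
Proof.
move=> f0 mf; rewrite (_ : (fun x => _) = (fun r : R => r `^ (-1)) \o f); last first.
  by apply/funext => x /=; rewrite powR_inv1.
exact: measurableT_comp.
Qed.

Lemma measurable_sqrt d (X : measurableType d) (f : X -> R) :
  measurable_fun setT f -> measurable_fun setT (fun x => Num.sqrt (f x)).
Proof.
move=> mf; rewrite (_ : (fun x => _) = (Num.sqrt : R -> R) \o f)//.
apply: measurableT_comp => //; apply: continuous_measurable_fun.
exact: sqrt_continuous.
Qed.

(* As [|v| >= sqrt |v_0| sqrt |v_1|], the singularity [1 / |v|] is dominated by a
   product of such weights, one in each coordinate. *)
Definition inv_sqrt_weight (r s : R) : R :=
  \1_([set x : R | `|x| <= r]) s * (1 + (Num.sqrt `|s|)^-1).

Lemma inv_sqrt_weight_ge0 r s : 0 <= inv_sqrt_weight r s.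
Proof. by rewrite mulr_ge0// ?addr_ge0 ?invr_ge0 ?sqrtr_ge0// indicE ler0n. Qed.

Lemma measurable_inv_sqrt_weight r : measurable_fun setT (inv_sqrt_weight r).
Proof.
apply: measurable_funM.
  apply: measurable_indic.
  have -> : [set x : R | `|x| <= r] = [set` `[-r, r]].
    by apply/seteqP; split=> x /=; rewrite in_itv/= ler_norml.
  exact: measurable_itv.
apply: measurable_funD => //; apply: measurable_inv_ge0.
  by move=> x; exact: sqrtr_ge0.
by apply: measurable_sqrt; exact: normr_measurable.
Qed.

Lemma is_derive_sqrt_primitive (s : R) : 0 < s ->
  is_derive s 1 (fun x => x + 2 * Num.sqrt x) (1 + (Num.sqrt s)^-1).
Proof.
move=> s0; apply: is_deriveD.
have H := is_derive1_sqrt s0.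
have -> : (Num.sqrt s)^-1 = 2 *: (2 * Num.sqrt s)^-1.
  by rewrite /GRing.scale/= invfM mulrA mulfV ?mul1r.
exact: is_deriveZ.
Qed.

Lemma integrable_inv_sqrt_weight r : 0 < r ->
  mu.-integrable setT (EFin \o inv_sqrt_weight r).
Proof.
move=> r0.
pose k (s : R) := 1 + (Num.sqrt `|s|)^-1.
have k0 s : 0 <= k s by rewrite addr_ge0 ?invr_ge0 ?sqrtr_ge0.
have ck s : s != 0 -> {for s, continuous k}.
  move=> s0; apply: cvgD; first exact: cvg_cst.
  apply: cvgV; first by rewrite sqrtr_eq0 -ltNge normr_gt0.
  have := @continuous_comp _ _ _ (fun x : R => `|x|) Num.sqrt s
    (@norm_continuous _ _ s) (@sqrt_continuous _ _).
  exact.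
(* With [n.+2] rather than [n.+1], already [e 0 < r], so no interval degenerates. *)
pose e n : R := r / n.+2%:R.
have e0 n : 0 < e n by rewrite divr_gt0.
have er n : e n < r by rewrite ltr_pdivrMr// ltr_pMr// ltr1n.
have en n : e n.+1 <= e n by rewrite ler_pM2l// lef_pV2 ?posrE// ler_nat.
pose A := \bigcup_n [set` `[e n, r]].
pose B := \bigcup_n [set` `[-r, - e n]].
have HA : (\int[mu]_(x in A) (k x)%:E <= (2 * (r + 2 * Num.sqrt r))%:E)%E.
  apply: (integral_bounded_primitive k (fun x => x + 2 * Num.sqrt x) e (fun=> r)) => //.
  move=> n x /andP[x1 x2]; have x0 := lt_le_trans (e0 n) x1; split=> //.
  - by apply: ck; rewrite gt_eqF.
  - by rewrite /k gtr0_norm//; exact: is_derive_sqrt_primitive.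
  - rewrite ger0_norm; first by rewrite lerD// ler_pM2l// ler_wsqrtr.
    by rewrite addr_ge0 ?mulr_ge0 ?sqrtr_ge0// ltW.
have HB : (\int[mu]_(x in B) (k x)%:E <= (2 * (r + 2 * Num.sqrt r))%:E)%E.
  apply: (integral_bounded_primitive k (fun x => - (- x + 2 * Num.sqrt (- x)))
    (fun=> - r) (fun n => - e n)).
  - by move=> n; rewrite ltrN2.
  - by move=> n; exact: lexx.
  - by move=> n; rewrite lerN2.
  move=> n x /andP[x1 x2]; have x0 : 0 < - x by rewrite (lt_le_trans (e0 n))// lerNr.
  split.
  - exact: k0.
  - by apply: ck; rewrite -oppr_eq0 gt_eqF.
  - rewrite /k -normrN (gtr0_norm x0).
    have H := is_derive_sqrt_primitive _ x0.
    have N : is_derive x 1 (fun x : R => - x) (-1) by exact: is_deriveN.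
    have := @is_derive1_comp _ (fun x => x + 2 * Num.sqrt x) (fun x : R => - x) x _ _ H N.
    by move=> /is_deriveN; rewrite mulrN1 opprK.
  - rewrite normrN ger0_norm; last by rewrite addr_ge0 ?mulr_ge0 ?sqrtr_ge0// ltW.
    by rewrite lerD// ?ler_pM2l ?ler_wsqrtr// lerNl.
have mA : measurable (A : set (measurableTypeR R)).
  by apply: bigcupT_measurable => n; exact: measurable_itv.
have mB : measurable (B : set (measurableTypeR R)).
  by apply: bigcupT_measurable => n; exact: measurable_itv.
have mw := measurable_inv_sqrt_weight r.
have mk : measurable_fun setT k.
  apply: measurable_funD => //; apply: measurable_inv_ge0.
    by move=> x; exact: sqrtr_ge0.
  by apply: measurable_sqrt; exact: normr_measurable.
have A0 x : A x -> 0 < x.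
  by move=> [n _ /=]; rewrite in_itv/= => /andP[h _]; exact: lt_le_trans h.
have B0 x : B x -> x < 0.
  move=> [n _ /=]; rewrite in_itv/= => /andP[_ h]; apply: le_lt_trans h _.
  by rewrite oppr_lt0.
have wA x : A x -> inv_sqrt_weight r x = k x.
  move=> Ax; have := A0 _ Ax; case: Ax => n _ /=; rewrite in_itv/= => /andP[_ xr] x0.
  by rewrite /inv_sqrt_weight indicE mem_set ?mul1r//= gtr0_norm.
have wB x : B x -> inv_sqrt_weight r x = k x.
  move=> Bx; have := B0 _ Bx; case: Bx => n _ /=; rewrite in_itv/= => /andP[xr _] x0.
  by rewrite /inv_sqrt_weight indicE mem_set ?mul1r//= ltr0_norm// lerNl.
have smallT (x : R) : 0 < x -> exists n, e n <= x.
  move=> x0; have xr : 0 < x / r by rewrite divr_gt0.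
  near \oo => n; exists n.
  have h : n.+1%:R^-1 < x / r by near: n; exact: (near_infty_natSinv_lt (PosNum xr)).
  rewrite /e -[leRHS](divfK (lt0r_neq0 r0)) mulrC ler_pM2r//.
  by apply: le_trans (ltW h); rewrite lef_pV2 ?posrE// ler_nat.
have w0 x : x != 0 -> ~ (A `|` B) x -> inv_sqrt_weight r x = 0.
  move=> x0 nAB; rewrite /inv_sqrt_weight indicE memNset ?mul0r// => /= xr.
  apply: nAB; have [xp|xn|x00] := ltgtP x 0; last by rewrite x00 eqxx in x0.
    have [|n nx] := smallT (- x); first by rewrite oppr_gt0.
    right; exists n => //=; rewrite in_itv/= lerNr nx andbT.
    by move: xr; rewrite ler_norml => /andP[].
  have [//|n nx] := smallT x.
  left; exists n => //=; rewrite in_itv/= nx/=.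
  by move: xr; rewrite ler_norml => /andP[].
apply/integrableP; split; first exact/measurable_EFinP.
under eq_integral => x _ do rewrite gee0_abs ?lee_fin ?inv_sqrt_weight_ge0//.
have mAB : measurable (A `|` B : set (measurableTypeR R)) by exact: measurableU.
(* [A] and [B] exhaust [[-r, r]] except for the point 0, which is negligible. *)
have ->: (\int[mu]_x (EFin \o inv_sqrt_weight r) x =
   \int[mu]_(x in A `|` B) (EFin \o inv_sqrt_weight r) x)%E.
  rewrite [RHS]integral_mkcond.
  apply: ge0_ae_eq_integral => //.
  - exact/measurable_EFinP.
  - by apply/measurable_restrict => //; apply/measurable_EFinP; exact: measurable_funTS.
  - by move=> x _; rewrite lee_fin inv_sqrt_weight_ge0.
  - by move=> x _; rewrite patchE; case: ifP => // _; rewrite lee_fin inv_sqrt_weight_ge0.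
  - exists [set 0]; split => //; first exact: lebesgue_measure_set1.
    move=> x /=; apply: contra_notP => /eqP x0 _; rewrite patchE.
    by case: ifPn => // nAB; rewrite /= w0//; apply/asboolPn.
rewrite ge0_integral_setU//; last 3 first.
- by apply/measurable_EFinP; exact: measurable_funTS.
- by move=> x _; rewrite lee_fin inv_sqrt_weight_ge0.
- by apply/disj_setPS => x [/A0 h1 /B0 h2]; have := lt_trans h1 h2; rewrite ltxx.
rewrite [X in (X + _)%E](_ : _ = \int[mu]_(x in A) (k x)%:E)%E; last first.
  by apply: eq_integral => x /set_mem /wA /= ->.
rewrite [X in (_ + X)%E](_ : _ = \int[mu]_(x in B) (k x)%:E)%E; last first.
  by apply: eq_integral => x /set_mem /wB /= ->.
by apply: lte_add_pinfty; [apply: le_lt_trans HA _|apply: le_lt_trans HB _]; rewrite ltry.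
Unshelve. all: end_near. Qed.

End inverse_sqrt.

(** * Weighted conical transforms *)

Section cone.
Context {R : realType} {m : nat}.
Local Notation T := (measurableTypeR R).
Local Notation P := ('rV[R]_m * R)%type.
Implicit Types (w : 'rV[R]_m -> R) (f : P -> R) (v : 'rV[R]_m).

Lemma enorm_ge0 v : 0 <= enorm v. Proof. exact: sqrtr_ge0. Qed.

Lemma coord_le_enorm v i : `|v 0 i| <= enorm v.
Proof.
rewrite -sqrtr_sqr; apply: ler_wsqrtr.
by rewrite (bigD1 i)//= lerDl sumr_ge0// => j _; exact: sqr_ge0.
Qed.

Lemma norm_le_enorm v : `|v| <= enorm v.
Proof. by apply/rV_norm_leP => [|i]; [exact: enorm_ge0|exact: coord_le_enorm]. Qed.

Lemma measurable_row i : measurable_fun setT (fun y : m.-tuple T => row_of_tuple y 0 i).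
Proof. by under eq_fun do rewrite mxE; exact: measurable_tnth. Qed.

Lemma measurable_enorm : measurable_fun setT (fun y : m.-tuple T => enorm (row_of_tuple y)).
Proof.
apply: measurable_sqrt; apply: measurable_sum => i.
by apply: measurable_funX; exact: measurable_row.
Qed.

(** One envelope for all the weights that occur: [1], [v_i], [|v|], [1 / |v|], [v_i / |v|] and their
    derivatives. As [0^-1 = 0], it reads [|w 0| <= 1] at the vertex. *)
Definition cone_weight w := measurable_fun setT (fun y : m.-tuple T => w (row_of_tuple y)) /\
  forall v, `|w v| <= 1 + enorm v + (enorm v)^-1.

Definition truncated_weight (r : R) (y : m.-tuple T) : R :=
  \1_([set y : m.-tuple T | enorm (row_of_tuple y) <= r]) y *
  (1 + enorm (row_of_tuple y) + (enorm (row_of_tuple y))^-1).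

Lemma truncated_weight_ge0 r y : 0 <= truncated_weight r y.
Proof. by rewrite mulr_ge0 ?addr_ge0 ?invr_ge0 ?enorm_ge0// indicE ler0n. Qed.

Hypothesis m2 : (1 < m)%N.

Lemma integrable_truncated_weight r : 0 < r ->
  (lebesgue_tuple m).-integrable setT (EFin \o truncated_weight r).
Proof.
move=> r0.
pose i0 : 'I_m := Ordinal (ltnW m2); pose i1 : 'I_m := Ordinal m2.
have i01 : i1 != i0 by [].
pose N (i : 'I_m) : set (m.-tuple T) := [set y | tnth y i = 0].
have mN i : measurable (N i).
  rewrite -[X in measurable X]setTI.
  exact: (measurable_tnth i measurableT (measurable_set1 0%R)).
have mt : measurable_fun setT (truncated_weight r).
  apply: measurable_funM.
    apply: measurable_indic.
    rewrite -[X in measurable X]setTI.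
    have := measurable_enorm measurableT _ (measurable_itv `]-oo, r]%R).
    by congr (measurable (_ `&` _)); apply/seteqP; split => y /=; rewrite in_itv.
  apply: measurable_funD.
    by apply: measurable_funD => //; exact: measurable_enorm.
  by apply: measurable_inv_ge0; [move=> y; exact: enorm_ge0|exact: measurable_enorm].
have mNN : measurable (N i0 `|` N i1) by exact: measurableU.
have NN0 : lebesgue_tuple m (N i0 `|` N i1) = 0%E.
  apply/eqP; rewrite eq_le measure_ge0 andbT.
  apply: le_trans (measureU2 _ (mN i0) (mN i1)) _.
  have z i : lebesgue_tuple m (N i) = 0%E by exact: lebesgue_tuple_coord0.
  by rewrite [X in (X + _)%E]z [X in (_ + X)%E]z adde0.
(* Where one of the two chosen coordinates is zero, the convention [0^-1 = 0] spoils the comparison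
   with the product of weights; this null set is removed first. *)
apply/(negligible_integrable mNN measurableT _ NN0); first exact/measurable_EFinP.
have iH := integrable_tensor m _ (inv_sqrt_weight_ge0 r) (integrable_inv_sqrt_weight r r0).
have iH' : (lebesgue_tuple m).-integrable (setT `\` (N i0 `|` N i1))
    (fun y => ((1 + r)%:E * (\prod_(i < m) inv_sqrt_weight r (tnth y i))%:E)%E).
  apply: integrableZl; first exact: measurableD.
  by apply: integrableS iH => //; exact: measurableD.
apply: le_integrable iH'; first exact: measurableD.
  by apply/measurable_EFinP; exact: measurable_funTS.
move=> y [_ nN] /=; rewrite lee_fin.
have p0 : 0 <= \prod_(i < m) inv_sqrt_weight r (tnth y i).
  by apply: prodr_ge0 => i _; exact: inv_sqrt_weight_ge0.
rewrite ger0_norm ?truncated_weight_ge0// ger0_norm; last first.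
  by rewrite mulr_ge0// addr_ge0// ltW.
rewrite /truncated_weight indicE; have [yr|yr] := pselect (enorm (row_of_tuple y) <= r); last first.
  by rewrite memNset// mul0r mulr_ge0// addr_ge0// ltW.
rewrite mem_set// mul1r.
have yc i : `|tnth y i| <= enorm (row_of_tuple y).
  by have := coord_le_enorm (row_of_tuple y) i; rewrite mxE.
have we i : inv_sqrt_weight r (tnth y i) = 1 + (Num.sqrt `|tnth y i|)^-1.
  by rewrite /inv_sqrt_weight indicE mem_set ?mul1r//=; exact: le_trans yr.
have w1 i : 1 <= inv_sqrt_weight r (tnth y i).
  by rewrite we lerDl invr_ge0 sqrtr_ge0.
set e := enorm _ in yr yc *.
set s0 := Num.sqrt `|tnth y i0|; set s1 := Num.sqrt `|tnth y i1|.
have s00 : 0 < s0 by rewrite sqrtr_gt0 normr_gt0; apply/eqP => h; apply: nN; left.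
have s10 : 0 < s1 by rewrite sqrtr_gt0 normr_gt0; apply/eqP => h; apply: nN; right.
have es : s0 * s1 <= e.
  have e0 : 0 <= e by exact: enorm_ge0.
  by rewrite -(sqr_sqrtr e0) expr2 ler_pM ?sqrtr_ge0// ler_wsqrtr.
have ei : e^-1 <= s0^-1 * s1^-1.
  rewrite -invfM lef_pV2 ?posrE ?mulr_gt0//.
  by apply: lt_le_trans es; rewrite mulr_gt0.
(* All factors are at least 1, so only those of the two chosen coordinates are kept. *)
have : (1 + s0^-1) * (1 + s1^-1) <= \prod_(i < m) inv_sqrt_weight r (tnth y i).
  rewrite (bigD1 i0)//= (bigD1 i1)//= !we mulrA ler_peMr//.
    by rewrite mulr_ge0// addr_ge0// invr_ge0 ltW.
  elim/big_ind: _ => //.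
  by move=> x z x1 z1; rewrite -[1]mulr1 ler_pM.
set q0 := s0^-1 in ei *; set q1 := s1^-1 in ei *.
have q00 : 0 < q0 by rewrite invr_gt0.
have q10 : 0 < q1 by rewrite invr_gt0.
have q01 : 0 < q0 * q1 by rewrite mulr_gt0.
move=> h.
have h2 : 1 + q0 * q1 <= \prod_(i < m) inv_sqrt_weight r (tnth y i) by nra.
(* Uses [e <= r] and [e^-1 <= q0 * q1], which give [1 + e + e^-1 <= 1 + r + q0 * q1]. *)
apply: (@le_trans _ _ ((1 + r) * (1 + q0 * q1))); first by nra.
by rewrite ler_pM2l// ltr_pwDl// ltW.
Qed.

Variable a : R.
Hypothesis a0 : 0 < a.

Definition cone w : (P -> R) -> P -> R :=
  avg (lebesgue_tuple m) (cst 1) (cst 1) (fun y => a * enorm (row_of_tuple y))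
    row_of_tuple (w \o row_of_tuple).

Lemma coneE w f p : cone w f p = \int[lebesgue_tuple m]_y
  (w (row_of_tuple y) * f (p.1 + row_of_tuple y, p.2 + a * enorm (row_of_tuple y))).
Proof.
by apply: eq_Rintegral => y _; rewrite /aff /= scale1r mul1r.
Qed.

Let mcone_t : measurable_fun setT (fun y : m.-tuple T => a * enorm (row_of_tuple y)).
Proof. by apply: measurable_funM => //; exact: measurable_enorm. Qed.

Lemma cone_admissible w : cone_weight w ->
  admissible (lebesgue_tuple m) (cst 1) (cst 1) (fun y => a * enorm (row_of_tuple y))
    row_of_tuple (w \o row_of_tuple).
Proof.
move=> [mw wle]; split => //.
  by move=> y _; rewrite normr1.
move=> p0 t0.
(* If [p] is within 1 of [p0] and the cone point over [y] has time at most [t0], then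
   [a * |y| <= t0 - p.2 <= |t0| + |p0.2| + 1], so [|y| <= r]. *)
pose r := (`|t0| + `|p0.2| + 1) / a + 1.
have r0 : 0 < r by rewrite ltr_pwDr// divr_ge0 ?ltW// !addr_ge0.
exists (truncated_weight r), (`|p0| + 1 + r + a * r); split.
- exact: integrable_truncated_weight.
- by move=> y; exact: truncated_weight_ge0.
have : \forall p \near p0, `|p - p0| < 1.
  by have /cvgrPdistC_lt := @cvg_id _ (nbhs p0); apply.
apply: filterS => p pp y wy; rewrite /aff /= scale1r mul1r => pt.
have : `|p - p0| < 1 by [].
rewrite prod_normE/= gt_max => /andP[pp1 pp2].
have e0 := enorm_ge0 (row_of_tuple y).
have er : enorm (row_of_tuple y) <= r.
  have h : a * enorm (row_of_tuple y) <= `|t0| + `|p0.2| + 1.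
    move: pp2; rewrite ltr_distl => /andP[h1 h2].
    have := ler_norm t0; have := ler_norm (- p0.2); rewrite normrN; lra.
  by rewrite /r ler_wpDr// ler_pdivlMr// mulrC.
split.
  rewrite /truncated_weight indicE mem_set//= mul1r; exact: wle.
rewrite prod_normE/= ge_max.
have [n1 n2] : `|p0.1| <= `|p0| /\ `|p0.2| <= `|p0|.
  by rewrite [`|p0|]prod_normE !le_max !lexx orbT.
have ar : a * enorm (row_of_tuple y) <= a * r by rewrite ler_pM2l.
have ar0 : 0 <= a * enorm (row_of_tuple y) by rewrite mulr_ge0// ltW.
have := norm_le_enorm (row_of_tuple y) => nr.
apply/andP; split.
  have -> : p.1 + row_of_tuple y = (p.1 - p0.1) + p0.1 + row_of_tuple y by rewrite subrK.
  have := ler_normD (p.1 - p0.1 + p0.1) (row_of_tuple y).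
  have := ler_normD (p.1 - p0.1) p0.1; lra.
have -> : p.2 + a * enorm (row_of_tuple y) =
  (p.2 - p0.2) + p0.2 + a * enorm (row_of_tuple y) by rewrite subrK.
have := ler_normD (p.2 - p0.2 + p0.2) (a * enorm (row_of_tuple y)).
have := ler_normD (p.2 - p0.2) p0.2; rewrite (ger0_norm ar0); lra.
Qed.

Lemma cone_integrable w f p : cone_weight w -> past_smooth f ->
  (lebesgue_tuple m).-integrable setT (EFin \o (fun y => w (row_of_tuple y) *
    f (p.1 + row_of_tuple y, p.2 + a * enorm (row_of_tuple y)))).
Proof.
move=> ww [sf f0].
have := avg_integrable (lebesgue_tuple m) (cst 1) (cst 1) _ row_of_tuple
  (measurable_cst _) (measurable_cst _) mcone_t measurable_row _ f p
  (cone_admissible _ ww) (smooth_continuous _ sf) f0.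
congr (integrable _ _ _); apply/funext => y /=.
by rewrite /aff /= scale1r mul1r.
Qed.

(** The cone is moved by translations only ([al = al' = 1]), so the space and time parts of
    [avg_is_derive] recombine into one derivative along [v]. *)
Lemma cone_is_derive w f p (v : P) : cone_weight w -> past_smooth f ->
  is_derive p v (cone w f) (cone w ('D_v f) p).
Proof.
move=> ww pf; case: v => xi tau.
have := avg_is_derive (lebesgue_tuple m) (cst 1) (cst 1) _ row_of_tuple
  (measurable_cst _) (measurable_cst _) mcone_t measurable_row _ f p xi tau
  (cone_admissible _ ww) pf.
congr (is_derive _ _ _ _).
have pD (q : P) : past_smooth ('D_q f).
  by split; [exact: smooth_derive pf.1|exact: derive_zero_past pf.2].
rewrite coneE /avg -RintegralD//; last 2 first.
- have := cone_integrable _ _ p ww (pD (xi, 0)); congr (integrable _ _ _).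
  by apply/funext => y; rewrite /aff /= scale1r mul1r mulr1.
- have := cone_integrable _ _ p ww (pD (0, tau)); congr (integrable _ _ _).
  by apply/funext => y; rewrite /aff /= scale1r mul1r mulr1.
apply: eq_Rintegral => y _; rewrite /aff /= scale1r mul1r !mulr1 -mulrDr; congr (_ * _).
have := derive_split f xi tau 1 1 _ pf.1 => /(_ (p.1 + row_of_tuple y, p.2 + a * enorm (row_of_tuple y))).
by rewrite scale1r !mul1r => ->.
Qed.

Lemma past_smooth_cone w f : cone_weight w -> past_smooth f -> past_smooth (cone w f).
Proof.
move=> ww pf; split.
  exact: (smooth_avg (lebesgue_tuple m) (cst 1) (cst 1) _ row_of_tuple
  (measurable_cst _) (measurable_cst _) mcone_t measurable_row _ f
  (cone_admissible _ ww) pf).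
apply: avg_zero_past pf => p y _; rewrite /aff /= mul1r lerDl.
by rewrite mulr_ge0 ?enorm_ge0 ?ltW.
Qed.

End cone.

Lemma is_derive_continuous {R : realType} (F : R -> R) (s d : R) :
  is_derive s 1 F d -> {for s, continuous F}.
Proof.
move=> dF; apply: differentiable_continuous; apply/derivable1_diffP.
exact: ex_derive.
Qed.

Lemma integral_derive_supp {R : realType} (F k : R -> R) (A B : R) : A < B ->
  (forall s : R, is_derive s 1 F (k s)) -> continuous k ->
  (forall s, ~~ (A <= s <= B) -> k s = 0) ->
  (\int[lebesgue_measure]_s (k s)%:E = (F B - F A)%:E)%E.
Proof.
move=> AB dF ck k0.
rewrite EFinB -(@continuous_FTC2 _ k F A B)//.
- rewrite [RHS]integral_mkcond; apply: eq_integral => s _; rewrite patchE.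
  case: ifPn => // sAB; rewrite k0//; apply: contraNN sAB => sAB.
  by rewrite inE /= in_itv.
- exact: continuous_subspaceT.
- split.
  + by move=> x _; exact: ex_derive.
  + by apply: cvg_at_right_filter; exact: is_derive_continuous.
  + by apply: cvg_at_left_filter; exact: is_derive_continuous.
- by move=> x _; rewrite derive1E; exact: derive_val.
Qed.

(** * Integration by parts along coordinate lines of the cone *)

Section enorm_line.
Context {R : realType} {m : nat}.
Variables (i j : 'I_m) (v : 'rV[R]_m).
Hypotheses (ij : i != j) (vj : v 0 j != 0).
Local Notation line s := (v + (s : R) *: delta_mx 0 i).

Lemma line_coord s : line s 0 i = v 0 i + s.
Proof. by rewrite !mxE !eqxx mulr1. Qed.

Lemma line_coord_neq k s : k != i -> line s 0 k = v 0 k.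
Proof. by move=> ki; rewrite !mxE (negbTE ki) andbF mulr0 addr0. Qed.

(** The line runs in direction [i != j] and keeps its nonzero [j]-th coordinate, hence misses the
    vertex. This is what makes the norm and its inverse differentiable along it. *)
Lemma enorm_line_gt0 s : 0 < enorm (line s).
Proof.
apply: lt_le_trans (coord_le_enorm (line s) j).
by rewrite line_coord_neq ?normr_gt0// eq_sym.
Qed.

Lemma is_derive_line_coord (s : R) : is_derive s 1 (fun s => line s 0 i) 1.
Proof.
under eq_fun do rewrite line_coord.
rewrite -[X in is_derive _ _ _ X]add0r; apply: is_deriveD.
Qed.

Lemma is_derive_enorm_line (s : R) :
  is_derive s 1 (fun s => enorm (line s)) (line s 0 i / enorm (line s)).
Proof.
pose c := \sum_(k | k != i) v 0 k ^+ 2.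
have E x : \sum_k line x 0 k ^+ 2 = c + line x 0 i ^+ 2.
  rewrite (bigD1 i)//= addrC; congr (_ + _).
  by apply: eq_bigr => k ki; rewrite line_coord_neq.
have g0 : 0 < c + line s 0 i ^+ 2.
  have := enorm_line_gt0 s; rewrite /enorm E => h.
  by rewrite -sqrtr_gt0.
have dq : is_derive s 1 (fun x => c + line x 0 i ^+ 2) (2 * line s 0 i).
  have d1 := is_derive_line_coord s.
  have d2 := is_deriveX 2 d1.
  have d3 := is_deriveD (is_derive_cst c s 1) d2.
  by move: d3; rewrite add0r /= expr1 /GRing.scale/= mulr1.
have -> : line s 0 i / enorm (line s) =
    (2 * Num.sqrt (c + line s 0 i ^+ 2))^-1 * (2 * line s 0 i).
  rewrite /enorm E invfM mulrACA mulVf// mul1r mulrC//.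
have := @is_derive1_comp _ Num.sqrt (fun x => c + line x 0 i ^+ 2) s _ _
  (is_derive1_sqrt g0) dq.
by congr (is_derive _ _ _ _); apply/funext => x /=; rewrite -E.
Qed.

Lemma continuous_enorm_line : continuous (fun s => enorm (line s)).
Proof. move=> s; exact: (is_derive_continuous _ _ _ (is_derive_enorm_line s)). Qed.

Lemma continuous_line_coord : continuous (fun s => line s 0 i).
Proof. move=> s; exact: (is_derive_continuous _ _ _ (is_derive_line_coord s)). Qed.

Lemma is_derive_inv_enorm_line (s : R) :
  is_derive s 1 (fun s => (enorm (line s))^-1) (- line s 0 i * (enorm (line s))^-1 ^+ 3).
Proof.
have n0 : enorm (line s) != 0 by rewrite gt_eqF// enorm_line_gt0.
have := @is_deriveV _ (fun s => enorm (line s)) s _ 1 n0 (is_derive_enorm_line s).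
congr (is_derive _ _ _ _); rewrite /GRing.scale/= !exprS expr0 !invfM; field; exact: n0.
Qed.

End enorm_line.

Section cone_ibp.
Context {R : realType} {m : nat}.
Hypothesis m2 : (1 < m)%N.
Variable a : R.
Hypothesis a0 : 0 < a.
Local Notation P := ('rV[R]_m * R)%type.
Local Notation T := (measurableTypeR R).
Implicit Types (w : 'rV[R]_m -> R) (f : P -> R) (v : 'rV[R]_m).

Lemma cone_weight_le w w' : cone_weight w ->
  measurable_fun setT (fun y : m.-tuple T => w' (row_of_tuple y)) ->
  (forall v, `|w' v| <= `|w v|) -> cone_weight w'.
Proof. by move=> [_ wle] mw' ww'; split=> // v; exact: le_trans (ww' v) (wle v). Qed.

Lemma measurable_inv_enorm :
  measurable_fun setT (fun y : m.-tuple T => (enorm (row_of_tuple y : 'rV[R]_m))^-1).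
Proof. by apply: measurable_inv_ge0; [move=> y; exact: enorm_ge0|exact: measurable_enorm]. Qed.

Lemma coord_div_enorm_le v i : `|v 0 i * (enorm v)^-1| <= 1.
Proof.
have [e0|e0] := eqVneq (enorm v) 0; first by rewrite e0 invr0 mulr0 normr0.
have ep : 0 < enorm v by rewrite lt_def e0 enorm_ge0.
by rewrite normrM normfV (gtr0_norm ep) ler_pdivrMr// mul1r coord_le_enorm.
Qed.

Lemma cone_weight_radial w i : cone_weight w ->
  cone_weight (fun v => w v * (v 0 i * (enorm v)^-1)).
Proof.
move=> ww; apply: (cone_weight_le _ _ ww).
  apply: measurable_funM; first by case: ww.
  by apply: measurable_funM; [exact: measurable_row|exact: measurable_inv_enorm].
by move=> v; rewrite normrM ler_piMr// coord_div_enorm_le.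
Qed.

Lemma row_of_tuple_upd (y : m.-tuple T) i s :
  row_of_tuple (tuple_upd m y i s) =
  row_of_tuple (tuple_upd m y i 0) + s *: delta_mx 0 i :> 'rV[R]_m.
Proof.
apply/rowP => k; rewrite !mxE !tnth_mktuple.
by rewrite eqxx; case: eqVneq => _ /=; rewrite ?mulr1 ?add0r ?mulr0 ?addr0.
Qed.

Lemma past_smooth_derive f (q : P) : past_smooth f -> past_smooth ('D_q f).
Proof. by move=> pf; split; [exact: smooth_derive pf.1|exact: derive_zero_past pf.2]. Qed.

(** The sum of the three integrands is the derivative along direction [i] of
    [w v * f (p.1 + v, p.2 + a |v|)]; the last term comes from the slope [a * v_i / |v|] of the
    cone. Its integral over each line with [v_j != 0] vanishes because [f] does at late times, and
    [integral_line0] concludes. The weight [dw] is a separate argument since it must be defined at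
    the vertex too. *)
Lemma cone_ibp w dw (i j : 'I_m) f p : i != j ->
  cone_weight w -> cone_weight dw ->
  (forall v (s : R), v 0 j != 0 -> is_derive s 1 (fun s : R => w (v + s *: delta_mx 0 i))
     (dw (v + s *: delta_mx 0 i))) ->
  (forall v, v 0 j != 0 -> continuous (fun s : R => dw (v + s *: delta_mx 0 i))) ->
  past_smooth f ->
  cone a dw f p + cone a w (dx i f) p
    + a * cone a (fun v => w v * (v 0 i * (enorm v)^-1)) (dt f) p = 0.
Proof.
move=> ij ww wdw dwP cdw pf.
have wr := cone_weight_radial _ i ww.
have pfi : past_smooth (dx i f) by exact: past_smooth_derive.
have pft : past_smooth (dt f) by exact: past_smooth_derive.
pose A v : P := (p.1 + v, p.2 + a * enorm v).
pose G v := dw v * f (A v) + w v * dx i f (A v)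
  + a * (w v * (v 0 i * (enorm v)^-1) * dt f (A v)).
have i1 := cone_integrable m2 a a0 dw f p wdw pf.
have i2 := cone_integrable m2 a a0 w _ p ww pfi.
have i3 := cone_integrable m2 a a0 _ _ p wr pft.
have i3' : (lebesgue_tuple m).-integrable setT (EFin \o (fun y : m.-tuple T =>
    a * (w (row_of_tuple y) * (row_of_tuple y 0 i * (enorm (row_of_tuple y))^-1)
      * dt f (A (row_of_tuple y))))).
  have := integrableZl measurableT a i3.
  by congr (integrable _ _ _); apply/funext => y /=; rewrite EFinM.
have i12 : (lebesgue_tuple m).-integrable setT (EFin \o (fun y : m.-tuple T =>
    dw (row_of_tuple y) * f (A (row_of_tuple y)) + w (row_of_tuple y) * dx i f (A (row_of_tuple y)))).
  have := integrableD measurableT i1 i2.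
  by congr (integrable _ _ _); apply/funext => y.
have iG : (lebesgue_tuple m).-integrable setT (EFin \o (fun y : m.-tuple T => G (row_of_tuple y))).
  have := integrableD measurableT i12 i3'.
  by congr (integrable _ _ _); apply/funext => y.
have -> : cone a dw f p + cone a w (dx i f) p
    + a * cone a (fun v => w v * (v 0 i * (enorm v)^-1)) (dt f) p =
    \int[lebesgue_tuple m]_y G (row_of_tuple y).
  by rewrite !coneE -RintegralZl// -RintegralD// -RintegralD.
apply: (integral_line0 m i j) => // y yj.
pose v := row_of_tuple (tuple_upd m y i 0) : 'rV[R]_m.
have vj : v 0 j != 0 by rewrite mxE tnth_mktuple (eq_sym j) (negbTE ij).
under eq_integral do rewrite row_of_tuple_upd -/v.
pose F (s : R) := w (v + s *: delta_mx 0 i) * f (A (v + s *: delta_mx 0 i)).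
have AE (s : R) : A (v + s *: delta_mx 0 i) = (p.1 + v, p.2) + s *: (delta_mx 0 i, 0)
   + (a * enorm (v + s *: delta_mx 0 i)) *: (0, 1).
  rewrite /A; congr pair => /=; first by rewrite scaler0 addr0 addrA.
  by rewrite scaler0 addr0 /GRing.scale/= mulr1.
have dF (s : R) : is_derive s 1 F (G (v + s *: delta_mx 0 i)).
  have de := is_derive_enorm_line _ _ _ ij vj s.
  have df : is_derive s 1 (fun s : R => f (A (v + s *: delta_mx 0 i)))
     (dx i f (A (v + s *: delta_mx 0 i)) +
      a * ((v + s *: delta_mx 0 i) 0 i * (enorm (v + s *: delta_mx 0 i))^-1) *
        dt f (A (v + s *: delta_mx 0 i))).
    rewrite AE -[X in is_derive _ _ _ (X + _)]mul1r.
    rewrite (_ : (fun s : R => f (A _)) = (fun s : R => f ((p.1 + v, p.2) + s *: (delta_mx 0 i, 0)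
       + (a * enorm (v + s *: delta_mx 0 i)) *: (0, 1)))); last first.
      by apply/funext => x; rewrite AE.
    apply: (is_derive_curve f (p.1 + v, p.2) (delta_mx 0 i, 0) (0, 1) id
       (fun s : R => a * enorm (v + s *: delta_mx 0 i))).
    - by move=> q; exact: smooth_derivable pf.1.
    - by move=> q; exact: smooth_derivable pf.1.
    - exact: smooth_continuous pfi.1.
  have := is_deriveM (dwP v s vj) df.
  congr (is_derive _ _ _ _); rewrite /G /GRing.scale/=; ring.
have cA : continuous (fun s : R => A (v + s *: delta_mx 0 i)).
  move=> s; rewrite (_ : (fun s : R => _) = (fun s : R => (p.1 + v, p.2) + s *: (delta_mx 0 i, 0)
       + (a * enorm (v + s *: delta_mx 0 i)) *: (0, 1))); last first.
      by apply/funext => x; rewrite AE.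
  apply: cvgD; first by apply: cvgD; [exact: cvg_cst|apply: cvgZr_tmp; exact: cvg_id].
  apply: cvgZr_tmp; apply: cvgM; first exact: cvg_cst.
  exact: (continuous_enorm_line _ _ _ ij vj).
have cG : continuous (fun s : R => G (v + s *: delta_mx 0 i)).
  move=> s.
  have cf g : past_smooth g -> g (A (v + s *: delta_mx 0 i)) @[s --> s] --> g (A (v + s *: delta_mx 0 i)).
    move=> [sg _]; apply: (continuous_comp (cA s)); exact: smooth_continuous.
  have cw : w (v + s *: delta_mx 0 i) @[s --> s] --> w (v + s *: delta_mx 0 i).
    exact: (is_derive_continuous _ _ _ (dwP v s vj)).
  apply: cvgD.
    by apply: cvgD; apply: cvgM; [exact: cdw|exact: cf|exact: cw|exact: cf].
  apply: cvgM; first exact: cvg_cst.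
  apply: cvgM; last exact: cf.
  apply: cvgM; first exact: cw.
  apply: cvgM; first exact: continuous_line_coord.
  exact: (is_derive_continuous _ _ _ (is_derive_inv_enorm_line _ _ _ ij vj s)).
have [t0 f0] := pf.2.
(* For [|s| >= r] the [i]-th coordinate alone exceeds [(|t0| + |p.2|) / a], which puts the cone
   point after time [t0]. *)
pose r := `|v 0 i| + (`|t0| + `|p.2|) / a + 1.
have r0 : 0 < r by rewrite ltr_pwDr// addr_ge0// divr_ge0 ?addr_ge0// ltW.
have F0 (s : R) : r <= `|s| -> f (A (v + s *: delta_mx 0 i)) = 0.
  move=> rs; apply: f0 => /=.
  have h1 : (`|t0| + `|p.2|) / a + 1 <= enorm (v + s *: delta_mx 0 i).
    apply: le_trans (coord_le_enorm _ i); rewrite line_coord.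
    have := ler_normB (v 0 i + s) (v 0 i); rewrite (addrC _ s) addrK.
    by move: rs; rewrite /r; lra.
  have h2 : (`|t0| + `|p.2|) + a <= a * enorm (v + s *: delta_mx 0 i).
    move: h1; rewrite -(ler_pM2l a0) mulrDr mulr1 mulrCA mulfV ?mulr1//.
    by rewrite gt_eqF.
  have := ler_norm t0; have := ler_norm (- p.2); rewrite normrN.
  by move: h2 a0; set E := a * enorm _; lra.
rewrite (integral_derive_supp F _ (- (r + 1)) (r + 1)) //.
- rewrite /F !F0 ?mulr0 ?subrr//.
    by rewrite normrN ger0_norm ?lerDl// addr_ge0// ltW.
  by rewrite ger0_norm ?lerDl// addr_ge0// ltW.
- lra.
- move=> s; rewrite -ler_norml -ltNge => rs.
  (* Outside the interval [G] is zero as the derivative of [F], which vanishes near [s]; no term of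
     [G] has to be examined. *)
  rewrite -(@derive_val _ _ _ _ _ _ _ (dF s)).
  have rnear : \forall x \near s, r < `|x|.
    have /cvgr_gt := @norm_continuous _ R s.
    by apply; lra.
  have E : \forall x \near s, F x = cst 0 x.
    by apply: filterS rnear => x rx; rewrite /F F0 ?mulr0// ltW.
  by rewrite (near_eq_derive (1 : R) E) derive_cst.
Qed.

End cone_ibp.

(** * Differential operators on smooth functions supported in the past *)

Section past_smooth_closure.
Context {R : realType} {m : nat}.
Local Notation P := ('rV[R]_m * R)%type.
Implicit Types (f g : P -> R).

Definition laplacian f : P -> R := fun p => \sum_(i < m) dx i (dx i f) p.
Definition mulx (i : 'I_m) f : P -> R := fun p => p.1 0 i * f p.
Definition mult f : P -> R := fun p => p.2 * f p.

Lemma past_smoothD f g : past_smooth f -> past_smooth g ->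
  past_smooth (fun p => f p + g p).
Proof.
move=> [sf [s f0]] [sg [t g0]]; split; first exact: smoothD.
exists (Num.max s t) => p; rewrite gt_max => /andP[h1 h2].
by rewrite f0// g0// addr0.
Qed.

Lemma past_smoothM h f : smooth h -> past_smooth f -> past_smooth (fun p => h p * f p).
Proof.
move=> sh [sf [s f0]]; split; first exact: smoothM.
by exists s => p h1; rewrite f0// mulr0.
Qed.

Lemma past_smoothZ c f : past_smooth f -> past_smooth (fun p => c * f p).
Proof. by apply: past_smoothM; exact: smooth_cst. Qed.

Lemma past_smooth0 : past_smooth (fun=> 0 : R) (m := m).
Proof. by split; [exact: smooth_cst|exists 0]. Qed.

Lemma past_smooth_sum n (F : 'I_n -> P -> R) : (forall i, past_smooth (F i)) ->
  past_smooth (fun p => \sum_(i < n) F i p).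
Proof.
elim: n F => [|n IH] F pF.
  by under eq_fun do rewrite big_ord0; exact: past_smooth0.
under eq_fun do rewrite big_ord_recl.
by apply: past_smoothD => //; exact: IH.
Qed.

Lemma past_smooth_dx i f : past_smooth f -> past_smooth (dx i f).
Proof. exact: past_smooth_derive. Qed.

Lemma past_smooth_dt f : past_smooth f -> past_smooth (dt f).
Proof. exact: past_smooth_derive. Qed.

Lemma smooth_coord i : smooth (fun p : P => p.1 0 i).
Proof.
apply: smooth_linear => [p|h v x].
  apply: (@continuous_comp _ _ _ (fst : P -> 'rV[R]_m) (fun x : 'rV[R]_m => x 0 i)).
    exact: cvg_fst.
  exact: coord_continuous.
by rewrite !mxE.
Qed.

Lemma smooth_time : smooth (fun p : P => p.2).
Proof. by apply: smooth_linear => [p|h v x //]; exact: cvg_snd. Qed.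

Lemma past_smooth_mulx i f : past_smooth f -> past_smooth (mulx i f).
Proof. by apply: past_smoothM; exact: smooth_coord. Qed.

Lemma past_smooth_mult f : past_smooth f -> past_smooth (mult f).
Proof. by apply: past_smoothM; exact: smooth_time. Qed.

(** Common form of [dx i] and [dt], so that each differentiation rule is proved once. *)
Definition dirD (v : P) f : P -> R := fun p => 'D_v f p.

Lemma dxE i f : dx i f = dirD (delta_mx 0 i, 0) f. Proof. by []. Qed.

Lemma dtE f : dt f = dirD (0, 1) f. Proof. by []. Qed.

Lemma laplacianE f p :
  laplacian f p = \sum_(i < m) dirD (delta_mx 0 i, 0) (dirD (delta_mx 0 i, 0) f) p.
Proof. by []. Qed.

Lemma past_smooth_dirD v f : past_smooth f -> past_smooth (dirD v f).
Proof. exact: past_smooth_derive. Qed.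

Lemma dirDD v f g : smooth f -> smooth g ->
  dirD v (fun p => f p + g p) = fun p => dirD v f p + dirD v g p.
Proof.
move=> sf sg; apply/funext => p.
exact: (deriveD (smooth_derivable f v p sf) (smooth_derivable g v p sg)).
Qed.

Lemma dirDB v f g : smooth f -> smooth g ->
  dirD v (fun p => f p - g p) = fun p => dirD v f p - dirD v g p.
Proof.
move=> sf sg; apply/funext => p.
exact: (deriveB (smooth_derivable f v p sf) (smooth_derivable g v p sg)).
Qed.

Lemma dirDM v f g : smooth f -> smooth g ->
  dirD v (fun p => f p * g p) = fun p => f p * dirD v g p + g p * dirD v f p.
Proof.
move=> sf sg; apply/funext => p.
exact: (deriveM (smooth_derivable f v p sf) (smooth_derivable g v p sg)).
Qed.

Lemma dirDZ v c f : smooth f -> dirD v (fun p => c * f p) = fun p => c * dirD v f p.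
Proof.
by move=> sf; apply/funext => p; exact: (deriveZ c (smooth_derivable f v p sf)).
Qed.

Lemma dirD_sum v n (F : 'I_n -> P -> R) : (forall i, past_smooth (F i)) ->
  dirD v (fun p => \sum_(i < n) F i p) = fun p => \sum_(i < n) dirD v (F i) p.
Proof.
elim: n F => [|n IH] F pF.
  under eq_fun do rewrite big_ord0.
  by apply/funext => p; rewrite big_ord0 /dirD derive_cst.
under eq_fun do rewrite big_ord_recl.
rewrite dirDD ?IH//; first by apply/funext => p; rewrite big_ord_recl.
  exact: (pF _).1.
by have [] := past_smooth_sum n (fun i => F (lift ord0 i)) (fun i => pF _).
Qed.

Lemma dirD_linear (l : P -> R) (v : P) :
  (forall (h : R) v x, l (h *: v + x) = h * l v + l x) -> dirD v l = fun=> l v.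
Proof.
move=> ll; apply/funext => p; apply/cvg_lim => //; apply: cvg_near_cst; near=> h.
have h0 : h != 0 by near: h; exact: nbhs_dnbhs_neq.
by rewrite /= ll addrK scalerA mulVf// scale1r.
Unshelve. all: end_near. Qed.

Lemma dirD_comm f (v w : P) : past_smooth f -> dirD w (dirD v f) = dirD v (dirD w f).
Proof.
move=> [sf _]; apply/funext => p.
have sv := smooth_derive f v sf; have sw := smooth_derive f w sf.
apply: derive_commute.
- by move=> q; exact: smooth_derivable _ _ _ sf.
- by move=> q; exact: smooth_derivable _ _ _ sf.
- by move=> q; exact: smooth_derivable _ _ _ sv.
- by move=> q; exact: smooth_derivable _ _ _ sw.
- exact: smooth_continuous _ (smooth_derive _ w sv).
- exact: smooth_continuous _ (smooth_derive _ v sw).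
Qed.

Lemma past_smooth_laplacian f : past_smooth f -> past_smooth (laplacian f).
Proof. by move=> pf; apply: past_smooth_sum => i; do 2 apply: past_smooth_dx. Qed.

Lemma laplacian_dirD v f : past_smooth f -> dirD v (laplacian f) = laplacian (dirD v f).
Proof.
move=> pf; rewrite /laplacian dirD_sum; last first.
  by move=> i; do 2 apply: past_smooth_dx.
apply/funext => p; apply: eq_bigr => i _; rewrite !dxE.
by rewrite (dirD_comm _ _ v (past_smooth_dirD _ _ pf)) (dirD_comm _ _ v pf).
Qed.

Variable b : R.

(** [box phi] with [tan phi ^+ 2] abstracted to [b]. The cone enters later through its slope [a] and
    the single relation [b * a ^+ 2 = 1]. *)
Definition boxb f : P -> R := fun p => dt (dt f) p - b * laplacian f p.

Lemma past_smoothB f g : past_smooth f -> past_smooth g ->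
  past_smooth (fun p => f p - g p).
Proof.
move=> pf pg; under eq_fun do rewrite -mulN1r.
by apply: past_smoothD => //; exact: past_smoothZ.
Qed.

Lemma past_smooth_boxb f : past_smooth f -> past_smooth (boxb f).
Proof.
move=> pf; apply: past_smoothB; first by do 2 apply: past_smooth_dt.
by apply: past_smoothZ; exact: past_smooth_laplacian.
Qed.

Lemma past_smooth_iter_boxb n f : past_smooth f -> past_smooth (iter n boxb f).
Proof. by move=> pf; elim: n => //= n; exact: past_smooth_boxb. Qed.

Lemma boxb_dirD v f : past_smooth f -> dirD v (boxb f) = boxb (dirD v f).
Proof.
move=> pf; have pt := past_smooth_dt _ pf; have ptt := past_smooth_dt _ pt.
have pl := past_smooth_laplacian _ pf.
rewrite /boxb (dirDB v _ _ ptt.1 (past_smoothZ b _ pl).1) (dirDZ v b _ pl.1).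
by rewrite (laplacian_dirD v f pf) !dtE (dirD_comm _ _ v pt) (dirD_comm _ _ v pf).
Qed.

Lemma iter_boxb_dirD n v f : past_smooth f ->
  dirD v (iter n boxb f) = iter n boxb (dirD v f).
Proof.
move=> pf; elim: n => [|n IH]; first by [].
by rewrite !iterS (boxb_dirD _ _ (past_smooth_iter_boxb n _ pf)) IH.
Qed.

Lemma boxbB f g : past_smooth f -> past_smooth g ->
  boxb (fun p => f p - g p) = fun p => boxb f p - boxb g p.
Proof.
move=> pf pg; apply/funext => p.
have E : laplacian (fun p => f p - g p) p = laplacian f p - laplacian g p.
  rewrite !laplacianE -sumrB; apply: eq_bigr => i _.
  by rewrite (dirDB _ _ _ pf.1 pg.1)
    (dirDB _ _ _ (past_smooth_dirD _ _ pf).1 (past_smooth_dirD _ _ pg).1).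
rewrite /boxb E !dtE (dirDB _ _ _ pf.1 pg.1)
  (dirDB _ _ _ (past_smooth_dirD _ _ pf).1 (past_smooth_dirD _ _ pg).1).
have regroup (x y z t : R) : x - y - b * (z - t) = x - b * z - (y - b * t) by ring.
exact: regroup.
Qed.

Lemma boxbZ c f : past_smooth f ->
  boxb (fun p => c * f p) = (fun p => c * boxb f p).
Proof.
move=> pf; apply/funext => p.
have E : laplacian (fun p => c * f p) p = c * laplacian f p.
  rewrite !laplacianE mulr_sumr; apply: eq_bigr => i _.
  by rewrite (dirDZ _ c _ pf.1) (dirDZ _ c _ (past_smooth_dirD _ _ pf).1).
rewrite /boxb E !dtE (dirDZ _ c _ pf.1) (dirDZ _ c _ (past_smooth_dirD _ _ pf).1); ring.
Qed.

Lemma iter_boxbZ n c f : past_smooth f ->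
  iter n boxb (fun p => c * f p) = (fun p => c * iter n boxb f p).
Proof.
move=> pf; elim: n => [|n IH]; first by [].
by rewrite !iterS IH (boxbZ _ _ (past_smooth_iter_boxb n _ pf)).
Qed.

Lemma iter_boxbB n f g : past_smooth f -> past_smooth g ->
  iter n boxb (fun p => f p - g p) = fun p => iter n boxb f p - iter n boxb g p.
Proof.
move=> pf pg; elim: n => [|n IH]; first by [].
by rewrite !iterS IH (boxbB _ _ (past_smooth_iter_boxb n _ pf) (past_smooth_iter_boxb n _ pg)).
Qed.

Lemma dx_mulx i j f : past_smooth f ->
  dx j (mulx i f) = fun p => (i == j)%:R * f p + mulx i (dx j f) p.
Proof.
move=> [sf _]; apply/funext => p; rewrite dxE /mulx (dirDM _ _ _ (smooth_coord i) sf).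
rewrite addrC; congr (_ + _); rewrite mulrC; congr (_ * _).
rewrite (dirD_linear (fun p => p.1 0 i)) ?mxE//=.
by move=> h v x; rewrite !mxE.
Qed.

Lemma dt_mulx i f : past_smooth f -> dt (mulx i f) = mulx i (dt f).
Proof.
move=> [sf _]; apply/funext => p.
rewrite dtE /mulx (dirDM _ _ _ (smooth_coord i) sf).
rewrite (dirD_linear (fun p => p.1 0 i)) ?mxE ?mulr0 ?addr0//=.
by move=> h v x; rewrite !mxE.
Qed.

Lemma dt_mult f : past_smooth f -> dt (mult f) = fun p => f p + mult (dt f) p.
Proof.
move=> [sf _]; apply/funext => p; rewrite dtE /mult (dirDM _ _ _ smooth_time sf).
by rewrite (dirD_linear (fun p => p.2))//= mulr1 addrC.
Qed.

Lemma laplacian_mulx i f p : past_smooth f ->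
  laplacian (mulx i f) p = mulx i (laplacian f) p + 2 * dx i f p.
Proof.
move=> pf; rewrite /laplacian.
have E j : dx j (dx j (mulx i f)) p =
    p.1 0 i * dx j (dx j f) p + 2 * ((i == j)%:R * dx j f p).
  have pj := past_smooth_dx j _ pf.
  rewrite (dx_mulx i j f pf) dxE.
  rewrite (dirDD _ _ _ (past_smoothZ _ _ pf).1 (past_smooth_mulx i _ pj).1).
  rewrite (dirDZ _ _ _ pf.1) -!dxE (dx_mulx i j _ pj) /mulx; ring.
rewrite (eq_bigr _ (fun j _ => E j)).
rewrite big_split/= -!mulr_sumr; congr (_ + 2 * _).
rewrite (bigD1 i)//= eqxx mul1r big1 ?addr0// => j ji.
by rewrite eq_sym (negbTE ji) mul0r.
Qed.

Lemma boxb_mulx i f : past_smooth f ->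
  boxb (mulx i f) = (fun p => mulx i (boxb f) p - 2 * b * dx i f p).
Proof.
move=> pf; apply/funext => p; rewrite /boxb (laplacian_mulx i f p pf) (dt_mulx i f pf).
rewrite (dt_mulx i _ (past_smooth_dt _ pf)) /mulx; ring.
Qed.

(** The commutator of one [boxb] with [x_i] is [- 2 b d_i], which itself commutes with [boxb]; the
    [n.+1] factors contribute it once each. *)
Lemma iter_boxb_mulx n i f : past_smooth f ->
  iter n.+1 boxb (mulx i f) =
  fun p => mulx i (iter n.+1 boxb f) p - 2 * n.+1%:R * b * dx i (iter n boxb f) p.
Proof.
move=> pf; elim: n => [|n IH]; first by rewrite /= boxb_mulx// mulr1.
rewrite iterS IH.
have pn := past_smooth_iter_boxb n _ pf; have pn1 := past_smooth_iter_boxb n.+1 _ pf.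
have pd := past_smooth_dx i _ pn.
rewrite (boxbB _ _ (past_smooth_mulx i _ pn1) (past_smoothZ _ _ pd)).
rewrite (boxb_mulx i _ pn1) (boxbZ _ _ pd) !dxE -(boxb_dirD _ _ pn).
apply/funext => p; rewrite -!dxE -[n.+2%:R]natr1 !iterS; ring.
Qed.

End past_smooth_closure.

(** * First-order identities between weighted cone transforms *)

Section cone_identities.
Context {R : realType} {m : nat}.
Hypothesis m2 : (1 < m)%N.
Variable a : R.
Hypothesis a0 : 0 < a.
Local Notation P := ('rV[R]_m * R)%type.
Local Notation T := (measurableTypeR R).
Implicit Types (w : 'rV[R]_m -> R) (f g u : P -> R) (v : 'rV[R]_m).

Lemma coneD w f g : cone_weight w -> past_smooth f -> past_smooth g ->
  cone a w (fun p => f p + g p) = fun p => cone a w f p + cone a w g p.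
Proof.
move=> ww pf pg; apply/funext => p; rewrite !coneE.
rewrite -(RintegralD measurableT (cone_integrable m2 a a0 w f p ww pf)
  (cone_integrable m2 a a0 w g p ww pg)).
by apply: eq_Rintegral => y _; rewrite mulrDr.
Qed.

Lemma coneZ w c f : cone_weight w -> past_smooth f ->
  cone a w (fun p => c * f p) = fun p => c * cone a w f p.
Proof.
move=> ww pf; apply/funext => p; rewrite !coneE.
rewrite -(RintegralZl c measurableT (cone_integrable m2 a a0 w f p ww pf)).
by apply: eq_Rintegral => y _; rewrite mulrCA.
Qed.

Lemma coneB w f g : cone_weight w -> past_smooth f -> past_smooth g ->
  cone a w (fun p => f p - g p) = fun p => cone a w f p - cone a w g p.
Proof.
move=> ww pf pg.
rewrite (_ : (fun p => f p - g p) = (fun p => f p + (-1) * g p)); last first.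
  by apply/funext => p; rewrite mulN1r.
rewrite (coneD _ _ _ ww pf (past_smoothZ (-1) _ pg)) (coneZ _ _ _ ww pg).
by apply/funext => p; rewrite mulN1r.
Qed.

Lemma cone0 w p : cone a w (fun=> 0) p = 0.
Proof.
rewrite coneE; under eq_Rintegral do rewrite mulr0.
by rewrite Rintegral_cst// mul0r.
Qed.

Lemma cone_sum w n (F : 'I_n -> P -> R) : cone_weight w -> (forall i, past_smooth (F i)) ->
  cone a w (fun p => \sum_(i < n) F i p) = fun p => \sum_(i < n) cone a w (F i) p.
Proof.
move=> ww; elim: n F => [|n IH] F pF; apply/funext => p.
  by under eq_fun do rewrite big_ord0; rewrite big_ord0 cone0.
under eq_fun do rewrite big_ord_recl.
have ps := past_smooth_sum n (fun i => F (lift ord0 i)) (fun i => pF _).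
rewrite (coneD _ _ _ ww (pF ord0) ps) (IH (fun i => F (lift ord0 i)) (fun i => pF _)).
by rewrite big_ord_recl.
Qed.

Lemma cone_weight_sum n (W : 'I_n -> 'rV[R]_m -> R) f p :
  (forall i, cone_weight (W i)) -> past_smooth f ->
  cone a (fun v => \sum_(i < n) W i v) f p = \sum_(i < n) cone a (W i) f p.
Proof.
move=> wW pf.
rewrite coneE; transitivity (\sum_(i < n) \int[lebesgue_tuple m]_y (W i (row_of_tuple y)
    * f (p.1 + row_of_tuple y, p.2 + a * enorm (row_of_tuple y)))); last first.
  by apply: eq_bigr => i _; rewrite coneE.
elim: n W wW => [|n IH] W wW.
  rewrite big_ord0; under eq_Rintegral do rewrite big_ord0 mul0r.
  by rewrite Rintegral_cst// mul0r.
rewrite big_ord_recl -(IH (fun i => W (lift ord0 i)) (fun i => wW _)).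
under eq_Rintegral do rewrite big_ord_recl mulrDl.
rewrite RintegralD//; first exact: cone_integrable.
have : (lebesgue_tuple m).-integrable setT (fun y : m.-tuple T =>
   \sum_(i < n) (W (lift ord0 i) (row_of_tuple y) *
   f (p.1 + row_of_tuple y, p.2 + a * enorm (row_of_tuple y)))%:E)%E.
  by apply: integrable_sum => // i _; exact: cone_integrable.
congr (integrable _ _ _); apply/funext => y /=.
by rewrite sumEFin mulr_suml.
Qed.

(** Serves simplifications of weights that fail at the vertex: a coordinate hyperplane is a null set
    containing it. *)
Lemma eq_cone_off w w' (j : 'I_m) f : cone_weight w -> cone_weight w' -> past_smooth f ->
  (forall v, v 0 j != 0 -> w v = w' v) -> cone a w f = cone a w' f.
Proof.
move=> ww ww' pf E; apply/funext => p; rewrite !coneE /Rintegral.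
have i1 := cone_integrable m2 a a0 w f p ww pf.
have i2 := cone_integrable m2 a a0 w' f p ww' pf.
congr fine; apply: ae_eq_integral => //.
- exact: measurable_int i1.
- exact: measurable_int i2.
exists [set y : m.-tuple T | tnth y j = 0%R]; split.
- rewrite -[X in measurable X]setTI.
  exact: (measurable_tnth j measurableT (measurable_set1 0%R)).
- exact: lebesgue_tuple_coord0.
- move=> y /=; apply: contra_notP => /eqP yj _; rewrite E//.
  by rewrite mxE.
Qed.

Lemma dirD_cone (v : P) w f : cone_weight w -> past_smooth f ->
  dirD v (cone a w f) = cone a w (dirD v f).
Proof.
move=> ww pf; apply/funext => p.
exact: (@derive_val _ _ _ _ _ _ _ (cone_is_derive m2 a a0 w f p v ww pf)).
Qed.

Lemma laplacian_cone w f : cone_weight w -> past_smooth f ->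
  laplacian (cone a w f) = cone a w (laplacian f).
Proof.
move=> ww pf; rewrite [in RHS]/laplacian cone_sum//; last first.
  by move=> i; do 2 apply: past_smooth_dx.
apply/funext => p; apply: eq_bigr => i _; rewrite !dxE.
by rewrite (dirD_cone _ _ _ ww pf) (dirD_cone _ _ _ ww (past_smooth_dirD _ _ pf)).
Qed.

Lemma boxb_cone b w f : cone_weight w -> past_smooth f ->
  boxb b (cone a w f) = cone a w (boxb b f).
Proof.
move=> ww pf; rewrite /boxb (laplacian_cone _ _ ww pf) !dtE.
rewrite (dirD_cone _ _ _ ww pf) (dirD_cone _ _ _ ww (past_smooth_dirD _ _ pf)).
have pl := past_smooth_laplacian _ pf.
rewrite (coneB _ _ _ ww (past_smooth_dirD _ _ (past_smooth_dirD _ _ pf)) (past_smoothZ b _ pl)).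
by rewrite (coneZ _ _ _ ww pl).
Qed.

Lemma iter_boxb_cone b n w f : cone_weight w -> past_smooth f ->
  iter n (boxb b) (cone a w f) = cone a w (iter n (boxb b) f).
Proof.
move=> ww pf; elim: n => [|n IH]; first by [].
by rewrite !iterS IH (boxb_cone _ _ _ ww (past_smooth_iter_boxb b n _ pf)).
Qed.

Lemma enorm_eq0 v : enorm v = 0 -> v = 0.
Proof.
move=> v0; apply/rowP => i; rewrite mxE; apply/eqP.
by rewrite -normr_le0 -v0 coord_le_enorm.
Qed.

Lemma sqr_enorm v : enorm v ^+ 2 = \sum_i v 0 i ^+ 2.
Proof. by rewrite sqr_sqrtr// sumr_ge0// => i _; exact: sqr_ge0. Qed.

Lemma cone_weight1 : cone_weight (fun _ : 'rV[R]_m => 1).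
Proof.
split; first exact: measurable_cst.
by move=> v; rewrite normr1 -addrA lerDl addr_ge0 ?invr_ge0 ?enorm_ge0.
Qed.

Lemma cone_weight0 : cone_weight (fun _ : 'rV[R]_m => 0).
Proof.
apply: (cone_weight_le _ _ cone_weight1); first exact: measurable_cst.
by move=> v; rewrite normr0 normr1.
Qed.

Lemma cone_weight_enorm : cone_weight (@enorm R m).
Proof.
split; first exact: measurable_enorm.
move=> v; rewrite ger0_norm ?enorm_ge0// addrAC lerDr.
by rewrite addr_ge0 ?invr_ge0 ?enorm_ge0.
Qed.

Lemma cone_weight_coord i : cone_weight (fun v : 'rV[R]_m => v 0 i).
Proof.
apply: (cone_weight_le _ _ cone_weight_enorm); first exact: measurable_row.
by move=> v; rewrite [leRHS]ger0_norm ?enorm_ge0// coord_le_enorm.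
Qed.

Lemma cone_weight_inv : cone_weight (fun v : 'rV[R]_m => (enorm v)^-1).
Proof.
split; first exact: measurable_inv_enorm.
move=> v; rewrite ger0_norm ?invr_ge0 ?enorm_ge0// lerDr.
by rewrite addr_ge0 ?enorm_ge0.
Qed.

Lemma cone_weight_dir i : cone_weight (fun v : 'rV[R]_m => v 0 i * (enorm v)^-1).
Proof.
have := cone_weight_radial _ i cone_weight1.
by under eq_fun do rewrite mul1r.
Qed.

(** The derivative of [v_i / |v|] in direction [i], extended by 0 at the vertex. *)
Definition dir_weight_deriv i v := (enorm v)^-1 - v 0 i ^+ 2 * (enorm v)^-1 ^+ 3.

Lemma cone_weight_dir_deriv i : cone_weight (dir_weight_deriv i).
Proof.
apply: (cone_weight_le _ _ cone_weight_inv).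
  apply: measurable_funB; first exact: measurable_inv_enorm.
  apply: measurable_funM; apply: measurable_funX; first exact: measurable_row.
  exact: measurable_inv_enorm.
move=> v; rewrite /dir_weight_deriv; set e := (enorm v)^-1.
have e0 : 0 <= e by rewrite invr_ge0 enorm_ge0.
have -> : e - v 0 i ^+ 2 * e ^+ 3 = e * (1 - (v 0 i * e) ^+ 2) by ring.
rewrite normrM ler_piMr//.
have h : (v 0 i * e) ^+ 2 <= 1.
  by rewrite -[_ ^+ 2]real_normK ?num_real// exprn_ile1// coord_div_enorm_le.
by rewrite ler_norml; have := sqr_ge0 (v 0 i * e); lra.
Qed.

Lemma other_index (i : 'I_m) : exists j, i != j.
Proof.
have [i0|i0] := eqVneq (i : nat) 0%N.
  by exists (Ordinal m2); rewrite -val_eqE /= i0.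
by exists (Ordinal (ltnW m2)); rewrite -val_eqE.
Qed.

Local Notation C := (cone a (fun=> 1)).
Local Notation N i := (cone a (fun v => v 0 i * (enorm v)^-1)).
Local Notation N1 := (cone a (fun v => (enorm v)^-1)).
Local Notation Cr := (cone a (@enorm R m)).
Local Notation Cx i := (cone a (fun v => v 0 i)).

Lemma sum3_eq0 n (A B D : 'I_n -> R) : (forall i, A i + B i + D i = 0) ->
  \sum_i A i + \sum_i B i + \sum_i D i = 0.
Proof. by move=> E; rewrite -!big_split big1 => [|i _]; [by []|exact: E]. Qed.

(** [cone_ibp] with the constant weight 1. The lemmas [cone_enorm_dx], [cone_coord_dx] and
    [cone_dir_dx] use the weights [|v|], [v_i] and [v_i / |v|], the last two summed over [i]. *)
Lemma cone_dx i u p : past_smooth u -> C (dx i u) p = - a * N i (dt u) p.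
Proof.
move=> pu; have [j ij] := other_index i.
have c0 v : v 0 j != 0 -> continuous (fun _ : R => 0 : R) by move=> _ s; exact: cvg_cst.
have := cone_ibp m2 a a0 (fun=> 1) (fun=> 0) i j u p ij cone_weight1 cone_weight0
  (fun v s _ => is_derive_cst _ _ _) c0 pu.
have -> : cone a (fun=> 0) u p = 0.
  by rewrite coneE; under eq_Rintegral do rewrite mul0r; rewrite Rintegral_cst// mul0r.
under [X in cone a X (dt u) p]eq_fun do rewrite mul1r.
by rewrite add0r mulNr => /eqP; rewrite addr_eq0 => /eqP.
Qed.

Lemma cone_enorm_dx i u p : past_smooth u ->
  N i u p + Cr (dx i u) p + a * Cx i (dt u) p = 0.
Proof.
move=> pu; have [j ij] := other_index i.
have := cone_ibp m2 a a0 (@enorm R m) (fun v => v 0 i * (enorm v)^-1) i j u p ij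
  cone_weight_enorm (cone_weight_dir i).
have -> : (fun v : 'rV[R]_m => enorm v * (v 0 i / enorm v)) = (fun v => v 0 i).
  apply/funext => v; have [v0|v0] := eqVneq (enorm v) 0.
    by rewrite (enorm_eq0 _ v0) mxE mul0r mulr0.
  by rewrite mulrCA mulfV ?mulr1.
apply=> //.
- by move=> v s vj; exact: is_derive_enorm_line ij vj s.
- move=> v vj s; apply: cvgM; first exact: continuous_line_coord.
  exact: (is_derive_continuous _ _ _ (is_derive_inv_enorm_line _ _ _ ij vj s)).
Qed.

Lemma sum_coord_enorm v : \sum_i v 0 i * (v 0 i * (enorm v)^-1) = enorm v.
Proof.
under eq_bigr do rewrite mulrA -expr2; rewrite -mulr_suml -sqr_enorm.
have [->|v0] := eqVneq (enorm v) 0; first by rewrite invr0 mulr0.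
by rewrite expr2 mulfK.
Qed.

(** Integration by parts against the position field: its divergence is [m], its radial component is
    [|v|]. *)
Lemma cone_coord_dx u p : past_smooth u ->
  m%:R * C u p + \sum_i Cx i (dx i u) p + a * Cr (dt u) p = 0.
Proof.
move=> pu.
have E i : C u p + Cx i (dx i u) p + a * cone a (fun v => v 0 i * (v 0 i * (enorm v)^-1)) (dt u) p = 0.
  have [j ij] := other_index i.
  apply: (cone_ibp m2 a a0 (fun v => v 0 i) (fun=> 1) i j u p ij (cone_weight_coord i) cone_weight1) => //.
  - by move=> v s vj; exact: is_derive_line_coord.
  - by move=> v vj s; exact: cvg_cst.
have := cone_weight_sum m (fun i v => v 0 i * (v 0 i * (enorm v)^-1)) (dt u) p
   (fun i => cone_weight_radial _ i (cone_weight_coord i)) (past_smooth_dt _ pu).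
under [X in cone a X _ _]eq_fun do rewrite sum_coord_enorm.
move=> ->; rewrite mulr_sumr.
have := sum3_eq0 m _ _ _ E.
by rewrite sumr_const card_ord -(mulr_natl (C u p)).
Qed.

(** Integration by parts against the unit radial field [v / |v|], whose divergence is
    [(m - 1) / |v|]; this is how the weight [1 / |v|] enters. *)
Lemma cone_dir_dx u p : past_smooth u ->
  (m%:R - 1) * N1 u p + \sum_i N i (dx i u) p + a * C (dt u) p = 0.
Proof.
move=> pu.
have wd i : cone_weight (fun v => v 0 i * (enorm v)^-1 * (v 0 i * (enorm v)^-1)).
  by apply: (cone_weight_radial _ i); exact: cone_weight_dir.
have E i : cone a (dir_weight_deriv i) u p + N i (dx i u) p +
    a * cone a (fun v => v 0 i * (enorm v)^-1 * (v 0 i * (enorm v)^-1)) (dt u) p = 0.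
  have [j ij] := other_index i.
  apply: (cone_ibp m2 a a0 _ _ i j u p ij (cone_weight_dir i) (cone_weight_dir_deriv i)) => //.
  - move=> v s vj.
    have := is_deriveM (is_derive_line_coord i v s) (is_derive_inv_enorm_line _ _ _ ij vj s).
    by congr (is_derive _ _ _ _); rewrite /dir_weight_deriv /GRing.scale/=; ring.
  - move=> v vj s.
    have ci : (enorm (v + s *: delta_mx 0 i))^-1 @[s --> s] --> (enorm (v + s *: delta_mx 0 i))^-1.
      exact: (is_derive_continuous _ _ _ (is_derive_inv_enorm_line _ _ _ ij vj s)).
    apply: cvgB; first exact: ci.
    apply: cvgM; last by apply: cvgM => //; apply: cvgM.
    by apply: cvgM; exact: continuous_line_coord.
have S1 := cone_weight_sum _ _ _ p wd (past_smooth_dt _ pu).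
have S2 := cone_weight_sum _ _ _ p cone_weight_dir_deriv pu.
pose j : 'I_m := Ordinal m2.
have ws n (W : 'I_n -> 'rV[R]_m -> R) w : cone_weight w ->
    (forall i, cone_weight (W i)) -> (forall v, `|\sum_(i < n) W i v| <= `|w v|) ->
    cone_weight (fun v => \sum_(i < n) W i v).
  move=> ww wW le; apply: (cone_weight_le _ _ ww) => //.
  by apply: measurable_sum => i; case: (wW i).
have sq1 v : v 0 j != 0 -> \sum_(i < m) (v 0 i * (enorm v)^-1 * (v 0 i * (enorm v)^-1)) = 1.
  move=> vj; have v0 : enorm v != 0.
    by apply: contra_neq vj => /enorm_eq0 ->; rewrite mxE.
  under eq_bigr do rewrite mulrACA -expr2; rewrite -mulr_suml -sqr_enorm.
  by rewrite -expr2 exprVn mulfV// expf_neq0.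
have sqle v : \sum_(i < m) (v 0 i * (enorm v)^-1 * (v 0 i * (enorm v)^-1)) <= 1.
  have [v0|v0] := eqVneq (enorm v) 0.
    by rewrite big1// => i _; rewrite v0 invr0 !mulr0.
  under eq_bigr do rewrite mulrACA -expr2; rewrite -mulr_suml -sqr_enorm.
  by rewrite -expr2 exprVn mulfV// expf_neq0.
have sum0 v : 0 <= \sum_(i < m) (v 0 i * (enorm v)^-1 * (v 0 i * (enorm v)^-1)).
  by apply: sumr_ge0 => i _; rewrite -expr2 sqr_ge0.
(* The squares of [v_i / |v|] sum to 1 except at the vertex, where the sum is 0; hence the passage
   through [eq_cone_off]. *)
have {}S1 : \sum_(i < m) cone a (fun v => v 0 i * (enorm v)^-1 * (v 0 i * (enorm v)^-1)) (dt u) p = C (dt u) p.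
  apply: etrans (esym S1) _; apply: (congr1 (fun F => F p)).
  apply: (eq_cone_off _ _ j); last exact: sq1.
  - apply: (ws _ _ (fun=> 1)); [exact: cone_weight1|exact: wd|].
    by move=> v; rewrite normr1 ger0_norm.
  - exact: cone_weight1.
  - exact: past_smooth_dt.
have dirE v : \sum_(i < m) dir_weight_deriv i v = (m%:R - 1) * (enorm v)^-1.
  rewrite /dir_weight_deriv sumrB sumr_const card_ord -mulr_suml -sqr_enorm.
  rewrite mulrBl mul1r; congr (_ - _); first by rewrite mulr_natl.
  have [->|v0] := eqVneq (enorm v) 0; first by rewrite invr0 expr2 !mul0r.
  by rewrite [_^-1 ^+ 3]exprS mulrCA exprVn mulfV ?mulr1// expf_neq0.
have {}S2 : \sum_(i < m) cone a (dir_weight_deriv i) u p = (m%:R - 1) * N1 u p.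
  apply: etrans (esym S2) _.
  rewrite !coneE -(RintegralZl (m%:R - 1) measurableT (cone_integrable m2 a a0 _ u p cone_weight_inv pu)).
  by apply: eq_Rintegral => y _; rewrite dirE mulrA.
apply: etrans (sum3_eq0 m _ _ _ E).
congr (_ + _ + _); first exact: esym S2.
by apply: etrans (mulr_sumr _ _ _ _); congr (_ * _); exact: esym S1.
Qed.

End cone_identities.

(** * Commutation with multiplication by coordinates *)

Section cone_commutation.
Context {R : realType} {m : nat}.
Hypothesis m2 : (1 < m)%N.
Variables a b : R.
Hypotheses (a0 : 0 < a) (ba : b * a ^+ 2 = 1).
Local Notation P := ('rV[R]_m * R)%type.
Implicit Types (f g u : P -> R).

Local Notation C := (cone a (fun=> 1)).
Local Notation N i := (cone a (fun v => v 0 i * (enorm v)^-1)).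
Local Notation N1 := (cone a (fun v => (enorm v)^-1)).
Local Notation Cr := (cone a (@enorm R m)).
Local Notation Cx i := (cone a (fun v => v 0 i)).

Lemma boxbE u : boxb b u = fun p => dt (dt u) p - b * laplacian u p.
Proof. by []. Qed.

Lemma laplacian_sum u : laplacian u = fun p => \sum_(i < m) dx i (dx i u) p.
Proof. by []. Qed.

Lemma dx_laplacian i u : past_smooth u -> dx i (laplacian u) = laplacian (dx i u).
Proof. exact: laplacian_dirD. Qed.

Lemma dx_boxb i u : past_smooth u -> dx i (boxb b u) = boxb b (dx i u).
Proof. exact: boxb_dirD. Qed.

Lemma dx_sum j n (F : 'I_n -> P -> R) : (forall i, past_smooth (F i)) ->
  dx j (fun p => \sum_(i < n) F i p) = fun p => \sum_(i < n) dx j (F i) p.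
Proof. exact: dirD_sum. Qed.

Lemma dx_dt i f : past_smooth f -> dx i (dt f) = dt (dx i f).
Proof. move=> pf; exact: dirD_comm. Qed.

Lemma dx_cone i w f : cone_weight w -> past_smooth f ->
  dx i (cone a w f) = cone a w (dx i f).
Proof. exact: dirD_cone. Qed.

Lemma dt_cone w f : cone_weight w -> past_smooth f ->
  dt (cone a w f) = cone a w (dt f).
Proof. exact: dirD_cone. Qed.

Lemma dtB f g : smooth f -> smooth g ->
  dt (fun p => f p - g p) = fun p => dt f p - dt g p.
Proof. exact: dirDB. Qed.

Lemma dtZ c f : smooth f -> dt (fun p => c * f p) = fun p => c * dt f p.
Proof. exact: dirDZ. Qed.

Opaque cone dx dt dirD laplacian boxb.

(** The difference is constant on vertical lines and zero at late times; a step of length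
    [|t0| + |p.2| + 1] from [p] leads past [t0]. *)
Lemma dt_inj f g : past_smooth f -> past_smooth g -> dt f = dt g -> f = g.
Proof.
move=> pf pg E.
pose h := fun p => f p - g p.
have ph : past_smooth h by exact: past_smoothB.
have dh p : 'D_(0, 1) h p = 0.
  have /(congr1 (fun F => F p)) := dtB _ _ pf.1 pg.1.
  by rewrite E subrr.
have [t0 h0] := ph.2.
apply/funext => p; apply/eqP; rewrite -subr_eq0; apply/eqP.
have [c _] := MVT_line h p (0, 1) (`|t0| + `|p.2| + 1)
  (fun q => smooth_derivable _ _ _ ph.1).
rewrite dh mulr0 h0; last first.
  rewrite /= /GRing.scale/= mulr1.
  have := ler_norm t0; have := ler_norm (- p.2); rewrite normrN; lra.
by rewrite sub0r => /eqP; rewrite oppr_eq0 => /eqP.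
Qed.

Let arith1 (M n c r x s : R) : c = - a * n -> n + r + a * x = 0 ->
  M * c + s + a * r = 0 -> a ^+ 2 * x = (M + 1) * c + s.
Proof.
move=> -> h1 h2; have -> : a ^+ 2 * x = a * (n + r + a * x) - a * n - a * r by ring.
have -> : a * r = - (M * (- a * n) + s).
  by apply/eqP; rewrite -addr_eq0 addrC; apply/eqP.
rewrite h1.
ring.
Qed.

(** Eliminates the weights [v_i / |v|] and [|v|] from [cone_dx], [cone_enorm_dx] at [dt u] and
    [cone_coord_dx] at [dx i u]. *)
Lemma cone_coord_dtt i u p : past_smooth u ->
  a ^+ 2 * Cx i (dt (dt u)) p =
  (m%:R + 1) * C (dx i u) p + \sum_j Cx j (dx j (dx i u)) p.
Proof.
move=> pu; have pt := past_smooth_dt _ pu; have pi := past_smooth_dx i _ pu.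
have h1 := cone_dx m2 a a0 i u p pu.
have h2 := cone_enorm_dx m2 a a0 i (dt u) p pt.
have h3 := cone_coord_dx m2 a a0 (dx i u) p pi.
rewrite (dx_dt i u pu) in h2.
exact: (arith1 _ _ _ _ _ _ h1 h2 h3).
Qed.

Let weightx := @cone_weight_coord R m.
Let weight1 := @cone_weight1 R m.

Lemma sum_cone_dx_dx u p : past_smooth u ->
  \sum_i C (dx i (dx i u)) p = C (laplacian u) p.
Proof.
move=> pu; have pii i : past_smooth (dx i (dx i u)) by do 2 apply: past_smooth_dx.
apply: etrans (congr1 (fun F => F p) (esym (cone_sum m2 a a0 _ m _ weight1 pii))) _.
by rewrite laplacian_sum.
Qed.

(** Apply [cone_coord_dtt] to [dx i u] and sum over [i]. The double sum of third derivatives equals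
    the Laplacian part of [boxb b u], whose coefficient is [b * a ^+ 2 = 1], and the two cancel. *)
Lemma sum_cone_coord_box u p : past_smooth u ->
  a ^+ 2 * \sum_i Cx i (dx i (boxb b u)) p = (m%:R + 1) * C (laplacian u) p.
Proof.
move=> pu.
have pl := past_smooth_laplacian _ pu; have pt := past_smooth_dt _ pu.
have ptt := past_smooth_dt _ pt.
have E i : a ^+ 2 * Cx i (dx i (boxb b u)) p =
    (m%:R + 1) * C (dx i (dx i u)) p + \sum_j Cx j (dx j (dx i (dx i u))) p
    - Cx i (dx i (laplacian u)) p.
  have pi := past_smooth_dx i _ pu.
  rewrite -(cone_coord_dtt i _ p pi).
  have -> : dx i (boxb b u) = fun p => dt (dt (dx i u)) p - b * dx i (laplacian u) p.
    by rewrite (dx_boxb i u pu) boxbE (dx_laplacian i u pu).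
  rewrite (coneB m2 a a0 _ _ _ (weightx i) (past_smooth_dt _ (past_smooth_dt _ pi))
    (past_smoothZ b _ (past_smooth_dx i _ pl))).
  rewrite (coneZ m2 a a0 _ b _ (weightx i) (past_smooth_dx i _ pl)).
  rewrite mulrBr; congr (_ - _); rewrite mulrA (mulrC _ b) ba mul1r//.
have S0 : a ^+ 2 * \sum_i Cx i (dx i (boxb b u)) p =
    (m%:R + 1) * \sum_i C (dx i (dx i u)) p
    + \sum_i \sum_j Cx j (dx j (dx i (dx i u))) p - \sum_i Cx i (dx i (laplacian u)) p.
  by rewrite mulr_sumr (eq_bigr _ (fun i _ => E i)) sumrB big_split/= -mulr_sumr.
have S2 : \sum_i \sum_j Cx j (dx j (dx i (dx i u))) p = \sum_j Cx j (dx j (laplacian u)) p.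
  apply: etrans (exchange_big _ _ _ _ _ _) _; apply: eq_bigr => j _.
  have pji i : past_smooth (dx j (dx i (dx i u))) by do 3 apply: past_smooth_dx.
  apply: etrans (congr1 (fun F => F p) (esym (cone_sum m2 a a0 _ m _ (weightx j) pji))) _.
  apply: (congr1 (fun F => Cx j F p)); rewrite laplacian_sum.
  have pii i : past_smooth (dx i (dx i u)) by do 2 apply: past_smooth_dx.
  exact: (esym (dx_sum j m (fun i => dx i (dx i u)) pii)).
have comb (A A' B D : R) : A = A' -> B = D -> (m%:R + 1) * A + B - D = (m%:R + 1) * A'.
  by move=> -> ->; rewrite addrK.
exact: etrans S0 (comb _ _ _ _ (sum_cone_dx_dx u p pu) S2).
Qed.

Let a2 : a ^+ 2 != 0. Proof. by rewrite expf_neq0// gt_eqF. Qed.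

(** The left side is [C (x_i [] u) - x_i C [] u]. The identities give [Cx i] only on second time
    derivatives, so the two sides are compared after [dt] twice, where [b * a ^+ 2 = 1] makes the
    Laplacian terms cancel. *)
Lemma cone_coord_box i u : past_smooth u ->
  Cx i (boxb b u) = fun p => (m%:R + 1) * b * C (dx i u) p.
Proof.
move=> pu.
have pb := past_smooth_boxb b _ pu; have pi := past_smooth_dx i _ pu.
have pc w f : cone_weight w -> past_smooth f -> past_smooth (cone a w f).
  by move=> ww pf; exact: past_smooth_cone.
apply: dt_inj.
  exact: pc.
  by apply: past_smoothZ; exact: pc.
apply: dt_inj.
- by apply: past_smooth_dt; exact: pc.
- by apply: past_smooth_dt; apply: past_smoothZ; exact: pc.
rewrite (dt_cone _ _ (weightx i) pb) (dt_cone _ _ (weightx i) (past_smooth_dt _ pb)).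
rewrite (dtZ _ _ (pc _ _ weight1 pi).1) (dtZ _ _ (past_smooth_dt _ (pc _ _ weight1 pi)).1).
rewrite (dt_cone _ _ weight1 pi) (dt_cone _ _ weight1 (past_smooth_dt _ pi)).
apply/funext => p; apply: (mulfI a2); apply: (mulfI a2).
rewrite (cone_coord_dtt i _ p pb).
rewrite (dx_boxb i u pu) [in LHS]mulrDr (sum_cone_coord_box (dx i u) p pi).
have ptt := past_smooth_dt _ (past_smooth_dt _ pi).
have pl := past_smooth_laplacian _ pi.
rewrite boxbE.
rewrite (coneB m2 a a0 _ _ _ weight1 ptt (past_smoothZ b _ pl)) (coneZ m2 a a0 _ b _ weight1 pl).
move: (C (dt (dt (dx i u))) p) (C (laplacian (dx i u)) p) => x y.
have -> : a ^+ 2 * (a ^+ 2 * ((m%:R + 1) * b * x)) = a ^+ 2 * (m%:R + 1) * x * (b * a ^+ 2) by ring.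
have -> : a ^+ 2 * ((m%:R + 1) * (x - b * y)) + (m%:R + 1) * y =
  a ^+ 2 * (m%:R + 1) * x + (m%:R + 1) * y * (1 - b * a ^+ 2) by ring.
by rewrite ba; ring.
Qed.

(** In [cone_dir_dx] at [dt u], [cone_dx] turns each [N i (dt (dx i u))] into
    [- a^-1 C (dx i (dx i u))]. With [b = a^-2] the sum is a multiple of [C (boxb b u)]. *)
Lemma cone_inv_dt u : past_smooth u ->
  N1 (dt u) = fun p => - (a / (m%:R - 1)) * C (boxb b u) p.
Proof.
move=> pu; apply/funext => p.
have pt := past_smooth_dt _ pu; have ptt := past_smooth_dt _ pt.
have pl := past_smooth_laplacian _ pu.
have h4 := cone_dir_dx m2 a a0 (dt u) p pt.
have E i : N i (dx i (dt u)) p = - a^-1 * C (dx i (dx i u)) p.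
  rewrite (dx_dt i u pu) (cone_dx m2 a a0 i _ p (past_smooth_dx i _ pu)).
  by rewrite mulrA mulNr mulrN opprK mulVf ?mul1r// gt_eqF.
have {}E : \sum_i N i (dx i (dt u)) p = - a^-1 * C (laplacian u) p.
  apply: etrans (eq_bigr _ (fun i _ => E i)) _; apply: etrans (esym (mulr_sumr _ _ _ _)) _.
  by congr (_ * _); exact: sum_cone_dx_dx.
have {}h4 : (m%:R - 1) * N1 (dt u) p + (- a^-1 * C (laplacian u) p) + a * C (dt (dt u)) p = 0.
  by apply: etrans h4; congr (_ + _ + _); exact: esym E.
rewrite boxbE.
rewrite (coneB m2 a a0 _ _ _ weight1 ptt (past_smoothZ b _ pl)) (coneZ m2 a a0 _ b _ weight1 pl).
move: h4; move: (N1 (dt u) p) (C (dt (dt u)) p) (C (laplacian u) p) => x y z.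
have m1 : m%:R - 1 != 0 :> R by rewrite subr_eq0 pnatr_eq1 gtn_eqF.
have a1 : a != 0 by rewrite gt_eqF.
have -> : b = a^-1 ^+ 2 by rewrite exprVn -[b]mulr1 -(mulfV a2) mulrA ba mul1r.
move=> h; apply: (mulfI m1).
have -> : (m%:R - 1) * x = a^-1 * z - a * y by lra.
field; rewrite a1//=.
Qed.

Definition double_cone u := C (C (iter m.+1 (boxb b) u)).

Lemma past_smooth_C u : past_smooth u -> past_smooth (C u).
Proof. by move=> pu; exact: past_smooth_cone. Qed.

Lemma C_mulx i u : past_smooth u -> C (mulx i u) = fun p => mulx i (C u) p + Cx i u p.
Proof.
move=> pu; apply/funext => p; rewrite /mulx !coneE.
rewrite -(RintegralZl _ measurableT (cone_integrable m2 a a0 _ u p weight1 pu)).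
rewrite -RintegralD//; last 2 first.
- have := integrableZl measurableT (p.1 0 i) (cone_integrable m2 a a0 _ u p weight1 pu).
  by congr (integrable _ _ _); apply/funext => y /=; rewrite EFinM.
- exact: cone_integrable m2 a a0 _ u p (weightx i) pu.
by apply: eq_Rintegral => y _ /=; rewrite [in LHS]mxE !mul1r mulrDl.
Qed.

(** Why two cones and the power [m.+1]: moving [x_i] out of [boxb ^ m.+1] costs [- 2 (m + 1) b d_i],
    and each passage of [x_i] through a cone returns [(m + 1) b d_i]. *)
Lemma double_cone_mulx i u : past_smooth u ->
  double_cone (mulx i u) = mulx i (double_cone u).
Proof.
move=> pu; rewrite /double_cone (iter_boxb_mulx b m i u pu).
set w := iter m (boxb b) u.
have pw : past_smooth w by exact: past_smooth_iter_boxb.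
rewrite iterS -/w.
have pb := past_smooth_boxb b _ pw; have pi := past_smooth_dx i _ pw.
set k := 2 * m.+1%:R * b.
rewrite (coneB m2 a a0 _ _ _ weight1 (past_smooth_mulx i _ pb) (past_smoothZ k _ pi)).
rewrite (C_mulx i _ pb) (cone_coord_box i w pw) (coneZ m2 a a0 _ k _ weight1 pi).
have pC := past_smooth_C _ pi; have pCb := past_smooth_C _ pb.
have -> : (fun p => mulx i (C (boxb b w)) p + (m%:R + 1) * b * C (dx i w) p - k * C (dx i w) p)
  = fun p => mulx i (C (boxb b w)) p - ((m%:R + 1) * b) * C (dx i w) p.
  apply/funext => p; rewrite /k -natr1; ring.
rewrite (coneB m2 a a0 _ _ _ weight1 (past_smooth_mulx i _ pCb) (past_smoothZ _ _ pC)).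
rewrite (C_mulx i _ pCb) (coneZ m2 a a0 _ _ _ weight1 pC).
have -> : C (boxb b w) = boxb b (C w) by rewrite (boxb_cone m2 a a0 b _ w weight1 pw).
rewrite (cone_coord_box i _ (past_smooth_C _ pw)).
rewrite (dx_cone i _ w weight1 pw).
by apply/funext => p; rewrite addrK.
Qed.

End cone_commutation.

(** * Reduction to functions of time *)

Section hadamard.
Context {R : realType} {m : nat}.
Local Notation P := ('rV[R]_m * R)%type.
Implicit Types (f g u : P -> R).
Local Notation mu := (@lebesgue_measure R).

Definition unit_weight (s : R) : R := \1_([set` `[(0:R), 1]]) s.

Definition ray_avg (al al' : R -> R) f : P -> R :=
  avg mu al al' (fun=> 0) (fun=> 0) unit_weight f.

Lemma measurable_unit_weight : measurable_fun setT unit_weight.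
Proof. by apply: measurable_indic; exact: measurable_itv. Qed.

Lemma integrable_unit_weight : mu.-integrable setT (EFin \o unit_weight).
Proof.
apply/integrableP; split.
  by apply/measurable_EFinP; exact: measurable_unit_weight.
rewrite (_ : \int[mu]_x _ = \int[mu]_x (\1_([set` `[(0:R), 1]]) x)%:E)%E; last first.
  by apply: eq_integral => x _; rewrite gee0_abs// lee_fin /unit_weight indicE ler0n.
rewrite integral_indic//.
have E := @lebesgue_measure_itv R `[(0 : R), 1]; rewrite /= lte_fin ltr01 -EFinB in E.
by rewrite setIT; apply: (le_lt_trans (y := (1 - 0)%:E)); [rewrite -E|rewrite ltry].
Qed.

Lemma ray_admissible al al' : (forall s, 0 <= s <= 1 -> `|al s| <= 1 /\ `|al' s| <= 1) ->
  admissible mu al al' (fun=> 0) (fun=> 0 : 'rV[R]_m) unit_weight.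
Proof.
move=> al1.
have w01 s : unit_weight s != 0 -> 0 <= s <= 1.
  rewrite /unit_weight indicE; case: (boolP (s \in _)) => [|_]; last by rewrite eqxx.
  by rewrite inE /= in_itv.
split; first exact: measurable_unit_weight.
  by move=> s /w01/al1.
move=> p0 t0; exists unit_weight, (`|p0| + 1); split.
- exact: integrable_unit_weight.
- by move=> s; rewrite /unit_weight indicE ler0n.
have : \forall p \near p0, `|p - p0| < 1.
  by have /cvgrPdistC_lt := @cvg_id _ (nbhs p0); apply.
apply: filterS => p pp s /w01/al1[s1 s2] _; split.
  by rewrite ger0_norm// /unit_weight indicE ler0n.
have np : `|p| <= `|p0| + 1.
  have : `|p - p0| < 1 by [].
  by have := ler_normD (p - p0) p0; rewrite subrK; lra.
apply: le_trans np; rewrite /aff !addr0 !prod_normE/= ge_max normrZ normrM.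
by rewrite !le_max !ler_piMl//= orbT.
Qed.

Lemma ray_integrable (al al' : R -> R) f p : measurable_fun setT al -> measurable_fun setT al' ->
  (forall s, 0 <= s <= 1 -> `|al s| <= 1 /\ `|al' s| <= 1) -> past_smooth f ->
  mu.-integrable setT (EFin \o (fun s => unit_weight s * f (al s *: p.1, al' s * p.2))).
Proof.
move=> mal mal' al1 [sf f0].
have := avg_integrable mu al al' (fun=> 0) (fun=> 0) mal mal' (measurable_cst _)
  (fun i => measurable_cst _) unit_weight f p (ray_admissible _ _ al1)
  (smooth_continuous _ sf) f0.
by congr (integrable _ _ _); apply/funext => s /=; rewrite /aff !addr0.
Qed.

Lemma ray_avgE al al' f p : ray_avg al al' f p =
  \int[mu]_s (unit_weight s * f (al s *: p.1, al' s * p.2)).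
Proof. by apply: eq_Rintegral => s _; rewrite /aff !addr0. Qed.

Lemma smooth_ray_avg (al al' : R -> R) f : measurable_fun setT al -> measurable_fun setT al' ->
  (forall s, 0 <= s <= 1 -> `|al s| <= 1 /\ `|al' s| <= 1) -> past_smooth f ->
  smooth (ray_avg al al' f).
Proof.
move=> mal mal' al1 pf.
exact: (smooth_avg mu al al' (fun=> 0) (fun=> 0) mal mal' (measurable_cst _)
  (fun i => measurable_cst _) unit_weight f (ray_admissible _ _ al1) pf).
Qed.

Lemma integral_unit_weight_derive (F k : R -> R) :
  (forall s : R, is_derive s 1 F (k s)) -> continuous k ->
  \int[mu]_s (unit_weight s * k s) = F 1 - F 0.
Proof.
move=> dF ck.
have E : (\int[mu]_(s in [set` `[0%R, 1%R]]) (k s)%:E = (F 1 - F 0)%R%:E)%E.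
  rewrite EFinB; apply: continuous_FTC2 => //.
  - exact: continuous_subspaceT.
  - split.
    + by move=> x _; exact: ex_derive.
    + by apply: cvg_at_right_filter; exact: is_derive_continuous.
    + by apply: cvg_at_left_filter; exact: is_derive_continuous.
  - by move=> x _; rewrite derive1E; exact: derive_val.
apply: (@congr1 _ _ fine _ (EFin (F 1 - F 0))).
rewrite -E [RHS]integral_mkcond; apply: eq_integral => s _.
rewrite patchE /unit_weight indicE; case: ifPn => sI.
  by rewrite mul1r.
by rewrite mul0r.
Qed.

Lemma derive_row f (x : 'rV[R]_m) q : smooth f ->
  'D_(x, 0) f q = \sum_i x 0 i * dx i f q.
Proof.
move=> sf.
have D n (c : 'I_n -> R) (v : 'I_n -> 'rV[R]_m) :
    'D_(\sum_i c i *: v i, 0) f q = \sum_i c i * 'D_(v i, 0) f q.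
  elim: n c v => [|n IH] c v; first by rewrite !big_ord0; exact: derive0.
  rewrite !big_ord_recl -IH.
  have -> : (c ord0 *: v ord0 + \sum_(i < n) c (lift ord0 i) *: v (lift ord0 i), 0 : R) =
    (c ord0 *: v ord0, 0) + (\sum_(i < n) c (lift ord0 i) *: v (lift ord0 i), 0) :> P.
    by congr pair; rewrite addr0.
  rewrite derive_dirD//.
  - congr (_ + _); have := derive_split f (v ord0) 0 (c ord0) 0 q sf.
    by rewrite mul0r => ->; rewrite mul0r addr0.
  - by move=> q'; exact: smooth_derivable _ _ _ sf.
  - by move=> q'; exact: smooth_derivable _ _ _ sf.
  - exact: smooth_continuous _ (smooth_derive _ _ sf).
rewrite [in LHS](row_sum_delta x) D; apply: eq_bigr => i _; by [].
Qed.

Let m_id : measurable_fun setT (id : R -> R). Proof. exact: measurable_id. Qed.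
Let m_1 : measurable_fun setT ((fun=> 1) : R -> R).
Proof. exact: measurable_cst. Qed.
Let l_id1 (s : R) : 0 <= s <= 1 -> `|s| <= 1 /\ `|1 : R| <= 1.
Proof. by move=> /andP[s0 s1]; rewrite normr1 ger0_norm. Qed.
Let l_1id (s : R) : 0 <= s <= 1 -> `|1 : R| <= 1 /\ `|s| <= 1.
Proof. by move=> /l_id1[]. Qed.

(** [w i] is the integral of [d_i u (s x, t)] over [s] in [[0, 1]]. Only [x] is scaled, so it
    vanishes after the same time as [d_i u]. *)
Lemma hadamard_space u : past_smooth u ->
  exists w : 'I_m -> P -> R, (forall i, past_smooth (w i)) /\
    forall p, u p = u (0, p.2) + \sum_i mulx i (w i) p.
Proof.
move=> pu; exists (fun i => ray_avg id (fun=> 1) (dx i u)); split=> [i|[x t]].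
  have pi := past_smooth_dx i _ pu.
  split; first exact: smooth_ray_avg.
  by apply: avg_zero_past pi => p y _; rewrite /aff /= mul1r addr0.
have dF (s : R) : is_derive s 1 (fun s : R => u ((0, t) + s *: (x, 0)))
    ('D_(x, 0) u ((0, t) + s *: (x, 0))).
  by apply: is_derive_line; exact: smooth_derivable _ _ _ pu.1.
have E (s : R) : (0, t) + s *: (x, 0) = (s *: x, 1 * t) :> P.
  by congr pair; rewrite /= ?add0r// scaler0 addr0 mul1r.
have ck : continuous (fun s : R => 'D_(x, 0) u ((0, t) + s *: (x, 0))).
  move=> s; apply: (@continuous_comp _ _ _ (fun s : R => (0, t) + s *: (x, 0)) ('D_(x, 0) u)).
    by apply: cvgD; [exact: cvg_cst|apply: cvgZr_tmp; exact: cvg_id].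
  exact: smooth_continuous _ (smooth_derive _ _ pu.1) _.
have := integral_unit_weight_derive _ _ dF ck.
rewrite scale1r scale0r addr0.
have -> : (0, t) + (x, 0) = (x, t) :> P by congr pair; rewrite /= ?add0r ?addr0.
move=> /eqP; rewrite eq_sym subr_eq => /eqP -> /=; rewrite addrC; congr (_ + _).
have ii i : mu.-integrable setT (EFin \o (fun s : R => x 0 i * (unit_weight s * dx i u (s *: x, 1 * t)))).
  have := integrableZl measurableT (x 0 i) (ray_integrable id (fun=> 1) _ (x, t) m_id m_1 l_id1
    (past_smooth_dx i _ pu)).
  by congr (integrable _ _ _); apply/funext => s /=; rewrite EFinM.
transitivity (\sum_i \int[mu]_s (x 0 i * (unit_weight s * dx i u (s *: x, 1 * t)))); last first.
  apply: eq_bigr => i _; rewrite /mulx ray_avgE RintegralZl//.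
  exact: (ray_integrable id (fun=> 1) _ (x, t) m_id m_1 l_id1 (past_smooth_dx i _ pu)).
transitivity (\int[mu]_s (\sum_i (x 0 i * (unit_weight s * dx i u (s *: x, 1 * t))))).
  apply: eq_Rintegral => s _; rewrite E derive_row ?mulr_sumr; last exact: pu.1.
  by apply: eq_bigr => i _; rewrite mulrCA.
have S n (W : 'I_n -> R -> R) : (forall i, mu.-integrable setT (EFin \o W i)) ->
    \int[mu]_s (\sum_i W i s) = \sum_i \int[mu]_s W i s.
  elim: n W => [|n IH] W iW.
    rewrite big_ord0; under eq_Rintegral do rewrite big_ord0.
    by rewrite Rintegral_cst// mul0r.
  rewrite big_ord_recl -IH//; under eq_Rintegral do rewrite big_ord_recl.
  rewrite RintegralD//.
  have : mu.-integrable setT (fun s => \sum_(i < n) (W (lift ord0 i) s)%:E)%E.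
    by apply: integrable_sum => // i _; exact: iW.
  by congr (integrable _ _ _); apply/funext => s /=; rewrite sumEFin.
exact: S.
Qed.

Lemma hadamard_time u : past_smooth u -> (forall x, u (x, 0) = 0) ->
  exists w, [/\ past_smooth w, u = mult w &
    (forall p, u p = u (0, p.2)) -> forall p, w p = w (0, p.2)].
Proof.
move=> pu u0; pose w := ray_avg (fun=> 1) id (dt u).
have pt := past_smooth_dt _ pu.
have E p : u p = p.2 * w p.
  case: p => x t.
  have dF (s : R) : is_derive s 1 (fun s : R => u ((x, 0) + s *: (0, t)))
      ('D_(0, t) u ((x, 0) + s *: (0, t))).
    by apply: is_derive_line; exact: smooth_derivable _ _ _ pu.1.
  have ck : continuous (fun s : R => 'D_(0, t) u ((x, 0) + s *: (0, t))).
    move=> s; apply: (@continuous_comp _ _ _ (fun s : R => (x, 0) + s *: (0, t)) ('D_(0, t) u)).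
      by apply: cvgD; [exact: cvg_cst|apply: cvgZr_tmp; exact: cvg_id].
    exact: smooth_continuous _ (smooth_derive _ _ pu.1) _.
  have := integral_unit_weight_derive _ _ dF ck.
  rewrite scale1r scale0r addr0 u0 subr0.
  have -> : (x, 0) + (0, t) = (x, t) :> P by congr pair; rewrite /= ?add0r ?addr0.
  move=> <-; rewrite /w ray_avgE -RintegralZl//; last first.
    exact: (ray_integrable (fun=> 1) id _ (x, t) m_1 m_id l_1id pt).
  apply: eq_Rintegral => s _ /=; rewrite mulrCA; congr (_ * _).
  have := derive_split u 0 1 0 t ((x, 0) + s *: (0, t)) pu.1.
  rewrite scaler0 mulr1 mul0r add0r => ->; congr (t * dt u _).
  by congr pair; rewrite /= ?add0r// scaler0 addr0 scale1r.
exists w; split.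
- split; first exact: smooth_ray_avg.
  (* Scaling [t] moves points back in time, so the vanishing of [w] cannot be seen under the
     integral. It follows from [u = t * w] for [t > 0]. *)
  have [t0 ut] := pu.2; exists (Num.max t0 0) => p; rewrite gt_max => /andP[p1 p2].
  by have /eqP := E p; rewrite ut// eq_sym mulf_eq0 gt_eqF//= => /eqP.
- exact/funext.
- move=> ut p; rewrite /w !ray_avgE; apply: eq_Rintegral => s _ /=; congr (_ * _).
  have dtt q : dt u q = dt u (0, q.2).
    rewrite /dt /derive; apply: (congr1 (fun F : R -> R => lim (F @ 0^'))).
    apply/funext => h /=; rewrite [in LHS]ut [in RHS]ut [u q]ut/=.
    by congr (_ *: (u _ - _)).
  by rewrite dtt/= [RHS]dtt.
Qed.

End hadamard.

Section cube.
Context {R : realType}.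
Local Notation T := (measurableTypeR R).

Definition cube n (r : R) : set (n.-tuple T) := [set y | forall i, 0 <= tnth y i <= r].

Lemma measurable_cube n r : measurable (cube n r).
Proof.
rewrite (_ : cube n r = \bigcap_(i in [set: 'I_n]) ((@tnth n T)^~ i @^-1` [set` `[0, r]])).
  apply: fin_bigcap_measurable => // i _.
  by rewrite -[X in measurable X]setTI; apply: measurable_tnth.
apply/seteqP; split=> y h i; first by move=> _; have := h i; rewrite /= in_itv.
by have := h i I; rewrite /= in_itv.
Qed.

(** Supplies sets of positive measure arbitrarily close to the vertex, for [cone_pos]. *)
Lemma lebesgue_tuple_cube n r : 0 < r -> lebesgue_tuple n (cube n r) = (r ^+ n)%:E.
Proof.
move=> r0; elim: n => [|n IH].
  by rewrite /= diracE mem_set// => -[].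
have := measurable_cube n r => mc.
rewrite /= /cons_measure /pushforward.
have -> : tuple_cons @^-1` (cube n.+1 r) = [set` `[0, r]] `*` cube n r.
  apply/seteqP; split=> -[x y] /=.
    move=> h; split => [|i].
      by have := h ord0; rewrite in_itv tnth_tuple_cons0.
    by have := h (lift ord0 i); rewrite tnth_tuple_consS.
  move=> [hx hy] i; case: (unliftP ord0 i) => [j|] ->.
    by rewrite tnth_tuple_consS; exact: hy.
  by rewrite tnth_tuple_cons0; move: hx; rewrite in_itv.
rewrite product_measure1E//.
rewrite [X in (_ * X)%E]IH exprS EFinM; congr (_ * _)%E.
have := @lebesgue_measure_itv R `[0, r]; rewrite /= lte_fin r0 -EFinB subr0.
by apply.
Qed.

End cube.

Section time_only.
Context {R : realType} {m : nat}.
Hypothesis m2 : (1 < m)%N.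
Variable a : R.
Hypothesis a0 : 0 < a.
Local Notation P := ('rV[R]_m * R)%type.
Implicit Types (f g u : P -> R).

Local Notation C := (cone a (fun=> 1)).
Local Notation Cr := (cone a (@enorm R m)).

Definition trans (q : P) f : P -> R := fun p => f (p + q).

Lemma trans_dirD q v f : smooth f -> dirD v (trans q f) = trans q (dirD v f).
Proof.
move=> sf; apply/funext => p.
exact: (@derive_val _ _ _ _ _ _ _ (derive_translate f p q v (smooth_derivable f v _ sf))).
Qed.

Lemma past_smooth_trans q f : past_smooth f -> past_smooth (trans q f).
Proof.
move=> [sf [t0 f0]]; split; last first.
  by exists (t0 - q.2) => p; rewrite ltrBlDr => h; exact: f0.
apply: (smooth_coind (fun h => exists2 g, smooth g & h = trans q g)); last by exists f.
move=> _ [g sg ->]; split=> [p|v].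
  apply: (@continuous_comp _ _ _ (fun p : P => p + q) g); last exact: smooth_continuous.
  by apply: cvgD; [exact: cvg_id|exact: cvg_cst].
split=> [p|]; last by exists (dirD v g); [exact: smooth_derive|exact: trans_dirD].
exact: (@ex_derive _ _ _ _ _ _ _ (derive_translate g p q v (smooth_derivable g v _ sg))).
Qed.

Lemma trans_cone q w f : cone a w (trans q f) = trans q (cone a w f).
Proof.
apply/funext => p; rewrite /trans !coneE; apply: eq_Rintegral => y _.
congr (_ * f _); rewrite [LHS]/= ; congr pair; first by rewrite addrAC.
by rewrite addrAC.
Qed.

Lemma trans_iter_dt q n f : past_smooth f ->
  iter n dt (trans q f) = trans q (iter n dt f).
Proof.
move=> pf; have pn k : past_smooth (iter k dt f).
  by elim: k => //= k; exact: past_smooth_dt.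
by elim: n => // n IH; rewrite !iterS IH; exact: trans_dirD (pn n).1.
Qed.

Definition time_only f := forall p, f p = f (0, p.2).

Lemma time_only_dt f : time_only f -> time_only (dt f).
Proof.
move=> tf p; rewrite /dt /derive; apply: (congr1 (fun F : R -> R => lim (F @ 0^'))).
apply/funext => h /=; rewrite [in LHS]tf [in RHS]tf [f p]tf/=.
by congr (_ *: (f _ - _)).
Qed.

Lemma time_only_dx i f : time_only f -> dx i f = fun=> 0.
Proof.
move=> tf; apply/funext => p; apply/cvg_lim => //; apply: cvg_near_cst; near=> h.
by rewrite /= tf/= [f p]tf scaler0 add0r subrr scaler0.
Unshelve. all: end_near. Qed.

Lemma past_smooth_iter_dt n f : past_smooth f -> past_smooth (iter n dt f).
Proof. by move=> pf; elim: n => //= n; exact: past_smooth_dt. Qed.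

Lemma time_only_iter_dt n f : time_only f -> time_only (iter n dt f).
Proof. by move=> pf; elim: n => //= n; exact: time_only_dt. Qed.

Lemma dt0 : dt ((fun=> 0) : P -> R) = fun=> 0.
Proof. by apply/funext => p; exact: derive_cst. Qed.

Opaque cone dx dt dirD.

Let weight1 := @cone_weight1 R m.
Let weightr := @cone_weight_enorm R m.

Lemma cone_enorm_dt f : past_smooth f -> time_only f ->
  (fun p => a * Cr (dt f) p) = fun p => - (m%:R * C f p).
Proof.
move=> pf tf; apply/funext => p; have := cone_coord_dx m2 a a0 f p pf.
have -> : \sum_i cone a (fun v => v 0 i) (dx i f) p = 0.
  by apply: big1 => i _; rewrite (time_only_dx i f tf); exact: cone0.
by rewrite addr0 => /eqP; rewrite addrC addr_eq0 => /eqP.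
Qed.

Lemma C_mult f : past_smooth f -> C (mult f) = fun p => mult (C f) p + a * Cr f p.
Proof.
move=> pf; apply/funext => p; rewrite /mult !coneE.
have i1 := cone_integrable m2 a a0 _ f p weight1 pf.
have i2 := cone_integrable m2 a a0 _ f p weightr pf.
rewrite -(RintegralZl p.2 measurableT i1) -(RintegralZl a measurableT i2).
rewrite -RintegralD//; last 2 first.
- have := integrableZl measurableT p.2 i1.
  by congr (integrable _ _ _); apply/funext => y /=; rewrite EFinM.
- have := integrableZl measurableT a i2.
  by congr (integrable _ _ _); apply/funext => y /=; rewrite EFinM.
by apply: eq_Rintegral => y _ /=; rewrite !mul1r mulrDl mulrA.
Qed.

Lemma iter_dt_mult n f : past_smooth f ->
  iter n.+1 dt (mult f) = fun p => mult (iter n.+1 dt f) p + n.+1%:R * iter n dt f p.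
Proof.
move=> pf; elim: n => [|n IH].
  by rewrite /= (dt_mult f pf); apply/funext => p; rewrite mul1r addrC.
have pn := past_smooth_iter_dt n _ pf; have pn1 := past_smooth_iter_dt n.+1 _ pf.
rewrite iterS IH.
have -> : dt (fun p => mult (iter n.+1 dt f) p + n.+1%:R * iter n dt f p) =
   fun p => dt (mult (iter n.+1 dt f)) p + dt (fun p => n.+1%:R * iter n dt f p) p.
  exact: dirDD (past_smooth_mult _ pn1).1 (past_smoothZ _ _ pn).1.
rewrite (dt_mult _ pn1) (dtZ _ _ pn.1) -!iterS; apply/funext => p.
by rewrite -[n.+2%:R]natr1; ring.
Qed.

(** Leibniz's rule leaves [m C (d_t^(m-1) f)], and the shift [a |v|] of the time along the cone
    leaves [a Cr (d_t^m f)]. By [cone_enorm_dt] these cancel: hence exactly [m] time derivatives. *)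
Lemma C_iter_dt_mult f : past_smooth f -> time_only f ->
  C (iter m dt (mult f)) = mult (C (iter m dt f)).
Proof.
move=> pf tf; have [n nE] : exists n, m = n.+1 by exists m.-1; rewrite prednK// ltnW.
have E1 k : k = n.+1 -> iter k dt (mult f) = fun p => mult (iter k dt f) p + k%:R * iter n dt f p.
  by move=> ->; exact: iter_dt_mult.
have E2 k : k = n.+1 -> dt (iter n dt f) = iter k dt f by move=> ->.
rewrite (E1 m nE).
have pn := past_smooth_iter_dt n _ pf; have pm := past_smooth_iter_dt m _ pf.
rewrite (coneD m2 a a0 _ _ _ weight1 (past_smooth_mult _ pm) (past_smoothZ _ _ pn)).
rewrite (C_mult _ pm) (coneZ m2 a a0 _ _ _ weight1 pn).
have := cone_enorm_dt _ pn (time_only_iter_dt n _ tf).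
rewrite (E2 m nE) => E; apply/funext => p.
by rewrite (congr1 (fun F => F p) E) addrNK.
Qed.

Lemma iter_dtB n c f g : past_smooth f -> past_smooth g ->
  iter n dt (fun p => f p - c * g p) = fun p => iter n dt f p - c * iter n dt g p.
Proof.
move=> pf pg; elim: n => // n IH; rewrite iterS IH.
have pfn := past_smooth_iter_dt n _ pf; have pgn := past_smooth_iter_dt n _ pg.
by rewrite (dtB _ _ pfn.1 (past_smoothZ c _ pgn).1) (dtZ _ _ pgn.1).
Qed.

Lemma iter_dt_inj n f g : past_smooth f -> past_smooth g ->
  iter n dt f = iter n dt g -> f = g.
Proof.
move=> pf pg; elim: n => // n IH; rewrite !iterS => /dt_inj E; apply: IH.
by apply: E; exact: past_smooth_iter_dt.
Qed.

Lemma iter_dt_cone n w f : cone_weight w -> past_smooth f ->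
  iter n dt (cone a w f) = cone a w (iter n dt f).
Proof.
move=> ww pf; elim: n => // n IH; rewrite !iterS IH.
by rewrite (dt_cone m2 a a0 _ _ ww (past_smooth_iter_dt n _ pf)).
Qed.

Lemma cone_pos f : past_smooth f -> (forall p, 0 <= f p) -> C f 0 = 0 -> f 0 = 0.
Proof.
move=> pf f0 Cf; apply/eqP; rewrite eq_le f0 andbT leNgt; apply/negP => fp.
have /cvgrPdist_lt/(_ _ fp) := smooth_continuous _ pf.1 (0 : P).
rewrite near_simpl => /nbhs_ballP[d /= d0 dP].
(* On the cube [|v| <= m r], and this [r] makes both [m r] and [a m r] smaller than [d]. *)
pose r := d / (2 * (1 + a) * m%:R).
have mp : 0 < m%:R :> R by rewrite ltr0n ltnW.
have m1 : 1 <= m%:R :> R by rewrite ler1n ltnW.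
have D0 : 0 < 2 * (1 + a) * m%:R by rewrite !mulr_gt0// addr_gt0.
have r0 : 0 < r by rewrite divr_gt0.
have rd : r * (2 * (1 + a) * m%:R) = d by rewrite /r divfK// gt_eqF.
have cubeP y : cube m r y -> 0 < f (row_of_tuple y, a * enorm (row_of_tuple y)).
  move=> cy; set p := (_, _).
  have e0 : enorm (row_of_tuple y) <= m%:R * r.
    have mr : 0 <= m%:R * r by rewrite mulr_ge0// ltW.
    rewrite -(ger0_norm mr) -sqrtr_sqr; apply: ler_wsqrtr.
    have : \sum_(i < m) (row_of_tuple y) 0 i ^+ 2 <= \sum_(i < m) r ^+ 2.
      apply: ler_sum => i _; rewrite mxE; have /andP[h1 h2] := cy i.
      by rewrite !expr2 ler_pM.
    rewrite sumr_const card_ord -(mulr_natl (r ^+ 2)) => /le_trans; apply.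
    by rewrite [leRHS]exprMn ler_pM2r ?exprn_gt0// expr2 ler_peMr// ltW.
  have pd : ball (0 : P) d p.
    rewrite -ball_normE /= sub0r normrN prod_normE gt_max /=.
    have := norm_le_enorm (row_of_tuple y).
    have := enorm_ge0 (row_of_tuple y); move: e0.
    move: (enorm _) => e h1 h2 h3.
    rewrite (ger0_norm (mulr_ge0 (ltW a0) h2)).
    have h4 : a * e <= a * (m%:R * r) by rewrite ler_pM2l.
    have h5 : 0 < m%:R * r by rewrite mulr_gt0.
    have h6 : 0 < a * (m%:R * r) by rewrite mulr_gt0.
    have rd' : 2 * (m%:R * r) + 2 * (a * (m%:R * r)) = d by rewrite -rd; ring.
    by apply/andP; split; [apply: le_lt_trans h3 _|apply: le_lt_trans h4 _]; lra.
  have := dP _ pd; rewrite /=.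
  have := ler_norm (f 0 - f p); lra.
have ii := cone_integrable m2 a a0 _ f 0 weight1 pf.
have : (\int[lebesgue_tuple m]_y (1 * f ((0 : P).1 + row_of_tuple y, (0 : P).2 + a * enorm (row_of_tuple y)))%:E = 0)%E.
  have fn := integrable_fin_num measurableT ii.
  by move: Cf; rewrite coneE /Rintegral => h; rewrite -(fineK fn)/= h.
have mf := measurable_int _ ii.
move=> I0.
have /(ae_eq_integral_abs (lebesgue_tuple m) measurableT mf) : (\int[lebesgue_tuple m]_y `|(1 * f ((0 : P).1 + row_of_tuple y, (0 : P).2 + a * enorm (row_of_tuple y)))%:E| = 0)%E.
  rewrite -[RHS]I0; apply: eq_integral => y _; rewrite gee0_abs// lee_fin mul1r; exact: f0.
(* The nonnegative integrand vanishes outside the null set [N] but is positive on the cube, whose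
   measure [r ^+ m] is positive. *)
move=> [N [mN N0 subN]].
have : (lebesgue_tuple m (cube m r) <= lebesgue_tuple m N)%E.
  apply: le_measure; rewrite ?inE//; first exact: measurable_cube.
  move=> y cy; apply: subN => /= /(_ Logic.I) h; have := cubeP y cy.
  move: h => [] ; rewrite mul1r !add0r => ->; by rewrite ltxx.
rewrite lebesgue_tuple_cube// [X in (_ <= X)%E]N0 lee_fin.
by rewrite leNgt exprn_gt0.
Qed.

Lemma time_only_constant : exists2 K : R, K != 0 &
  forall f, past_smooth f -> time_only f -> C (iter m dt f) = fun p => K * f p.
Proof.
have trans_time q f : time_only f -> time_only (trans q f).
  by move=> tf p; rewrite /trans tf [RHS]tf/= .
(* All operators commute with translations, so the origin is enough. *)
have local K : (forall f, past_smooth f -> time_only f -> C (iter m dt f) 0 = K * f 0) ->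
    forall f, past_smooth f -> time_only f -> C (iter m dt f) = fun p => K * f p.
  move=> KP f pf tf; apply/funext => p.
  have := KP _ (past_smooth_trans p _ pf) (trans_time p _ tf).
  by rewrite (trans_iter_dt p m f pf) trans_cone /trans add0r.
(* This case distinction spares the construction of a cutoff function. If no such [e] exists,
   translation shows that every function in question is zero, and any nonzero [K] will do. *)
have [[e [pe te e0]]|ne] := pselect (exists e, [/\ past_smooth e, time_only e & e 0 != 0]); last first.
  have f0 f : past_smooth f -> time_only f -> f = fun=> 0.
    move=> pf tf; apply/funext => p; apply/eqP/negPn/negP => fp; apply: ne.
    exists (trans p f); split; [exact: past_smooth_trans|exact: trans_time|].
    by rewrite /trans add0r.
  exists 1; first exact: oner_neq0.
  apply: local => f pf tf.
  rewrite (f0 _ (past_smooth_iter_dt m _ pf) (time_only_iter_dt m _ tf)).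
  by rewrite (f0 f pf tf) cone0 mulr0.
pose K := C (iter m dt e) 0 / e 0.
have KP : forall f, past_smooth f -> time_only f -> C (iter m dt f) 0 = K * f 0.
  (* With this [c], [f - c e] vanishes at time 0, so it is [t * w], and commutation with [t] makes
     its image vanish at 0. *)
  move=> f pf tf; pose c := f 0 / e 0.
  pose h := fun p => f p - c * e p.
  have ph : past_smooth h by apply: past_smoothB => //; exact: past_smoothZ.
  have th : time_only h by move=> p; rewrite /h tf [e p]te.
  have h0 x : h (x, 0) = 0.
    by rewrite th /h /c /= -[(0, 0)]/(0 : P) divfK// subrr.
  have [w [pw hw tw]] := hadamard_time h ph h0.
  have : C (iter m dt h) 0 = 0.
    by rewrite hw (C_iter_dt_mult w pw (tw th)) /mult mul0r.
  rewrite (iter_dtB m c f e pf pe).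
  have pfm := past_smooth_iter_dt m _ pf; have pem := past_smooth_iter_dt m _ pe.
  rewrite (coneB m2 a a0 _ _ _ weight1 pfm (past_smoothZ c _ pem)) (coneZ m2 a a0 _ _ _ weight1 pem).
  move/eqP; rewrite subr_eq0 => /eqP ->; rewrite /K /c; ring.
exists K; last exact: local.
apply/eqP => K0.
(* If [K] were 0, then [d_t^m C (e^2) = 0], hence [C (e^2) = 0]; the square makes [cone_pos]
   applicable and gives [e 0 = 0]. *)
pose e2 p := e p * e p.
have pe2 : past_smooth e2 by apply: past_smoothM => //; exact: pe.1.
have te2 : time_only e2 by move=> p; rewrite /e2 te.
have E := local _ KP e2 pe2 te2.
have pz := @past_smooth0 R m.
have C0 : C e2 = fun=> 0.
  apply: (iter_dt_inj m) => //; first exact: past_smooth_cone.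
  rewrite (iter_dt_cone m _ _ weight1 pe2) E K0.
  have -> n : iter n dt ((fun=> 0) : P -> R) = (fun=> 0).
    by elim: n => // n IH; rewrite iterS IH dt0.
  by apply/funext => p; rewrite mul0r.
have := cone_pos e2 pe2 (fun p => _) (congr1 (fun F => F 0) C0).
rewrite /e2 => H; have /eqP := H (fun p => ltac:(by rewrite -expr2 sqr_ge0)).
by rewrite mulf_eq0 (negbTE e0).
Qed.

End time_only.

(** * The inversion identities *)

Section inversion.
Context {R : realType} {m : nat}.
Hypothesis m2 : (1 < m)%N.
Variables a b : R.
Hypotheses (a0 : 0 < a) (ba : b * a ^+ 2 = 1).
Local Notation P := ('rV[R]_m * R)%type.
Implicit Types (f g u : P -> R).

Local Notation C := (cone a (fun=> 1)).
Local Notation N1 := (cone a (fun v => (enorm v)^-1)).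

Lemma trans_dx q i u : past_smooth u -> dx i (trans q u) = trans q (dx i u).
Proof. by move=> pu; exact: trans_dirD pu.1. Qed.

Lemma trans_dt q u : past_smooth u -> dt (trans q u) = trans q (dt u).
Proof. by move=> pu; exact: trans_dirD pu.1. Qed.

Lemma trans_boxb q u : past_smooth u -> boxb b (trans q u) = trans q (boxb b u).
Proof.
move=> pu; have pt := past_smooth_dt _ pu.
have E1 : dt (dt (trans q u)) = trans q (dt (dt u)).
  by rewrite (trans_dt q u pu); exact: trans_dt.
have E2 : laplacian (trans q u) = trans q (laplacian u).
  have E i : dx i (dx i (trans q u)) = trans q (dx i (dx i u)).
    by rewrite (trans_dx q i u pu); apply: trans_dx; exact: past_smooth_dx.
  by apply/funext => p; apply: eq_bigr => i _; exact: (congr1 (fun F => F p) (E i)).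
by rewrite /boxb E1 E2.
Qed.

Lemma time_only_boxb u : time_only u -> boxb b u = dt (dt u).
Proof.
move=> tu; apply/funext => p; rewrite /boxb [laplacian u p]big1 ?mulr0 ?subr0// => i _.
rewrite (time_only_dx i u tu).
exact: derive_cst.
Qed.

Opaque cone dx dt dirD laplacian boxb.

Let weight1 := @cone_weight1 R m.
Let weight_inv := @cone_weight_inv R m.

Lemma trans_iter_boxb q n u : past_smooth u ->
  iter n (boxb b) (trans q u) = trans q (iter n (boxb b) u).
Proof.
move=> pu; elim: n => [|n IH]; first by [].
have pn := past_smooth_iter_boxb b n _ pu.
rewrite !iterS IH.
exact: trans_boxb pn.
Qed.

Lemma time_only_iter_boxb n u : time_only u ->
  iter n (boxb b) u = iter (n + n) dt u.
Proof.
move=> tu; elim: n => // n IH; rewrite iterS IH addSn addnS !iterS.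
exact: time_only_boxb (time_only_iter_dt _ _ tu).
Qed.

Lemma double_coneE : exists2 K : R, K != 0 &
  forall u, past_smooth u -> double_cone a b u = fun p => K * dt (dt u) p.
Proof.
have [K K0 KP] := time_only_constant m2 a a0.
exists (K * K); first by rewrite mulf_neq0.
have timeE u : past_smooth u -> time_only u ->
    double_cone a b u = fun p => K * K * dt (dt u) p.
  move=> pu tu; rewrite /double_cone (time_only_iter_boxb m.+1 u tu).
  (* Each of the two cones absorbs [m] time derivatives into a factor [K], and two derivatives
     remain. *)
  have -> : (m.+1 + m.+1 = m + (m + 2))%N by rewrite addSnnS -addn2.
  rewrite iterD (iterD m).
  set w := iter 2 dt u.
  have pw : past_smooth w by exact: past_smooth_iter_dt.
  have tw : time_only w by exact: time_only_iter_dt.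
  rewrite (KP _ (past_smooth_iter_dt m _ pw) (time_only_iter_dt m _ tw)).
  rewrite (coneZ m2 a a0 _ _ _ weight1 (past_smooth_iter_dt m _ pw)) (KP _ pw tw).
  by apply/funext => p; rewrite mulrA.
have add (u v : P -> R) : past_smooth u -> past_smooth v ->
    double_cone a b (fun p => u p - v p) = fun p => double_cone a b u p - double_cone a b v p.
  move=> pu pv; rewrite /double_cone (iter_boxbB b m.+1 u v pu pv).
  have pbu := past_smooth_iter_boxb b m.+1 _ pu; have pbv := past_smooth_iter_boxb b m.+1 _ pv.
  rewrite (coneB m2 a a0 _ _ _ weight1 pbu pbv).
  by rewrite (coneB m2 a a0 _ _ _ weight1 (past_smooth_C m2 a a0 _ pbu) (past_smooth_C m2 a a0 _ pbv)).
(* Split [u] into [u (0, t)] and a sum of terms [x_i w_i]. Both operators commute with [x_i], so at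
   the origin they see only the first part. *)
have at0 u : past_smooth u -> double_cone a b u 0 = K * K * dt (dt u) 0.
  move=> pu; have [w [pw uw]] := hadamard_space u pu.
  pose r p := u p - \sum_i mulx i (w i) p.
  have pmw i : past_smooth (mulx i (w i)) by exact: past_smooth_mulx.
  have ps := past_smooth_sum m _ pmw.
  have pr : past_smooth r by exact: past_smoothB.
  have rE p : r p = u (0, p.2) by rewrite /r [u p]uw addrK.
  have tr : time_only r by move=> p; rewrite !rE.
  have H : double_cone a b r 0 = K * K * dt (dt r) 0 by rewrite (timeE r pr tr).
  have E n (F : 'I_n -> P -> R) v : past_smooth v -> (forall i, past_smooth (F i)) ->
      (forall i, double_cone a b (F i) 0 = 0) ->
      double_cone a b (fun p => v p - \sum_i F i p) 0 = double_cone a b v 0.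
    elim: n F v => [|n IH] F v pv pF F0.
      apply: (congr1 (fun G => double_cone a b G 0)).
      by apply/funext => p; rewrite big_ord0 subr0.
    have -> : (fun p => v p - \sum_i F i p) =
        fun p => (fun p => v p - F ord0 p) p - \sum_(i < n) F (lift ord0 i) p.
      by apply/funext => p; rewrite big_ord_recl opprD addrA.
    apply: etrans (IH (fun i => F (lift ord0 i)) (fun p => v p - F ord0 p) _ _ _) _.
    - exact: past_smoothB.
    - by move=> i; exact: pF.
    - by move=> i; exact: F0.
    - apply: etrans (congr1 (fun G => G 0) (add _ _ pv (pF ord0))) _.
      by rewrite F0 subr0.
  have s0 : double_cone a b r 0 = double_cone a b u 0.
    apply: E => // i; rewrite (double_cone_mulx m2 a b a0 ba i _ (pw i)).
    by rewrite /mulx mxE mul0r.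
  have d0 : dt (dt (fun p => \sum_i mulx i (w i) p)) 0 = 0.
    have dts n (F : 'I_n -> P -> R) : (forall i, past_smooth (F i)) ->
      dt (fun p => \sum_(i < n) F i p) = fun p => \sum_(i < n) dt (F i) p.
      exact: dirD_sum.
    rewrite (dts m _ pmw) (dts m _ (fun i => past_smooth_dt _ (pmw i))).
    apply: big1 => i _; rewrite (dt_mulx i _ (pw i)) (dt_mulx i _ (past_smooth_dt _ (pw i))).
    by rewrite /mulx mxE mul0r.
  have dr : dt (dt r) 0 = dt (dt u) 0.
    rewrite /r (dtB _ _ pu.1 ps.1) (dtB _ _ (past_smooth_dt _ pu).1 (past_smooth_dt _ ps).1).
    by rewrite d0 subr0.
  exact: etrans (esym s0) (etrans H (congr1 (fun z => K * K * z) dr)).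
move=> u pu; apply/funext => p.
have E1 : double_cone a b (trans p u) = trans p (double_cone a b u).
  apply: etrans (congr1 (fun F => C (C F)) (trans_iter_boxb p m.+1 u pu)) _.
  exact: etrans (congr1 (fun F => C F) (trans_cone _ p _ _)) (trans_cone _ p _ _).
have E2 : dt (dt (trans p u)) = trans p (dt (dt u)).
  by rewrite (trans_dt p u pu); apply: trans_dt; exact: past_smooth_dt.
have := at0 _ (past_smooth_trans p _ pu); rewrite E1 E2 /trans.
by rewrite add0r.
Qed.

Let m1 : m%:R - 1 != 0 :> R.
Proof. by rewrite subr_eq0 pnatr_eq1 gtn_eqF. Qed.

Let c0 : - (a / (m%:R - 1)) != 0.
Proof. by rewrite oppr_eq0 mulf_neq0// ?invr_eq0// gt_eqF. Qed.

(** [dt] moves inside to [N1], where [cone_inv_dt] trades it for a further [boxb] under [C]: the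
    power rises from [m] to [m.+1], as [double_coneE] requires. *)
Lemma dt_iter_box_cone_inv u : past_smooth u ->
  dt (iter m (boxb b) (N1 u)) = fun p => - (a / (m%:R - 1)) * C (iter m.+1 (boxb b) u) p.
Proof.
move=> pu; have pN := past_smooth_cone m2 a a0 _ _ weight_inv pu.
have -> : dt (iter m (boxb b) (N1 u)) = iter m (boxb b) (dt (N1 u)).
  exact: iter_boxb_dirD.
rewrite (dt_cone m2 a a0 _ _ weight_inv pu) (cone_inv_dt m2 a b a0 ba u pu).
have pb := past_smooth_boxb b _ pu.
rewrite (iter_boxbZ b m _ _ (past_smooth_C m2 a a0 _ pb)).
by rewrite (iter_boxb_cone m2 a a0 b m _ _ weight1 pb) -iterSr.
Qed.

(** Both parts are read off after one [dt], which produces [C (iter m.+1 (boxb b) u)]. For the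
    second part, a further [C] gives [dt (dt u) = 0], and [dt_inj] applies twice. *)
Lemma box_cone_inv_cone : exists2 K : R, K != 0 &
  (forall u, past_smooth u -> iter m (boxb b) (N1 (C u)) = fun p => K * dt u p) /\
  (forall u, past_smooth u -> iter m (boxb b) (N1 u) = (fun=> 0) -> u = fun=> 0).
Proof.
have [K K0 KP] := double_coneE.
exists (- (a / (m%:R - 1)) * K); first by rewrite mulf_neq0.
split=> u pu.
  have pC := past_smooth_C m2 a a0 _ pu.
  apply: dt_inj.
  - by apply: past_smooth_iter_boxb; exact: past_smooth_cone.
  - by apply: past_smoothZ; exact: past_smooth_dt.
  rewrite (dt_iter_box_cone_inv _ pC) (dtZ _ _ (past_smooth_dt _ pu).1).
  rewrite (iter_boxb_cone m2 a a0 b m.+1 _ _ weight1 pu).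
  apply/funext => p; have := congr1 (fun F => F p) (KP u pu).
  by rewrite /double_cone => ->; rewrite mulrA.
move=> E; have := dt_iter_box_cone_inv _ pu.
rewrite E dt0 => E1.
have Cz : C (iter m.+1 (boxb b) u) = fun=> 0.
  apply/funext => p; have := congr1 (fun F => F p) E1.
  by move=> /esym/eqP; rewrite mulf_eq0 (negbTE c0) => /eqP.
have pz := @past_smooth0 R m.
have E2 : dt (dt u) = dt (dt (fun=> 0)).
  apply/funext => p; have := congr1 (fun F => F p) (KP u pu).
  rewrite /double_cone Cz cone0 !dt0 => /esym/eqP.
  by rewrite mulf_eq0 (negbTE K0) => /eqP.
exact: (dt_inj _ _ pu pz (dt_inj _ _ (past_smooth_dt _ pu) (past_smooth_dt _ pz) E2)).
Qed.

End inversion.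

(** * Supports and the range *)

Section supports.
Context {R : realType} {m : nat}.
Local Notation P := ('rV[R]_m * R)%type.
Implicit Types (f g h u : P -> R).
Local Notation mu := (@lebesgue_measure R).

Lemma closed_norm_le (B : R) : closed [set q : P | `|q| <= B].
Proof.
apply: (@closed_comp _ _ (fun q : P => `|q|) [set t | t <= B]).
  by move=> q _; exact: norm_continuous.
exact: closed_le.
Qed.

Lemma compactly_supportedP f :
  compactly_supported f <-> exists B, forall p, f p != 0 -> `|p| <= B.
Proof.
split=> [cf|[B fB]].
  have [M [Mr MP]] := compact_bounded cf.
  exists (M + 1) => p fp; apply: (MP (M + 1)); first by rewrite ltrDl.
  exact: subset_closure.
apply: subclosed_compact (compact_norm_le B) _; first exact: closed_closure.
rewrite /supp [X in _ `<=` X](closure_id _).1; last exact: closed_norm_le.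
by apply: closureS => p; exact: fB.
Qed.

Lemma compactly_supported_past f : smooth f -> compactly_supported f -> past_smooth f.
Proof.
move=> sf /compactly_supportedP[B fB]; split=> //; exists B => p pB.
apply/eqP; apply: contraTT pB => /fB; rewrite prod_normE ge_max => /andP[_ h].
by rewrite -leNgt; exact: le_trans (ler_norm _) h.
Qed.

Lemma supp_halfspace_past f (t0 : R) : smooth f -> supp f `<=` halfspace t0 -> past_smooth f.
Proof.
move=> sf ft; split=> //; exists t0 => p pt; apply/eqP; apply: contraTT pt => fp.
by rewrite -leNgt; apply: ft; exact: subset_closure.
Qed.

Lemma past_smooth_supp f : past_smooth f -> exists t0 : R, supp f `<=` halfspace t0.
Proof.
move=> [_ [t0 f0]]; exists t0.
have ch : closed (@halfspace R m t0).
  apply: (@closed_comp _ _ (snd : P -> R) [set t | t <= t0]).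
    by move=> q _; exact: cvg_snd.
  exact: closed_le.
rewrite [X in _ `<=` X](closure_id _).1//; apply: closureS => p /= fp.
by rewrite /halfspace /= leNgt; apply: contraNN fp => /f0 ->; rewrite eqxx.
Qed.

Lemma derive_eq0_outside f (v : P) B : (forall p, f p != 0 -> `|p| <= B) ->
  forall p, 'D_v f p != 0 -> `|p| <= B.
Proof.
move=> fB p; apply: contraNT; rewrite -ltNge => Bp; apply/eqP.
have E : \forall q \near p, f q = cst 0 q.
  have /cvgr_gt/(_ B Bp) := @norm_continuous _ P p.
  apply: filterS => q Bq; apply/eqP; apply: contraTT Bq => /fB.
  by rewrite -leNgt.
by rewrite (near_eq_derive v E) derive_cst.
Qed.

Definition half_line_weight (s : R) : R := \1_([set s : R | 0 <= s]) s.

(** The integral of [h (x, s)] over [s >= t]: the primitive of [- h] in time that vanishes at late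
    times. *)
Definition future_integral h : P -> R :=
  avg mu (fun=> 1) (fun=> 1) id (fun=> 0) half_line_weight h.

Lemma measurable_half_line_weight : measurable_fun setT half_line_weight.
Proof.
apply: measurable_indic.
rewrite (_ : [set s : R | 0 <= s] = [set` `[0, +oo[]); first exact: measurable_itv.
by apply/seteqP; split=> s /=; rewrite in_itv/= andbT.
Qed.

Lemma half_line_weight_neq0 s : half_line_weight s != 0 -> 0 <= s.
Proof.
rewrite /half_line_weight indicE; case: (boolP (s \in _)) => [|_]; last by rewrite eqxx.
by rewrite inE.
Qed.

Lemma half_line_admissible : admissible mu (fun=> 1) (fun=> 1) id (fun=> 0 : 'rV[R]_m)
  half_line_weight.
Proof.
split; first exact: measurable_half_line_weight.
  by move=> s _; rewrite normr1.
(* If [p] is within 1 of [p0] and [p.2 + s <= t0], then [s <= r]. *)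
move=> p0 t0; pose r := `|t0| + `|p0| + 1.
have r0 : 0 <= r by rewrite !addr_ge0.
exists (fun s => \1_([set` `[- r, r]]) s), (`|p0| + 1 + r); split.
- apply/integrableP; split.
    by apply/measurable_EFinP; apply: measurable_indic; exact: measurable_itv.
  rewrite (_ : \int[mu]_x _ = \int[mu]_x (\1_([set` `[- r, r]%R]) x)%:E)%E; last first.
    by apply: eq_integral => x _; rewrite gee0_abs// lee_fin indicE ler0n.
  rewrite integral_indic//.
  have E := @lebesgue_measure_itv R `[- r, r]; rewrite setIT.
  apply: le_lt_trans (_ : (_ <= (r - - r)%:E)%E) (ltry _).
  rewrite [leLHS]E /=; case: ifP => _; first by rewrite -EFinB.
  by rewrite lee_fin opprK addr_ge0.
- by move=> s; rewrite indicE ler0n.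
have : \forall p \near p0, `|p - p0| < 1.
  by have /cvgrPdistC_lt := @cvg_id _ (nbhs p0); apply.
apply: filterS => p pp s /half_line_weight_neq0 s0; rewrite /aff /= mul1r scale1r addr0 => pt.
have : `|p - p0| < 1 by [].
rewrite prod_normE/= gt_max => /andP[pp1 pp2].
have [n1 n2] : `|p0.1| <= `|p0| /\ `|p0.2| <= `|p0|.
  by rewrite [`|p0|]prod_normE !le_max !lexx orbT.
have sr : s <= r.
  move: pp2; rewrite ltr_distl => /andP[h1 h2].
  have := ler_norm t0; have := ler_norm (- p0.2); rewrite normrN /r; lra.
split.
  rewrite /half_line_weight !indicE !mem_set ?normr1//= in_itv/= sr andbT.
  by rewrite (le_trans _ s0)// oppr_le0.
rewrite prod_normE/= ge_max; apply/andP; split.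
  by have := ler_normD (p.1 - p0.1) p0.1; rewrite subrK; lra.
have := ler_normD (p.2 - p0.2 + p0.2) s; rewrite subrK.
have := ler_normD (p.2 - p0.2) p0.2; rewrite subrK (ger0_norm s0); lra.
Qed.

Let mid : measurable_fun setT (id : R -> R). Proof. exact: measurable_id. Qed.
Let m1 : measurable_fun setT ((fun=> 1) : R -> R).
Proof. exact: measurable_cst. Qed.

Lemma past_smooth_future h : past_smooth h -> past_smooth (future_integral h).
Proof.
move=> ph; split.
  exact: (smooth_avg mu (fun=> 1) (fun=> 1) id (fun=> 0) m1 m1 mid
    (fun i => measurable_cst _) half_line_weight h half_line_admissible ph).
apply: avg_zero_past ph => p s /half_line_weight_neq0 s0.
by rewrite /aff /= mul1r lerDl.
Qed.

Lemma future_integralE h p : future_integral h p =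
  \int[mu]_s (half_line_weight s * h (p.1, p.2 + s)).
Proof. by apply: eq_Rintegral => s _; rewrite /aff /= scale1r mul1r addr0. Qed.

Lemma integral_half_line_derive (F k : R -> R) (S : R) : 0 < S ->
  (forall s : R, is_derive s 1 F (k s)) -> continuous k ->
  (forall s, S < s -> k s = 0) ->
  \int[mu]_s (half_line_weight s * k s) = F S - F 0.
Proof.
move=> S0 dF ck k0.
have E : (\int[mu]_(s in [set` `[0%R, S]]) (k s)%:E = (F S - F 0)%R%:E)%E.
  rewrite EFinB; apply: continuous_FTC2 => //.
  - exact: continuous_subspaceT.
  - split.
    + by move=> x _; exact: ex_derive.
    + by apply: cvg_at_right_filter; exact: is_derive_continuous.
    + by apply: cvg_at_left_filter; exact: is_derive_continuous.
  - by move=> x _; rewrite derive1E; exact: derive_val.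
apply: (@congr1 _ _ fine _ (EFin (F S - F 0))).
rewrite -E [RHS]integral_mkcond; apply: eq_integral => s _.
rewrite patchE /half_line_weight indicE; case: ifPn => sI.
  by rewrite mem_set ?mul1r//=; move: sI; rewrite inE /= in_itv/= => /andP[].
have [s0|s0] := leP 0 s; last by rewrite memNset ?mul0r//=; apply/negP; rewrite -ltNge.
rewrite k0 ?mulr0// ltNge; apply: contraNN sI => sS.
by rewrite inE /= in_itv/= s0.
Qed.

Lemma is_derive_time h (x : 'rV[R]_m) (t s : R) : smooth h ->
  is_derive s 1 (fun s => h (x, t + s)) (dt h (x, t + s)).
Proof.
move=> sh.
have E (r : R) : (x, t) + r *: (0, 1) = (x, t + r) :> P.
  by congr pair; rewrite /= ?scaler0 ?addr0// /GRing.scale/= mulr1.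
have := is_derive_line h (x, t) (0, 1) s (smooth_derivable _ _ _ sh).
by rewrite E; congr (is_derive _ _ _ _); apply/funext => s'; rewrite E.
Qed.

Lemma continuous_time h (x : 'rV[R]_m) (t : R) : continuous h ->
  continuous (fun s : R => h (x, t + s)).
Proof.
move=> ch s; apply: (@continuous_comp _ _ _ (fun s : R => (x, t + s)) h); last exact: ch.
apply: (@cvg_pair _ _ _ _ (nbhs _) (nbhs _)); first exact: cvg_cst.
by apply: cvgD; [exact: cvg_cst|exact: cvg_id].
Qed.

(** Differentiation falls on [h] under the integral, and the fundamental theorem is applied up to a
    time [S] after which [h] and [dt h] both vanish. *)
Lemma dt_future h : past_smooth h -> dt (future_integral h) = fun p => - h p.
Proof.
move=> ph; apply/funext => -[x t].
have pt := past_smooth_dt _ ph.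
have D := avg_is_derive mu (fun=> 1) (fun=> 1) id (fun=> 0) m1 m1 mid
    (fun i => measurable_cst _) half_line_weight h (x, t) 0 1 half_line_admissible ph.
rewrite [LHS](@derive_val _ _ _ _ _ _ _ D).
have -> : avg mu (fun=> 1) (fun=> 1) id (fun=> 0) (fun y => half_line_weight y * 1)
    ('D_(0, 0) h) (x, t) = 0.
  rewrite /avg; under eq_Rintegral do rewrite derive0 mulr0.
  by rewrite Rintegral_cst// mul0r.
rewrite add0r.
have [t0 h0] := ph.2; have [t1 d0] := pt.2.
pose S := `|t0| + `|t1| + `|t| + 1.
have S0 : 0 < S by rewrite ltr_pwDr// !addr_ge0.
have big s : S <= s -> t0 < t + s /\ t1 < t + s.
  rewrite /S => Ss; have := ler_norm t0; have := ler_norm t1.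
  have := ler_norm (- t); rewrite normrN.
  by have := normr_ge0 t0; have := normr_ge0 t1; split; lra.
have := integral_half_line_derive (fun s => h (x, t + s)) (fun s => dt h (x, t + s)) S S0
  (fun s => is_derive_time h x t s ph.1) (continuous_time _ x t (smooth_continuous _ pt.1))
  (fun s Ss => d0 (x, t + s) (big s (ltW Ss)).2).
rewrite h0 ?sub0r ?addr0; last exact: (big S (lexx _)).1.
move=> <-; apply: eq_Rintegral => s _.
by rewrite /aff /= mul1r scale1r addr0 mulr1.
Qed.

(** Outside the ball there are three cases. For [|x| > B] the whole vertical line avoids the support
    of [h]; for [t > B] its future part does; for [t < - B] the future integral is the full integral
    over the line, zero by hypothesis. Condition (ii) of the theorem serves here. *)
Lemma future_integral_supp h B : past_smooth h -> (forall p, h p != 0 -> `|p| <= B) ->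
  (forall x : 'rV[R]_m, \int[mu]_t h (x, t) = 0) ->
  forall p, future_integral h p != 0 -> `|p| <= B.
Proof.
move=> ph hB ih [x t].
have pF := past_smooth_future _ ph.
apply: contraNT; rewrite -ltNge => Bp; apply/eqP.
have [xB|xB] := ltP B `|x|.
  rewrite future_integralE; under eq_Rintegral.
    move=> s _; rewrite (_ : h _ = 0); last first.
      apply/eqP; apply: contraTT xB => /hB; rewrite prod_normE/= ge_max -leNgt.
      by move=> /andP[].
    rewrite mulr0; over.
  by rewrite Rintegral_cst// mul0r.
have tB : B < `|t| by move: Bp; rewrite prod_normE/= lt_max ltNge xB.
have B0 : 0 <= B by exact: le_trans (normr_ge0 _) xB.
have ht s : B < `|s| -> h (x, s) = 0.
  move=> sB; apply/eqP; apply: contraTT sB => /hB; rewrite prod_normE/= ge_max -leNgt.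
  by move=> /andP[].
have [t0 F0] := pF.2.
have [tp|tn] := leP 0 t.
  rewrite future_integralE; under eq_Rintegral.
    move=> s _; rewrite (_ : _ * _ = 0); last first.
      have [->|/half_line_weight_neq0 s0] := eqVneq (half_line_weight s) 0; first by rewrite mul0r.
      rewrite /= ht ?mulr0// ger0_norm ?addr_ge0//.
      by move: tB; rewrite ger0_norm//; lra.
    over.
  by rewrite Rintegral_cst// mul0r.
(* Late enough for both [h] and its future integral to vanish, so the integral over [[t, T]] is at
   once the full one and the value of [future_integral h] at [(x, t)]. *)
pose T := `|t0| + B + 1.
have tT : t < T by rewrite (lt_le_trans tn)// !addr_ge0.
have D (s : R) : is_derive s 1 (fun s => - future_integral h (x, s)) (h (x, s)).
  have := is_derive_time _ x 0 s pF.1; rewrite dt_future// !add0r.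
  under [X in is_derive _ _ X _]eq_fun do rewrite add0r.
  by move=> /is_deriveN; rewrite opprK.
have ch : continuous (fun s => h (x, s)).
  have := continuous_time h x 0 (smooth_continuous _ ph.1).
  by under [X in continuous X]eq_fun do rewrite add0r.
have k0 s : ~~ (t <= s <= T) -> h (x, s) = 0.
  rewrite negb_and -!ltNge => /orP[st|Ts]; apply: ht.
    by rewrite ltr0_norm ?(lt_trans st)//; move: tB; rewrite ltr0_norm//; lra.
  have T0 : B < T by rewrite /T ltr_pwDr// lerDr.
  by rewrite (lt_trans T0)// (lt_le_trans Ts)// ler_norm.
have I := integral_derive_supp _ (fun s => h (x, s)) t T tT D ch k0.
have := ih x; rewrite /Rintegral I /= F0 ?oppr0 ?sub0r ?opprK//=.
by rewrite /T; have := ler_norm t0; lra.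
Qed.

End supports.

(** * The range of the conical transform *)

Section conical_range.
Context {R : realType} {m : nat}.
Hypothesis m2 : (1 < m)%N.
Variable phi : R.
Hypotheses (phi0 : 0 < phi) (phi1 : phi < pi / 2).
Local Notation P := ('rV[R]_m * R)%type.
Implicit Types (f g h u : P -> R).

Lemma cot_gt0 : 0 < cot phi.
Proof.
rewrite /cot invr_gt0 /tan divr_gt0//.
  by rewrite sin_gt0_pi// phi0 (lt_trans phi1)// ltr_pdivrMr// ltr_pMr ?pi_gt0// ltr1n.
by rewrite cos_gt0_pihalf// phi1 andbT (lt_trans _ phi0)// oppr_lt0 divr_gt0 ?pi_gt0.
Qed.

Lemma tan_cot : tan phi ^+ 2 * cot phi ^+ 2 = 1.
Proof.
by rewrite -exprMn /cot mulfV ?expr1n// -invr_eq0 gt_eqF// cot_gt0.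
Qed.

Lemma conicalE f : conical phi f = cone (cot phi) (fun=> 1) f.
Proof.
by apply/funext => p; rewrite coneE; apply: eq_Rintegral => y _; rewrite mul1r.
Qed.

Lemma conical1E f : past_smooth f ->
  conical1 phi f = fun p => (Num.sqrt 2 * cot phi)^-1 * cone (cot phi) (fun v => (enorm v)^-1) f p.
Proof.
move=> pf; apply/funext => p; rewrite coneE.
rewrite -(RintegralZl _ measurableT (cone_integrable m2 _ cot_gt0 _ f p cone_weight_inv pf)).
by apply: eq_Rintegral => y _ /=; rewrite mulrC [X in X * _]invfM mulrA.
Qed.

End conical_range.

Theorem theorem6 (R : realType) (phi : R) (k : nat)
    (g : 'rV[R]_(2 * k) * R -> R) :
  0 < phi -> phi < pi / 2 -> (1 <= k)%N -> smooth g ->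
  ((exists f : 'rV[R]_(2 * k) * R -> R,
      [/\ smooth f, compactly_supported f & g = conical phi f])
   <->
   (let h := iter (2 * k) (box phi) (conical1 phi g) in
    [/\ compactly_supported h,
        forall x : 'rV[R]_(2 * k), \int[lebesgue_measure]_t h (x, t) = 0
      & exists t0 : R, supp g `<=` halfspace t0])).
Proof.
move=> phi0 phi1 k1 sg; move: (2 * k)%N (leq_mul2l 2 1 k) g sg => m /= m2 g sg.
have {}m2 : (1 < m)%N by rewrite m2.
have a0 := cot_gt0 phi phi0 phi1; have ba := tan_cot phi phi0 phi1.
set a := cot phi in a0 ba; set b := tan phi ^+ 2 in ba.
have [K K0 [inv uniq]] := box_cone_inv_cone m2 a b a0 ba.
(* Normalisation of [conical1] relative to the cone transform with weight [1 / |v|]. *)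
pose c := (Num.sqrt 2 * a)^-1.
have c0 : c != 0 by rewrite invr_eq0 mulf_neq0 ?gt_eqF// sqrtr_gt0.
have weight_inv := @cone_weight_inv R m.
have iterE (u : 'rV[R]_m * R -> R) : past_smooth u -> iter m (box phi) (conical1 phi u) =
    fun p => c * iter m (boxb b) (cone a (fun v => (enorm v)^-1) u) p.
  move=> pu; rewrite (conical1E m2 phi phi0 phi1 u pu).
  exact: iter_boxbZ (past_smooth_cone m2 a a0 _ _ weight_inv pu).
split=> [[f [sf cf gE]]|].
  have pf := compactly_supported_past f sf cf.
  have [B fB] := (compactly_supportedP f).1 cf.
  have pg : past_smooth g.
    by rewrite gE conicalE; exact: past_smooth_C m2 a a0 f pf.
  (* As a multiple of [dt f], this function inherits the compact support of [f], and its integral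
     over each vertical line is zero. *)
  have hE : iter m (box phi) (conical1 phi g) = fun p => c * (K * dt f p).
    rewrite (iterE g pg); apply/funext => p; congr (_ * _).
    by rewrite gE conicalE; exact: (congr1 (fun F : _ -> R => F p) (inv f pf)).
  split.
  - rewrite hE; apply/compactly_supportedP; exists B => p.
    rewrite !mulf_eq0 !negb_or => /andP[_ /andP[_]].
    exact: derive_eq0_outside f _ B fB p.
  - move=> x; rewrite hE.
    pose F t := c * (K * f (x, t)).
    have dF (t : R) : is_derive t 1 F (c * (K * dt f (x, t))).
      have := is_derive_time f x 0 t sf; rewrite add0r.
      under [X in is_derive _ _ X _]eq_fun do rewrite add0r.
      by move=> H; apply: is_deriveZ; exact: is_deriveZ.
    have cF : continuous (fun t => c * (K * dt f (x, t))).
      move=> t; apply: cvgM; first exact: cvg_cst.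
      apply: cvgM; first exact: cvg_cst.
      have := continuous_time (dt f) x 0 (smooth_continuous _ (past_smooth_dt _ pf).1) t.
      by rewrite /continuous_at add0r; under eq_fun do rewrite add0r.
    pose S := `|B| + 1.
    have f0 t : S <= `|t| -> f (x, t) = 0.
      move=> St; apply/eqP; apply: contraTT St => /fB; rewrite prod_normE/= ge_max -ltNge.
      by move=> /andP[_ tB]; rewrite (le_lt_trans tB)// /S; have := ler_norm B; lra.
    have d0 t : ~~ (- S <= t <= S) -> c * (K * dt f (x, t)) = 0.
      rewrite -ler_norml -ltNge => St.
      suff -> : dt f (x, t) = 0 by rewrite !mulr0.
      apply/eqP; apply: contraTT St => /(derive_eq0_outside f _ B fB).
      rewrite prod_normE/= ge_max -leNgt => /andP[_ tB].
      by rewrite (le_trans tB)// /S; have := ler_norm B; lra.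
    have SS : - S < S by rewrite /S; have := normr_ge0 B; lra.
    have := integral_derive_supp F _ (- S) S SS dF cF d0.
    rewrite /F !f0 ?mulr0 ?subrr ?normrN ?ger0_norm ?addr_ge0// => I.
    by rewrite /Rintegral I.
  - exact: past_smooth_supp.
move=> [ch ih [t0 gt]].
have pg := supp_halfspace_past g t0 sg gt.
set h := iter _ _ _ in ch ih.
have hE : h = fun p => c * iter m (boxb b) (cone a (fun v => (enorm v)^-1) g) p by exact: iterE.
have pN : past_smooth (cone a (fun v => (enorm v)^-1) g).
  exact: past_smooth_cone m2 a a0 _ _ weight_inv pg.
have ph : past_smooth h.
  by rewrite hE; apply: past_smoothZ; exact: past_smooth_iter_boxb.
have [B hB] := (compactly_supportedP h).1 ch.
(* The solution of [h = c K d_t f] that vanishes at late times. *)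
pose f p := - (c * K)^-1 * future_integral h p.
have cK : c * K != 0 by rewrite mulf_neq0.
have pF := past_smooth_future h ph.
have pf : past_smooth f by exact: past_smoothZ.
have dtf : dt f = fun p => (c * K)^-1 * h p.
  rewrite /f (dtZ _ _ pF.1) (dt_future h ph); apply/funext => p.
  by rewrite mulrN mulNr opprK.
exists f; split.
- exact: pf.1.
- apply/compactly_supportedP; exists B => p; rewrite /f mulf_eq0 negb_or => /andP[_].
  exact: future_integral_supp h B ph hB ih p.
- rewrite conicalE.
  have pC := past_smooth_C m2 a a0 f pf.
  (* [[]^m N] maps [g] to [c^-1 h] and [C f] to [K d_t f], which is also [c^-1 h]; its injectivity
     gives [w = 0]. *)
  pose w p := g p - cone a (fun=> 1) f p.
  have pw : past_smooth w by exact: past_smoothB.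
  have : w = fun=> 0.
    apply: uniq => //; rewrite /w (coneB m2 a a0 _ _ _ weight_inv pg pC).
    have pNC := past_smooth_cone m2 a a0 _ _ weight_inv pC.
    rewrite (iter_boxbB b m _ _ pN pNC) (inv f pf) dtf.
    apply/funext => p; rewrite (congr1 (fun F : _ -> R => F p) hE).
    move: (iter m _ _ p) => z; rewrite invfM; by field; rewrite K0 c0.
  move=> w0; apply/funext => p; apply/eqP; rewrite -subr_eq0; apply/eqP.
  exact: (congr1 (fun F : _ -> R => F p) w0).
Qed.
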